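(* Deciding consistency (i.e. whether $\mathrm{Mod}(\mathcal{K}) \neq \emptyset$) of a statistical $\mathcal{EL}$ knowledge base $\mathcal{K}$ is in NExpTime.
   Context: $\mathcal{EL}$ concepts over disjoint sets $N_C$, $N_R$ are built by $C ::= A \mid \top \mid C \sqcap C \mid \exists r.C$, with standard set semantics. Interpretations $\mathcal{I} = (\Delta^{\mathcal{I}}, \cdot^{\mathcal{I}})$ have a non-empty finite domain; $[X]^{\mathcal{I}} := |X^{\mathcal{I}}|$. A conditional is $(C \mid D)[\ell,u]$ with concepts $C,D$ and rationals $0 \le \ell \le u \le 1$; $\mathcal{I} \models (C \mid D)[\ell,u]$ iff $[D]^{\mathcal{I}} = 0$ or $[C \sqcap D]^{\mathcal{I}}/[D]^{\mathcal{I}} \in [\ell,u]$. A statistical $\mathcal{EL}$ knowledge base is a finite set of conditionals over $\mathcal{EL}$ concepts (GCIs $C \sqsubseteq D$ being shorthand for $(D \mid C)[1,1]$); $\mathrm{Mod}(\mathcal{K})$ is the set of finite interpretations satisfying all of them. Complexity is measured in the size of $\mathcal{K}$ with rationals encoded in binary. *)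

(* Defs.v *)
From HB Require Import structures.
From mathcomp Require Import all_boot all_order all_algebra.
From Stdlib Require List.
Set Implicit Arguments. Unset Strict Implicit. Unset Printing Implicit Defensive.
Import Order.TTheory GRing.Theory Num.Theory.

(* EL concepts. Concept names N_C and role names N_R are both copies  *)
(* of nat (countably infinite, disjoint since used in different       *)
(* constructors / fields).                                            *)
Inductive concept : Type :=
  | CName of nat
  | CTop
  | CAnd of concept & concept
  | CEx of nat & concept.

Record conditional : Type := Cond {
  cond_C : concept; cond_D : concept; cond_l : rat; cond_u : rat }.

Definition wf_cond (k : conditional) : Prop :=
  (0 <= cond_l k)%R /\ (cond_l k <= cond_u k)%R /\ (cond_u k <= 1)%R.

Definition kb := seq conditional.
Definition wf_kb (K : kb) : Prop := forall k, List.In k K -> wf_cond k.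

Definition GCI (C D : concept) : conditional := Cond D C 1%R 1%R.

(* Finite interpretations: domain is a finType (nonemptiness imposed   *)
(* separately).                                                        *)
Record interp (Δ : finType) := Interp {
  conc : nat -> pred Δ;
  role : nat -> rel Δ }.

Fixpoint ext (Δ : finType) (I : interp Δ) (c : concept) : pred Δ :=
  match c with
  | CName a => conc I a
  | CTop => predT
  | CAnd c1 c2 => fun x => ext I c1 x && ext I c2 x
  | CEx r c1 => fun x => [exists y, role I r x y && ext I c1 y]
  end.

Definition card_ext (Δ : finType) (I : interp Δ) (c : concept) : nat :=
  #|[pred x | ext I c x]|.

Definition sat_cond (Δ : finType) (I : interp Δ) (k : conditional) : Prop :=
  card_ext I (cond_D k) = 0%N \/
  ((cond_l k <= (card_ext I (CAnd (cond_C k) (cond_D k)))%:R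
                 / (card_ext I (cond_D k))%:R)%R
   /\ ((card_ext I (CAnd (cond_C k) (cond_D k)))%:R
                 / (card_ext I (cond_D k))%:R <= cond_u k)%R).

Definition is_model (Δ : finType) (I : interp Δ) (K : kb) : Prop :=
  forall k, List.In k K -> sat_cond I k.

Definition consistent (K : kb) : Prop :=
  exists (Δ : finType) (I : interp Δ), (0 < #|Δ|)%N /\ is_model I K.

Fixpoint bits_aux (fuel n : nat) : seq bool :=
  match fuel with
  | 0 => [::]
  | f.+1 => if n == 0 then [::] else odd n :: bits_aux f n./2
  end.
Definition nat_bits (n : nat) : seq bool := bits_aux n n.

(* self-delimiting binary code of a natural number:
   each bit b as [true; b], terminated by [false; false] *)
Definition numenc (n : nat) : seq bool :=
  flatten [seq [:: true; b] | b <- nat_bits n] ++ [:: false; false].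

Fixpoint ser_concept (c : concept) : seq nat :=
  match c with
  | CName a => [:: 0; a]
  | CTop => [:: 1]
  | CAnd c1 c2 => 2 :: ser_concept c1 ++ ser_concept c2
  | CEx r c1 => [:: 3, r & ser_concept c1]
  end.

Definition ser_rat (q : rat) : seq nat := [:: absz (numq q); absz (denq q)].

Definition ser_cond (k : conditional) : seq nat :=
  ser_concept (cond_C k) ++ ser_concept (cond_D k)
  ++ ser_rat (cond_l k) ++ ser_rat (cond_u k).

Definition ser_kb (K : kb) : seq nat := size K :: flatten (map ser_cond K).

Definition enc_kb (K : kb) : seq bool := flatten (map numenc (ser_kb K)).

(* Nondeterministic single-tape Turing machines over input alphabet   *)
(* {0,1}; tape symbols option bool (None = blank).                     *)
Inductive dir : Type := MoveL | MoveR | Stay.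

Record NTM : Type := {
  tm_state : finType;
  tm_start : tm_state;
  tm_accept : tm_state;
  tm_delta : tm_state -> option bool -> seq (tm_state * option bool * dir) }.

(* configuration: state, left part of tape (reversed, nearest cell
   first), scanned symbol, right part of tape *)
Record config (M : NTM) : Type := Config {
  c_state : tm_state M;
  c_left : seq (option bool);
  c_head : option bool;
  c_right : seq (option bool) }.

Definition move (M : NTM) (q : tm_state M) (l : seq (option bool))
    (a : option bool) (r : seq (option bool)) (d : dir) : config M :=
  match d with
  | MoveL => match l with
             | [::] => Config q [::] None (a :: r)
             | b :: l' => Config q l' b (a :: r)
             end
  | MoveR => match r with
             | [::] => Config q (a :: l) None [::]
             | b :: r' => Config q (a :: l) b r'
             end
  | Stay => Config q l a r
  end.

Definition tm_step (M : NTM) (c c' : config M) : Prop :=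
  exists q' w d, List.In (q', w, d) (tm_delta (c_state c) (c_head c)) /\
    c' = move q' (c_left c) w (c_right c) d.

Definition init_config (M : NTM) (w : seq bool) : config M :=
  Config (tm_start M) [::] (head None (map Some w)) (behead (map Some w)).

Fixpoint accepts_within (M : NTM) (n : nat) (c : config M) : Prop :=
  c_state c = tm_accept M \/
  match n with
  | 0 => False
  | n'.+1 => exists c', tm_step c c' /\ accepts_within n' c'
  end.

Definition in_NExpTime (X : Type) (valid : X -> Prop) (enc : X -> seq bool)
    (P : X -> Prop) : Prop :=
  exists (M : NTM) (k : nat), forall x, valid x ->
    (P x <-> accepts_within (2 ^ ((size (enc x)).+1 ^ k)) (init_config M (enc x))).

(* Main.v *)
Require Import Defs.
From mathcomp Require Import all_boot all_order all_algebra.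
From mathcomp Require Import perm zify ring.
From mathcomp Require Import boolp.
Set Implicit Arguments. Unset Strict Implicit. Unset Printing Implicit Defensive.

(** Satisfying a conditional is a pair of homogeneous linear inequalities in the
    numbers of elements of each type, a type being a set of subconcepts of K.  A vector
    of minimal support in the kernel of the system (with slack variables) is unique up
    to scaling, so Cramer's rule bounds its entries; summing one such vector per
    realised type keeps every type realised and yields a model of size 2 ^ poly(n).

    A model of that size can be guessed as a family of relations on an initial segment
    [0, N) of the naturals, together with the parsing of the input and the counting of
    extensions; that the guess is correct is a first-order property, with quantifiers
    bounded by N, of the guess and of the input bits.  A fixed formula is evaluated in
    time polynomial in N by nested loops over counters, which a one-tape machine
    keeps, next to the input and the guess, as stacks separated by blanks. *)

(** * Tapes up to trailing blanks *)

(** There is one unknown per type, hence exponentially many, but only two inequalities per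
    conditional. Cramer's rule is applied to a square submatrix whose order is bounded by the number
    of inequalities, which keeps every entry at most 2 ^ poly(n). Multiplicities matter only for the
    counts, while an existential restriction only asks that a witnessing type be inhabited; hence
    the set of realised types must be preserved exactly.

    Nondeterminism is confined to an initial phase that writes the guess; the evaluation after it is
    deterministic and ends on every guess. Soundness therefore speaks of arbitrary guesses and needs
    no time bound, whereas completeness needs one guess and a cost estimate. The bound N is itself
    part of the guess, so nothing exponential is computed from the input. For completeness it is
    taken above the size of the model, every number written in the input and every input position,
    so that counts, values and positions all lie in the range of the quantifiers. *)

Definition blank_eq (u v : seq (option bool)) := forall n, nth None u n = nth None v n.

Lemma blank_eq_cons a u v : blank_eq u v -> blank_eq (a :: u) (a :: v).
Proof. by move=> h [|n] /=. Qed.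

Lemma blank_eq_trans u v w : blank_eq u v -> blank_eq v w -> blank_eq u w.
Proof. by move=> h1 h2 n; rewrite h1 h2. Qed.

Lemma blank_eq_head u : blank_eq (head None u :: behead u) u.
Proof. by case: u => [|a u] [|n] //=; rewrite nth_nil. Qed.

Lemma blank_eq_behead u v : blank_eq u v -> blank_eq (behead u) (behead v).
Proof. by move=> h n; rewrite !nth_behead h. Qed.

Section Tape.
Variable M : NTM.
Implicit Types (c : config M) (q : tm_state M) (l r : seq (option bool)).

(** The scanned cell and the right part are compared as one word: running off the end of [c_right]
    materialises a blank, so only this word up to trailing blanks is invariant. *)
Definition tape c q l r :=
  [/\ c_state c = q, blank_eq (c_left c) l & blank_eq (c_head c :: c_right c) r].

(** Exactly one transition applies, so the step can be taken forwards and is also forced on any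
    accepting run. *)
Definition det_step c c' := exists q' w d,
  tm_delta (c_state c) (c_head c) = [:: (q', w, d)] /\
  c' = move q' (c_left c) w (c_right c) d.

Fixpoint det_path n c c' : Prop :=
  if n is n'.+1 then exists2 d, det_step c d & det_path n' d c' else c = c'.

Definition reach B q l r q' l' r' := forall c, tape c q l r ->
  exists n c', [/\ n <= B, det_path n c c' & tape c' q' l' r'].

Lemma det_path_cat n m c d e : det_path n c d -> det_path m d e -> det_path (n + m) c e.
Proof.
elim: n c => [|n IH] c /=; first by move=> ->.
by case=> x hx hp hq; exists x => //; apply: IH.
Qed.

Lemma tape_eq c q l r l' r' :
  blank_eq l l' -> blank_eq r r' -> tape c q l r -> tape c q l' r'.
Proof.
by move=> h1 h2 [h3 h4 h5]; split=> //; [apply: blank_eq_trans h1|apply: blank_eq_trans h2].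
Qed.

Lemma reach_trans B1 B2 q l r q' l' r' q2 l2 r2 :
  reach B1 q l r q' l' r' -> reach B2 q' l' r' q2 l2 r2 ->
  reach (B1 + B2) q l r q2 l2 r2.
Proof.
move=> h1 h2 c /h1[n [d [hn hd /h2[m [e [hm he ht]]]]]].
by exists (n + m), e; split=> //; [lia|apply: det_path_cat hd he].
Qed.

Lemma reach_refl q l r : reach 0 q l r q l r.
Proof. by move=> c h; exists 0, c. Qed.

Lemma reach_eq B q l r q' l' r' l1 r1 l2 r2 :
  reach B q l r q' l' r' -> blank_eq l1 l -> blank_eq r1 r ->
  blank_eq l' l2 -> blank_eq r' r2 -> reach B q l1 r1 q' l2 r2.
Proof.
move=> h e1 e2 e3 e4 c /(tape_eq e1 e2)/h[n [d [hn hd ht]]].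
by exists n, d; split=> //; apply: tape_eq ht.
Qed.

Lemma reach_le B B' q l r q' l' r' :
  reach B q l r q' l' r' -> B <= B' -> reach B' q l r q' l' r'.
Proof.
move=> h hB c /h[n [d [hn hd ht]]]; exists n, d; split=> //; exact: leq_trans hB.
Qed.

Lemma tape_head c q l r : tape c q l r -> c_head c = head None r.
Proof. by case=> _ _ /(_ 0) /= ->; rewrite nth0. Qed.

Lemma tape_right c q l r : tape c q l r -> blank_eq (c_right c) (behead r).
Proof. by case=> _ _ /blank_eq_behead. Qed.

Lemma tape_moveR c q l r q' w : tape c q l r ->
  tape (move q' (c_left c) w (c_right c) MoveR) q' (w :: l) (behead r).
Proof.
move=> h; have hr := tape_right h; case: (h) => _ hl _.
rewrite /move; case E: (c_right c) hr => [|b r'] hr; split=> //=; try exact: blank_eq_cons.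
by move=> [|n]; rewrite -hr //= nth_nil.
Qed.

Lemma tape_moveL c q l r q' w : tape c q l r ->
  tape (move q' (c_left c) w (c_right c) MoveL) q' (behead l) [:: head None l, w & behead r].
Proof.
move=> h; have hr := tape_right h; case: (h) => _ hl _.
have h0 := hl 0; rewrite nth0 in h0.
rewrite /move; case E: (c_left c) hl h0 => [|b l'] hl h0; split=> //=.
- exact: blank_eq_behead hl.
- by rewrite -nth0 -h0 /=; do 2!apply: blank_eq_cons.
- exact: blank_eq_behead hl.
- by rewrite -nth0 -h0 /=; do 2!apply: blank_eq_cons.
Qed.

Lemma tape_stay c q l r q' w : tape c q l r ->
  tape (move q' (c_left c) w (c_right c) Stay) q' l (w :: behead r).
Proof.
by move=> h; have hr := tape_right h; case: (h) => _ hl _; split=> //=; apply: blank_eq_cons.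
Qed.

Lemma reach1 q l r q' w d l' r' :
  tm_delta q (head None r) = [:: (q', w, d)] ->
  (forall c, tape c q l r -> tape (move q' (c_left c) w (c_right c) d) q' l' r') ->
  reach 1 q l r q' l' r'.
Proof.
move=> hd hm c ht; exists 1, (move q' (c_left c) w (c_right c) d); split=> //; last exact: hm.
exists (move q' (c_left c) w (c_right c) d) => //; exists q', w, d; split=> //.
by rewrite (tape_head ht); case: ht => -> .
Qed.

Lemma reachR q l r q' w : tm_delta q (head None r) = [:: (q', w, MoveR)] ->
  reach 1 q l r q' (w :: l) (behead r).
Proof. by move=> h; apply: reach1 h _ => c; apply: tape_moveR. Qed.

Lemma reachL q l r q' w : tm_delta q (head None r) = [:: (q', w, MoveL)] ->
  reach 1 q l r q' (behead l) [:: head None l, w & behead r].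
Proof. by move=> h; apply: reach1 h _ => c; apply: tape_moveL. Qed.

Lemma reachS q l r q' w : tm_delta q (head None r) = [:: (q', w, Stay)] ->
  reach 1 q l r q' l (w :: behead r).
Proof. by move=> h; apply: reach1 h _ => c; apply: tape_stay. Qed.

Hypothesis acc_final : forall a, tm_delta (tm_accept M) a = [::].

Lemma accepts_monotone n m c : n <= m -> accepts_within n c -> accepts_within m c.
Proof.
elim: n m c => [|n IH] [|m] c //=.
- by move=> _ [->|//]; left.
- by move=> h [->|[c' [h1 h2]]]; [left|right; exists c'; split=> //; apply: IH h2].
Qed.

Lemma det_path_accepts n m c c' :
  det_path n c c' -> accepts_within m c' -> accepts_within (n + m) c.
Proof.
elim: n c => [|n IH] c /=; first by move=> ->.
case=> d [q' [w [dd [h1 h2]]]] hp ha; right; exists d; split; last exact: IH.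
by exists q', w, dd; rewrite h1; split=> //; left.
Qed.

(** An accepting run must follow the forced steps and cannot stop on the way: the accepting state
    has no transition, while every configuration left by [det_step] has one. *)
Lemma accepts_det_path n m c c' :
  det_path n c c' -> accepts_within m c -> exists m', accepts_within m' c'.
Proof.
elim: n m c => [|n IH] m c /=; first by move=> -> h; exists m.
case=> d [q' [w [dd [h1 h2]]]] hp.
case: m => [|m] /= [h|].
- by move: h1; rewrite h acc_final.
- by [].
- by move: h1; rewrite h acc_final.
- case=> c2 [[q2 [w2 [d2 [+ hc]]]] ha]; rewrite h1 /= => -[] // -[hq hw hd].
  by apply: IH hp _; rewrite h2 hq hw hd -hc; exact: ha.
Qed.

End Tape.

(** * Stack programs on a one-tape machine *)

Definition stacks := nat -> seq bool.
Definition upd (T : Type) (s : nat -> T) i v : nat -> T := fun j => if j == i then v else s j.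

Inductive instr :=
  | IPush of nat & bool
  | IPop of nat & nat & nat & nat
  | IJmp of nat
  | IAcc
  | IHalt.

Definition gstep (C : seq instr) (x : nat * stacks) : option (nat * stacks) :=
  let: (pc, s) := x in
  match nth IHalt C pc with
  | IPush i b => Some (pc.+1, upd s i (b :: s i))
  | IPop i l1 l0 lE =>
    Some (match s i with
          | [::] => (lE, s)
          | b :: v => (if b then l1 else l0, upd s i v)
          end)
  | IJmp l => Some (l, s)
  | _ => None
  end.

Fixpoint gsteps C n x y : Prop :=
  if n is n'.+1 then exists2 z, gstep C x = Some z & gsteps C n' z y else x = y.

Definition instr_ok k (i : instr) :=
  match i with IPush i _ => i < k | IPop i _ _ _ => i < k | _ => true end.

(* Tape layout: each stack, top first, is followed by a blank; the head rests on the
   leftmost cell, which follows a blank as well. *)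
Definition block (u : seq bool) : seq (option bool) := rcons (map Some u) None.
Definition layout (s : stacks) a m := flatten [seq block (s i) | i <- iota a m].
(** Each block contains exactly one blank, at its end, so a counter of blanks locates a stack. *)
Definition blanks (u : seq (option bool)) := count (pred1 None) u.

Lemma blanks_Some u : blanks (map Some u) = 0.
Proof. by elim: u. Qed.

Lemma blanks_cat u v : blanks (u ++ v) = blanks u + blanks v.
Proof. exact: count_cat. Qed.

Lemma blanks_rev u : blanks (rev u) = blanks u.
Proof. exact: count_rev. Qed.

Lemma blanks_block u : blanks (block u) = 1.
Proof. by rewrite /block -cats1 blanks_cat blanks_Some. Qed.

Lemma layoutS s a m : layout s a m.+1 = block (s a) ++ layout s a.+1 m.
Proof. by []. Qed.

Lemma blanks_layout s a m : blanks (layout s a m) = m.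
Proof. by elim: m a => // m IH a; rewrite layoutS blanks_cat blanks_block IH. Qed.

Lemma layout_cat s a m n : layout s a (m + n) = layout s a m ++ layout s (a + m) n.
Proof. by rewrite /layout iotaD map_cat flatten_cat. Qed.

Lemma layout_split s k i : i < k ->
  layout s 0 k = layout s 0 i ++ block (s i) ++ layout s i.+1 (k - i.+1).
Proof. by move=> h; rewrite -layoutS -layout_cat; congr layout; lia. Qed.

Lemma layout_upd_lt s i v a m : a + m <= i -> layout (upd s i v) a m = layout s a m.
Proof.
elim: m a => // m IH a h; rewrite !layoutS IH; last by lia.
by rewrite /upd; case: eqP => // ?; lia.
Qed.

Lemma layout_upd_gt s i v a m : i < a -> layout (upd s i v) a m = layout s a m.
Proof.
elim: m a => // m IH a h; rewrite !layoutS IH; last by lia.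
by rewrite /upd; case: eqP => // ?; lia.
Qed.

Lemma layout_upd s k i v : i < k ->
  layout (upd s i v) 0 k = layout s 0 i ++ block v ++ layout s i.+1 (k - i.+1).
Proof.
move=> h; rewrite (layout_split _ h) layout_upd_lt // layout_upd_gt //.
by rewrite /upd eqxx.
Qed.

(** * The simulating machine and the walks of its head *)

Section Machine.
Variables (C : seq instr) (k : nat).
Hypothesis kge2 : 2 <= k.
Hypothesis Cok : all (instr_ok k) C.

Notation raw := (nat * nat * nat * option bool)%type.
(** Between instructions the machine is in [tHome]; [tWalkP] and [tWalkQ] look for the stack of a
    push and of a pop, and [tEnd] runs to the last separator before a shift to the left. *)
Definition tHome := 0. Definition tWalkP := 1. Definition tIns := 2. Definition tRet := 3.
Definition tWalkQ := 4. Definition tEnd := 5. Definition tSL := 6. Definition tG0 := 7.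
Definition tG1 := 8. Definition tAcc := 9.

Definition is_none (x : option bool) : nat := if x is None then 1 else 0.

(* Transition table on raw states (mode, program counter, separators still to be
   crossed, carried symbol).  [tIns] shifts the tape one cell to the right, [tSL] one
   cell to the left; [tRet] brings the head back to the leftmost cell.  The machine starts
   in [tG0], crosses the input and writes in [tG1] an arbitrary content of stack 1. *)
Definition raw_delta (q : raw) (x : option bool) : seq (raw * option bool * dir) :=
  let: (t, pc, j, a) := q in
  let i := nth IHalt C pc in
  match t with
  | 0 => match i with
         | IPush i _ => [:: ((tWalkP, pc, i, None), x, Stay)]
         | IPop i _ _ _ => [:: ((tWalkQ, pc, i, None), x, Stay)]
         | IJmp l => [:: ((tHome, l, 0, None), x, Stay)]
         | IAcc => [:: ((tAcc, 0, 0, None), x, Stay)]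
         | IHalt => [::]
         end
  | 1 => if j == 0 then
           (if i is IPush i b then [:: ((tIns, pc, k - i, Some b), x, Stay)] else [::])
         else [:: ((tWalkP, pc, j - is_none x, None), x, MoveR)]
  | 2 => if j == 0 then [:: ((tRet, pc.+1, k, None), x, MoveL)]
         else [:: ((tIns, pc, j - is_none x, x), a, MoveR)]
  | 3 => if (x == None) && (j == 1) then [:: ((tHome, pc, 0, None), x, MoveR)]
         else [:: ((tRet, pc, j - is_none x, None), x, MoveL)]
  | 4 => if j == 0 then
           (if i is IPop i _ _ lE then
              if x is None then [:: ((tRet, lE, i.+1, None), x, MoveL)]
              else [:: ((tEnd, pc, k - i, None), x, Stay)]
            else [::])
         else [:: ((tWalkQ, pc, j - is_none x, None), x, MoveR)]
  | 5 => if (x == None) && (j == 1) then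
           (if i is IPop i _ _ _ then [:: ((tSL, pc, k - i, None), x, MoveL)] else [::])
         else [:: ((tEnd, pc, j - is_none x, None), x, MoveR)]
  | 6 => if (x == None) && (j == 1) then
           (if i is IPop i l1 l0 _ then
              [:: ((tRet, if a is Some true then l1 else l0, i.+1, None), x, Stay)]
            else [::])
         else [:: ((tSL, pc, j - is_none x, x), a, MoveL)]
  | 7 => if x is None then [:: ((tG1, 0, 0, None), x, MoveR)]
         else [:: ((tG0, 0, 0, None), x, MoveR)]
  | 8 => [:: ((tG1, 0, 0, None), Some true, MoveR); ((tG1, 0, 0, None), Some false, MoveR);
             ((tRet, 0, 2, None), x, MoveL)]
  | _ => [::]
  end.

Let P := size C.
Definition tm_st : finType := ('I_10 * 'I_P.+1 * 'I_k.+2 * option bool)%type.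
(** Addresses past the end of the code all read [IHalt], so clamping them to [P] makes the state set
    finite without changing the behaviour. *)
Definition mk_state (q : raw) : tm_st :=
  let: (t, pc, j, a) := q in (inord t, inord (minn pc P), inord j, a).
Definition rawof (q : tm_st) : raw :=
  let: (t, pc, j, a) := q in (val t, val pc, val j, a).

Definition mach : NTM := {|
  tm_state := tm_st;
  tm_start := mk_state (tG0, 0, 0, None);
  tm_accept := mk_state (tAcc, 0, 0, None);
  tm_delta := fun q x => [seq (mk_state y.1.1, y.1.2, y.2) | y <- raw_delta (rawof q) x] |}.

Lemma nth_clamp pc : nth IHalt C (minn pc P) = nth IHalt C pc.
Proof. by rewrite /minn; case: ltnP => // h; rewrite !nth_default. Qed.

Lemma deltaE t pc j a x : t < 10 -> j < k.+2 ->
  @tm_delta mach (mk_state (t, pc, j, a)) x =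
  [seq (mk_state y.1.1, y.1.2, y.2) | y <- raw_delta (t, pc, j, a) x].
Proof.
move=> ht hj.
have E : rawof (mk_state (t, pc, j, a)) = (t, minn pc P, j, a).
  by rewrite /= !inordK // ltnS geq_minr.
transitivity [seq (mk_state y.1.1, y.1.2, y.2) | y <- raw_delta (rawof (mk_state (t, pc, j, a))) x]; first by [].
rewrite E {E}.
have E1 : minn (minn pc P) P = minn pc P by lia.
have E2 : minn (minn pc P).+1 P = minn pc.+1 P by lia.
do 10?[case: t ht => [|t] ht; rewrite /raw_delta].
all: rewrite ?nth_clamp; case: (nth IHalt C pc) => //=; intros;
  repeat (case: ifP => //= _); rewrite ?E1 ?E2 //.
all: by case: x => //= *; rewrite ?E1 ?E2.
Qed.

Definition mstate t pc j a : tm_state mach := mk_state (t, pc, j, a).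

Lemma stepR t pc j a l r t' pc' j' a' w : t < 10 -> j < k.+2 ->
  raw_delta (t, pc, j, a) (head None r) = [:: ((t', pc', j', a'), w, MoveR)] ->
  reach 1 (mstate t pc j a) l r (mstate t' pc' j' a') (w :: l) (behead r).
Proof. by move=> h1 h2 h3; apply: reachR; rewrite deltaE // h3. Qed.

Lemma stepL t pc j a l r t' pc' j' a' w : t < 10 -> j < k.+2 ->
  raw_delta (t, pc, j, a) (head None r) = [:: ((t', pc', j', a'), w, MoveL)] ->
  reach 1 (mstate t pc j a) l r (mstate t' pc' j' a') (behead l) [:: head None l, w & behead r].
Proof. by move=> h1 h2 h3; apply: reachL; rewrite deltaE // h3. Qed.

Lemma stepS t pc j a l r t' pc' j' a' w : t < 10 -> j < k.+2 ->
  raw_delta (t, pc, j, a) (head None r) = [:: ((t', pc', j', a'), w, Stay)] ->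
  reach 1 (mstate t pc j a) l r (mstate t' pc' j' a') l (w :: behead r).
Proof. by move=> h1 h2 h3; apply: reachS; rewrite deltaE // h3. Qed.

(** One walk serves three modes. With [lo = 0] it stops just after a separator, so [u] has to end in
    a blank; with [lo = 1] one separator is left over, the one on which [tEnd] stops. *)
Lemma scanR lo t pc u l r : t < 10 -> blanks u + lo < k.+2 ->
  (forall x j, 0 < j -> (x == None) && (lo == 1) && (j == 1) = false ->
     raw_delta (t, pc, j, None) x = [:: ((t, pc, j - is_none x, None), x, MoveR)]) ->
  lo <= 1 ->
  0 < lo \/ last None u = None ->
  reach (size u) (mstate t pc (blanks u + lo) None) l (u ++ r) (mstate t pc lo None) (rev u ++ l) r.
Proof.
move=> ht + hd hlo; elim: u l => [|x u IH] l hj hu; first exact: reach_refl.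
rewrite /= -add1n; apply: (reach_trans (q' := mstate t pc (blanks u + lo) None) (l' := x :: l) (r' := u ++ r)).
- have hp : 0 < blanks (x :: u) + lo.
    case: hu => [|hu]; first by lia.
    apply: ltn_addr; rewrite /blanks -has_count; case: (x) (u) hu => [b|] // [|y v] // hu.
    by apply/hasP; exists (last y v); [rewrite inE mem_last orbT|apply/eqP].
  apply: stepR => //; rewrite [head _ _]/= hd //; last first.
    apply/negbTE/negP => /andP[/andP[/eqP hx /eqP h1] /eqP h2]; move: h2.
    by rewrite hx /blanks /=; lia.
  by congr [:: (_, _, _, _, _, _)]; case: (x) => [b|] //=; lia.
- rewrite rev_cons -cats1 -catA /=; apply: IH; first by move: hj; rewrite /blanks /=; lia.
  by case: hu => [|hu]; [left|right; case: (u) hu].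
Qed.

Lemma retL pc u v r : blanks u + 1 < k.+2 ->
  reach (size u) (mstate tRet pc (blanks u + 1) None) (behead (u ++ v)) (head None (u ++ v) :: r)
    (mstate tRet pc 1 None) (behead v) (head None v :: rev u ++ r).
Proof.
elim: u r => [|x u IH] r hj; first exact: reach_refl.
rewrite /= -add1n; apply: (reach_trans (q' := mstate tRet pc (blanks u + 1) None)
  (l' := behead (u ++ v)) (r' := head None (u ++ v) :: x :: r)).
- apply: stepL => //=; rewrite ifF; last first.
    by apply/negbTE/negP => /andP[/eqP -> /eqP]; rewrite /blanks /=; lia.
  by congr [:: (_, _, _, _, _, _)]; case: (x) => [b|] //=; lia.
- rewrite rev_cons -cats1 -catA /=; apply: IH; by move: hj; rewrite /blanks /=; lia.
Qed.

(** The counter exceeds the separators of [u] by one: the last blank met is the cell left of the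
    tape contents, from which one step to the right leads home. *)
Lemma ret_home pc u r : blanks u <= k ->
  reach (size u).+1 (mstate tRet pc (blanks u).+1 None) (behead u) (head None u :: r)
    (mstate tHome pc 0 None) [::] (rev u ++ r).
Proof.
move=> h; rewrite -(addn1 (size u)) -(addn1 (blanks u)); apply: reach_trans.
  by have := @retL pc u [::] r; rewrite !cats0 /=; apply; lia.
apply: (reach_eq (@stepR tRet pc 1 None [::] (None :: rev u ++ r) tHome pc 0 None None
  isT isT erefl)) => //.
by case=> // n; rewrite /= nth_nil.
Qed.

Lemma insR pc a u lo l r : blanks u + lo < k.+2 -> 0 < lo ->
  reach (size u) (mstate tIns pc (blanks u + lo) a) l (u ++ r)
    (mstate tIns pc lo (last a u)) (rev (belast a u) ++ l) r.
Proof.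
elim: u a l => [|x u IH] a l hj hlo; first exact: reach_refl.
rewrite /= -add1n; apply: (reach_trans (q' := mstate tIns pc (blanks u + lo) x) (l' := a :: l) (r' := u ++ r)).
- apply: stepR => //=; rewrite ifF; last by lia.
  by congr [:: (_, _, _, _, _, _)]; case: (x) => [b|] //=; lia.
- rewrite rev_cons -cats1 -catA /=; apply: IH => //; by move: hj; rewrite /blanks /=; lia.
Qed.

Lemma slL pc a u v r : blanks u + 1 < k.+2 ->
  reach (size u) (mstate tSL pc (blanks u + 1) a) (behead (u ++ v)) (head None (u ++ v) :: r)
    (mstate tSL pc 1 (last a u)) (behead v) (head None v :: rev (belast a u) ++ r).
Proof.
elim: u a r => [|x u IH] a r hj; first exact: reach_refl.
rewrite /= -add1n; apply: (reach_trans (q' := mstate tSL pc (blanks u + 1) x)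
  (l' := behead (u ++ v)) (r' := head None (u ++ v) :: a :: r)).
- apply: stepL => //=; rewrite ifF; last first.
    by apply/negbTE/negP => /andP[/eqP -> /eqP]; rewrite /blanks /=; lia.
  by congr [:: (_, _, _, _, _, _)]; case: (x) => [b|] //=; lia.
- rewrite rev_cons -cats1 -catA /=; apply: IH; by move: hj; rewrite /blanks /=; lia.
Qed.

Lemma last_layout s a m : last None (layout s a m) = None.
Proof.
elim: m a => // m IH a; rewrite layoutS last_cat /block last_rcons; exact: IH.
Qed.

(** The final separator is split off because only blanks follow it: an insertion ends there and a
    deletion starts there. *)
Lemma layout_rcons s i m :
  exists2 B, block (s i) ++ layout s i.+1 m = rcons B None & blanks B = m.
Proof.
rewrite -layoutS; have := last_layout s i m.+1; have := blanks_layout s i m.+1.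
case: (lastP (layout s i m.+1)) => // B x h1; rewrite last_rcons => hx; subst x.
by exists B => //; move: h1; rewrite -cats1 blanks_cat /=; lia.
Qed.

Lemma reach_eqR (M : NTM) B q l r q' l' r' r2 : @reach M B q l r q' l' r' ->
  blank_eq r' r2 -> reach B q l r q' l' r2.
Proof. by move=> h e; apply: (reach_eq h). Qed.

Lemma pushP pc s i b : nth IHalt C pc = IPush i b -> i < k ->
  reach (3 * (size (layout s 0 k)) + 8) (mstate tHome pc 0 None) [::] (layout s 0 k)
   (mstate tHome pc.+1 0 None) [::] (layout (upd s i (b :: s i)) 0 k).
Proof.
move=> hi ik; have [B hB cB] := layout_rcons s i (k - i.+1).
have hl : layout s 0 k = layout s 0 i ++ B ++ [:: None] by rewrite (layout_split _ ik) hB -cats1.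
have hl' : layout (upd s i (b :: s i)) 0 k = layout s 0 i ++ (Some b :: B) ++ [:: None].
  by rewrite layout_upd // /block /= -/(block _) hB -cats1.
have sz : size (layout s 0 k) = size (layout s 0 i) + size B + 1.
  by rewrite hl !size_cat addnA.
have copy_add := blanks_layout s 0 i.
(* The summands are the legs of the trip: start, walk, switch to insertion, shift of [B], last
   carried symbol, turn, return. *)
apply: (@reach_le _ (1 + (size (layout s 0 i) + (1 + (size B + (1 + (1 + (size (layout s 0 i) + size B).+2)))))));
  last by lia.
apply: (reach_trans (q' := mstate tWalkP pc i None) (l' := [::]) (r' := layout s 0 k)).
  by apply: reach_eqR; [apply: (stepS (t := tHome)) => //=; rewrite hi|exact: blank_eq_head].
rewrite hl; apply: reach_trans.
  have := @scanR 0 tWalkP pc (layout s 0 i) [::] (B ++ [:: None]); rewrite copy_add addn0; apply=> //.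
  - by lia.
  - by move=> x j hj _ /=; rewrite ifF //; lia.
  - by right; apply: last_layout.
apply: (reach_trans (q' := mstate tIns pc (blanks B + 1) (Some b))).
  apply: reach_eqR; first apply: (stepS (t := tWalkP)) => //=; last exact: blank_eq_head.
  by rewrite hi cB; congr [:: (_, _, _, _, _, _)]; lia.
apply: reach_trans; first by apply: insR => //; lia.
apply: reach_trans; first by apply: (stepR (t := tIns)) => //=.
apply: reach_trans; first by apply: (stepL (t := tIns)) => //=.
rewrite cats0 -cat_cons -rev_rcons -lastI -rev_cat.
have := @ret_home pc.+1 (rev (layout s 0 i ++ Some b :: B)) [:: None].
rewrite size_rev size_cat blanks_rev blanks_cat copy_add (_ : blanks (Some b :: B) = k - i.+1) // revK hl'.
have -> : (i + (k - i.+1)).+1 = k by lia.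
by rewrite [size (_ :: B)]/= addnS -catA; apply; lia.
Qed.

Lemma scan_pop pc s i l1 l0 lE : nth IHalt C pc = IPop i l1 l0 lE -> i < k ->
  reach (1 + size (layout s 0 i)) (mstate tHome pc 0 None) [::] (layout s 0 k)
   (mstate tWalkQ pc 0 None) (rev (layout s 0 i)) (block (s i) ++ layout s i.+1 (k - i.+1)).
Proof.
move=> hi ik; apply: (reach_trans (q' := mstate tWalkQ pc i None) (l' := [::]) (r' := layout s 0 k)).
  by apply: reach_eqR; [apply: (stepS (t := tHome)) => //=; rewrite hi|exact: blank_eq_head].
have := @scanR 0 tWalkQ pc (layout s 0 i) [::] (block (s i) ++ layout s i.+1 (k - i.+1)).
rewrite blanks_layout addn0 cats0 -layout_split //; apply=> //.
- by lia.
- by move=> x j hj _ /=; rewrite ifF //; lia.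
- by right; apply: last_layout.
Qed.

Lemma pop_emptyP pc s i l1 l0 lE : nth IHalt C pc = IPop i l1 l0 lE -> i < k ->
  s i = [::] ->
  reach (3 * (size (layout s 0 k)) + 8) (mstate tHome pc 0 None) [::] (layout s 0 k)
   (mstate tHome lE 0 None) [::] (layout s 0 k).
Proof.
move=> hi ik hs; have copy_add := blanks_layout s 0 i.
have sz : size (layout s 0 k) = size (layout s 0 i) + 1 + size (layout s i.+1 (k - i.+1)).
  by rewrite (layout_split _ ik) hs !size_cat /= addnA.
apply: (@reach_le _ (1 + size (layout s 0 i) + (1 + (size (layout s 0 i)).+1))); last by lia.
apply: (reach_trans (@scan_pop _ s _ _ _ _ hi ik)).
apply: reach_trans; first by apply: (stepL (t := tWalkQ)) => //=; rewrite hi hs.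
have := @ret_home lE (rev (layout s 0 i)) (None :: layout s i.+1 (k - i.+1)).
by rewrite size_rev blanks_rev copy_add revK (layout_split _ ik) hs /=; apply; lia.
Qed.

Lemma head_rev_layout s i : head None (rev (layout s 0 i)) = None.
Proof.
have := last_layout s 0 i; case: (lastP (layout s 0 i)) => // u x.
by rewrite last_rcons rev_rcons.
Qed.

(** The shift runs from right to left, starting with a carried blank. When it meets the separator
    before the block, the symbol still carried is the popped bit, which selects the jump. *)
Lemma popP pc s i l1 l0 lE b v : nth IHalt C pc = IPop i l1 l0 lE -> i < k ->
  s i = b :: v ->
  reach (3 * (size (layout s 0 k)) + 8) (mstate tHome pc 0 None) [::] (layout s 0 k)
   (mstate tHome (if b then l1 else l0) 0 None) [::] (layout (upd s i v) 0 k).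
Proof.
move=> hi ik hs; have copy_add := blanks_layout s 0 i.
have [B hB cB] := layout_rcons (upd s i v) i (k - i.+1).
rewrite /upd eqxx -/(upd s i v) layout_upd_gt // in hB.
have hB2 : block (s i) ++ layout s i.+1 (k - i.+1) = (Some b :: B) ++ [:: None].
  by rewrite hs /block /= -/(block v) hB cats1.
have hl' : layout (upd s i v) 0 k = layout s 0 i ++ rcons B None by rewrite layout_upd // hB.
have sz : size (layout s 0 k) = size (layout s 0 i) + size B + 2.
  by rewrite (layout_split _ ik) hB2 !size_cat /=; lia.
apply: (@reach_le _ (1 + size (layout s 0 i) + (1 + ((size B).+1 + (1 + ((size B).+1 +
  (1 + (size (layout s 0 i)).+1))))))); last by lia.
apply: (reach_trans (@scan_pop _ s _ _ _ _ hi ik)).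
rewrite hB2; apply: (reach_trans (q' := mstate tEnd pc (blanks (Some b :: B) + 1) None)).
  apply: reach_eqR; first apply: (stepS (t := tWalkQ)) => //=; last exact: blank_eq_head.
  by rewrite hi; congr [:: (_, _, _, _, _, _)]; lia.
apply: reach_trans.
  apply: (@scanR 1 tEnd pc (Some b :: B)) => //.
  - by rewrite (_ : blanks (Some b :: B) = k - i.+1) //; lia.
  - by move=> x j hj; rewrite andbT /= => ->.
  - by left.
apply: (reach_trans (q' := mstate tSL pc (blanks (rev (Some b :: B)) + 1) None)).
  apply: (stepL (t := tEnd)) => //=; rewrite hi; congr [:: (_, _, _, _, _, _)].
  by rewrite blanks_rev (_ : blanks (Some b :: B) = k - i.+1) //; lia.
apply: reach_trans.
  have := @slL pc None (rev (Some b :: B)) (rev (layout s 0 i)) [:: None].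
  rewrite size_rev; apply.
  by rewrite blanks_rev (_ : blanks (Some b :: B) = k - i.+1) //; lia.
rewrite rev_cons last_rcons belast_rcons rev_cons revK head_rev_layout.
apply: reach_trans; first by apply: (stepS (t := tSL)) => //=; rewrite hi.
have := @ret_home (if b then l1 else l0) (rev (layout s 0 i)) (rcons B None ++ [:: None]).
rewrite size_rev blanks_rev copy_add revK head_rev_layout hl' => h; apply: reach_eqR; first by apply: h; lia.
rewrite catA => n; rewrite nth_cat; case: ltnP => // hn.
by rewrite [RHS]nth_default //; case: (n - _) => [|m] //=; rewrite nth_nil.
Qed.

Lemma instr_lt pc : instr_ok k (nth IHalt C pc).
Proof.
have [h|h] := ltnP pc (size C); last by rewrite nth_default.
exact: (all_nthP IHalt Cok).
Qed.

Lemma gstep_sim pc s pc' s' : gstep C (pc, s) = Some (pc', s') ->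
  reach (3 * (size (layout s 0 k)) + 8) (mstate tHome pc 0 None) [::] (layout s 0 k)
   (mstate tHome pc' 0 None) [::] (layout s' 0 k).
Proof.
rewrite /gstep; have := instr_lt pc; case E: (nth IHalt C pc) => [i b|i l1 l0 lE|l| |] //= ok.
- by case=> <- <-; apply: pushP.
- case hs: (s i) => [|b v] [<- <-]; [exact: pop_emptyP E ok hs|exact: popP E ok hs].
- case=> <- <-; apply: (@reach_le _ 1); last by lia.
  by apply: reach_eqR; [apply: (stepS (t := tHome)) => //=; rewrite E|exact: blank_eq_head].
Qed.

Lemma gstep_size pc s pc' s' : gstep C (pc, s) = Some (pc', s') ->
  size (layout s' 0 k) <= (size (layout s 0 k)).+1.
Proof.
rewrite /gstep; have := instr_lt pc; case E: (nth IHalt C pc) => [i b|i l1 l0 lE|l| |] //= ok.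
- case=> _ <-; rewrite layout_upd // (layout_split _ ok) !size_cat /block !size_rcons !size_map /=; lia.
- case hs: (s i) => [|b v] [_ <-] //.
  rewrite layout_upd // (layout_split _ ok) hs !size_cat /block !size_rcons !size_map /=; lia.
- by case=> _ <-.
Qed.

(** Each instruction lengthens the tape by at most one cell, so none of the [n] instructions sees
    more than the initial length plus [n]. *)
Lemma gsteps_sim n pc s pc' s' : gsteps C n (pc, s) (pc', s') ->
  reach (n * (3 * (size (layout s 0 k) + n) + 8)) (mstate tHome pc 0 None) [::] (layout s 0 k)
   (mstate tHome pc' 0 None) [::] (layout s' 0 k).
Proof.
elim: n pc s => [|n IH] pc s /=; first by case=> -> ->; apply: reach_refl.
case=> -[pc2 s2] h1 /IH h2; have hs := gstep_size h1.
by apply: reach_le; [apply: reach_trans (gstep_sim h1) h2|nia].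
Qed.

(** * The guessing phase and the language of the machine *)

Definition stacks0 (w g : seq bool) : stacks := upd (upd (fun _ => [::]) 1 g) 0 w.

Lemma layout_nil a m : layout (fun _ => [::]) a m = nseq m None.
Proof. by elim: m a => // m IH a; rewrite layoutS IH. Qed.

Lemma layout0 w g : layout (stacks0 w g) 0 k = block w ++ block g ++ nseq (k - 2) None.
Proof.
rewrite -(subnKC kge2) layout_cat addKn {1}/layout /= cats0 -catA; congr (_ ++ (_ ++ _)).
by rewrite /stacks0 !layout_upd_gt // layout_nil.
Qed.

Definition guessL (w g : seq bool) := rev (map Some g) ++ None :: rev (map Some w).

Lemma initP w : reach (size w).+1 (mstate tG0 0 0 None) [::] (map Some w)
  (mstate tG1 0 0 None) (guessL w [::]) [::].
Proof.
have h u l : reach (size u).+1 (mstate tG0 0 0 None) l (map Some u)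
    (mstate tG1 0 0 None) (None :: rev (map Some u) ++ l) [::].
  elim: u l => [|b u IH] l; first exact: (@stepR tG0 0 0 None l [::]).
  rewrite -add1n; apply: reach_trans; last first.
    by rewrite map_cons rev_cons cat_rcons; apply: IH.
  exact: (@stepR tG0 0 0 None l (Some b :: map Some u)).
by have := h w [::]; rewrite cats0.
Qed.

(** The blank tape beyond the guess already represents the remaining empty stacks, so only the head
    has to be brought home. *)
Lemma guess_home w g : reach (size w + size g).+2 (mstate tRet 0 2 None)
  (behead (guessL w g)) [:: head None (guessL w g); None]
  (mstate tHome 0 0 None) [::] (layout (stacks0 w g) 0 k).
Proof.
have := @ret_home 0 (guessL w g) [:: None].
rewrite /guessL blanks_cat !blanks_rev blanks_Some /= blanks_rev blanks_Some => h.
apply: reach_eqR.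
  by apply: reach_le; [apply: h; lia|rewrite size_cat /= !size_rev !size_map; lia].
rewrite rev_cat rev_cons !revK layout0 /block -!cats1 -!catA => n.
rewrite !nth_cat; case: ifP => // _; case: ifP => // _; case: ifP => // _; case: ifP => // _.
by rewrite nth_nseq if_same; case: (_ - _) => [|m] //=; rewrite nth_nil.
Qed.

Lemma acc_final a : @tm_delta mach (tm_accept mach) a = [::].
Proof. by rewrite [tm_accept _]/(mk_state _) deltaE. Qed.

Lemma mode_neq_acc t pc j a : t < 9 -> mstate t pc j a <> tm_accept mach.
Proof.
move=> ht; rewrite /mstate /= => -[/(congr1 val) /=]; rewrite !inordK //; last by lia.
by rewrite /tAcc; lia.
Qed.

Lemma guess_complete w g g0 c m :
  tape c (mstate tG1 0 0 None) (guessL w g0) [::] ->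
  (forall c', tape c' (mstate tRet 0 2 None) (behead (guessL w (g0 ++ g)))
      [:: head None (guessL w (g0 ++ g)); None] -> accepts_within m c') ->
  accepts_within (size g + 1 + m) c.
Proof.
elim: g g0 c => [|b g IH] g0 c ht hc.
  right; exists (move (mstate tRet 0 2 None) (c_left c) None (c_right c) MoveL); split.
    exists (mstate tRet 0 2 None), None, MoveL; split=> //.
    by rewrite (tape_head ht); case: ht => -> _ _; rewrite deltaE //=; right; right; left.
  by apply: hc; rewrite cats0; apply: tape_moveL ht.
right; exists (move (mstate tG1 0 0 None) (c_left c) (Some b) (c_right c) MoveR); split.
  exists (mstate tG1 0 0 None), (Some b), MoveR; split=> //.
  rewrite (tape_head ht); case: ht => -> _ _; rewrite deltaE //=.
  by case: (b); [left|right; left].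
apply: (IH (rcons g0 b)); last by move=> c'; rewrite cat_rcons; apply: hc.
by have := tape_moveR (mstate tG1 0 0 None) (Some b) ht; rewrite /guessL map_rcons rev_rcons.
Qed.

Lemma guess_sound w g c m :
  tape c (mstate tG1 0 0 None) (guessL w g) [::] -> accepts_within m c ->
  exists g' m' c', tape c' (mstate tRet 0 2 None) (behead (guessL w g'))
    [:: head None (guessL w g'); None] /\ accepts_within m' c'.
Proof.
elim: m g c => [|m IH] g c ht /= [h|].
- by case: ht => hs _ _; case: (@mode_neq_acc tG1 0 0 None) => //; rewrite -hs.
- by [].
- by case: ht => hs _ _; case: (@mode_neq_acc tG1 0 0 None) => //; rewrite -hs.
case=> c' [[q' [w' [d []]]]]; rewrite (tape_head ht).
case: (ht) => -> _ _; rewrite deltaE //= => hin hc ha.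
case: hin => [[hq hw hd]|[[hq hw hd]|[[hq hw hd]|//]]]; subst q' w' d c'.
- apply: (IH (rcons g true)) ha; rewrite /guessL map_rcons rev_rcons.
  exact: (tape_moveR (mstate tG1 0 0 None) (Some true) ht).
- apply: (IH (rcons g false)) ha; rewrite /guessL map_rcons rev_rcons.
  exact: (tape_moveR (mstate tG1 0 0 None) (Some false) ht).
- exists g, m; eexists; split; last exact: ha.
  exact: (tape_moveL (mstate tRet 0 2 None) None ht).
Qed.

Lemma init_tape w : tape (init_config mach w) (mstate tG0 0 0 None) [::] (map Some w).
Proof. by split=> //=; exact: blank_eq_head. Qed.

Lemma mach_complete w g n pc s : gsteps C n (0, stacks0 w g) (pc, s) ->
  nth IHalt C pc = IAcc ->
  accepts_within ((n + 1) * (3 * (size w + size g + k + n) + 8) + 2 * (size w + size g) + 8)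
    (init_config mach w).
Proof.
move=> hg hpc.
have [n1 [c1 [hn1 hp1 ht1]]] := initP (init_tape w).
have hsz : size (layout (stacks0 w g) 0 k) = size w + size g + k.
  by rewrite layout0 !size_cat /block !size_rcons !size_map size_nseq; lia.
apply: (@accepts_monotone _ (n1 + (size g + 1 + ((size w + size g).+2 +
  (n * (3 * (size w + size g + k + n) + 8) + 1))))); first by nia.
apply: det_path_accepts hp1 _; apply: (guess_complete (g0 := [::]) ht1) => c2 ht2.
have [n3 [c3 [hn3 hp3 ht3]]] := guess_home ht2; rewrite /= in hn3 ht3.
apply: (@accepts_monotone _ (n3 + (n * (3 * (size w + size g + k + n) + 8) + 1))); first by lia.
apply: det_path_accepts hp3 _.
have [n4 [c4 [hn4 hp4 ht4]]] := gsteps_sim hg ht3; rewrite hsz in hn4.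
apply: (@accepts_monotone _ (n4 + 1)); first by lia.
apply: det_path_accepts hp4 _; right.
exists (move (mstate tAcc 0 0 None) (c_left c4) (c_head c4) (c_right c4) Stay); split; last by left.
exists (mstate tAcc 0 0 None), (c_head c4), Stay; split=> //.
by case: ht4 => -> _ _; rewrite deltaE //= hpc; left.
Qed.

(** Phrased as absence of rejection: after the guess all steps are forced, so acceptance excludes
    that the program reaches [IHalt]. That the program ends at all is supplied later through
    [decides]. *)
Lemma mach_sound w m : accepts_within m (init_config mach w) ->
  exists g, forall n pc s, gsteps C n (0, stacks0 w g) (pc, s) -> nth IHalt C pc <> IHalt.
Proof.
move=> ha.
have [n1 [c1 [_ hp1 ht1]]] := initP (init_tape w).
have [m1 ha1] := accepts_det_path acc_final hp1 ha.
have [g [m2 [c2 [ht2 ha2]]]] := guess_sound ht1 ha1.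
have [n3 [c3 [_ hp3 ht3]]] := guess_home ht2.
have [m3 ha3] := accepts_det_path acc_final hp3 ha2.
exists g => n pc s hg hpc.
have [n4 [c4 [_ hp4 ht4]]] := gsteps_sim hg ht3.
have [m4 ha4] := accepts_det_path acc_final hp4 ha3.
case: ht4 => hs _ _; case: m4 ha4 => [|m4] /= [h|] //.
- by case: (@mode_neq_acc tHome pc 0 None) => //; rewrite -hs.
- by case: (@mode_neq_acc tHome pc 0 None) => //; rewrite -hs.
by case=> c5 [[q' [w' [d []]]]]; rewrite hs deltaE //= hpc.
Qed.

End Machine.

(** * Structured programs *)

(* [Case] pops stack i and branches on the bit (or emptiness); [Loop i c] runs c as long
   as popping stack i yields true (the terminating false, if any, is popped as well). *)
Inductive cmd :=
  | Skip
  | Push of nat & bool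
  | Seq of cmd & cmd
  | Case of nat & cmd & cmd & cmd
  | Loop of nat & cmd.

(** The costs are those of the compiled code: one pop, plus one jump after a branch other than the
    last, or back to the head of a loop. *)
Inductive exec : cmd -> stacks -> nat -> stacks -> Prop :=
  | ESkip s : exec Skip s 0 s
  | EPush i b s : exec (Push i b) s 1 (upd s i (b :: s i))
  | ESeq c1 c2 s n1 s1 n2 s2 : exec c1 s n1 s1 -> exec c2 s1 n2 s2 ->
      exec (Seq c1 c2) s (n1 + n2) s2
  | ECase1 i c1 c0 cE s v n s' : s i = true :: v -> exec c1 (upd s i v) n s' ->
      exec (Case i c1 c0 cE) s (n + 2) s'
  | ECase0 i c1 c0 cE s v n s' : s i = false :: v -> exec c0 (upd s i v) n s' ->
      exec (Case i c1 c0 cE) s (n + 2) s'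
  | ECaseE i c1 c0 cE s n s' : s i = [::] -> exec cE s n s' ->
      exec (Case i c1 c0 cE) s (n + 1) s'
  | ELoop1 i c s v n1 s1 n2 s2 : s i = true :: v -> exec c (upd s i v) n1 s1 ->
      exec (Loop i c) s1 n2 s2 -> exec (Loop i c) s (n1 + n2 + 2) s2
  | ELoop0 i c s v : s i = false :: v -> exec (Loop i c) s 1 (upd s i v)
  | ELoopE i c s : s i = [::] -> exec (Loop i c) s 1 s.

(** Labels are absolute, so the address at which the code will be placed is a parameter. *)
Fixpoint comp (pc : nat) (c : cmd) : seq instr :=
  match c with
  | Skip => [::]
  | Push i b => [:: IPush i b]
  | Seq c1 c2 => let k1 := comp pc c1 in k1 ++ comp (pc + size k1) c2
  | Case i c1 c0 cE =>
    let k1 := comp pc.+1 c1 in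
    let p0 := pc.+1 + size k1 + 1 in
    let k0 := comp p0 c0 in
    let pE := p0 + size k0 + 1 in
    let kE := comp pE cE in
    let stop := pE + size kE in
    IPop i pc.+1 p0 pE :: k1 ++ IJmp stop :: k0 ++ IJmp stop :: kE
  | Loop i c1 =>
    let k1 := comp pc.+1 c1 in
    let stop := pc.+1 + size k1 + 1 in
    IPop i pc.+1 stop stop :: k1 ++ [:: IJmp pc]
  end.

Lemma comp_case pc i c1 c0 cE : comp pc (Case i c1 c0 cE) =
  (let k1 := comp pc.+1 c1 in
   let p0 := pc.+1 + size k1 + 1 in
   let k0 := comp p0 c0 in
   let pE := p0 + size k0 + 1 in
   let kE := comp pE cE in
   let stop := pE + size kE in
   IPop i pc.+1 p0 pE :: k1 ++ IJmp stop :: k0 ++ IJmp stop :: kE).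
Proof. by []. Qed.

Lemma comp_loop pc i c : comp pc (Loop i c) =
  (let k1 := comp pc.+1 c in
   let stop := pc.+1 + size k1 + 1 in
   IPop i pc.+1 stop stop :: k1 ++ [:: IJmp pc]).
Proof. by []. Qed.

Definition code_at (C : seq instr) pc K := exists A B, C = A ++ K ++ B /\ size A = pc.

Lemma code_at_nth C pc i K : code_at C pc (i :: K) -> nth IHalt C pc = i.
Proof. by case=> A [B [-> <-]]; rewrite nth_cat ltnn subnn. Qed.

Lemma code_at_catl C pc K1 K2 : code_at C pc (K1 ++ K2) -> code_at C pc K1.
Proof. by case=> A [B [-> <-]]; exists A, (K2 ++ B); rewrite !catA. Qed.

Lemma code_at_catr C pc K1 K2 : code_at C pc (K1 ++ K2) -> code_at C (pc + size K1) K2.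
Proof.
by case=> A [B [-> <-]]; exists (A ++ K1), B; rewrite size_cat !catA.
Qed.

Lemma code_at_behead C pc i K : code_at C pc (i :: K) -> code_at C pc.+1 K.
Proof. by rewrite -cat1s => /code_at_catr; rewrite addn1. Qed.

Lemma gsteps_trans C n m x y z : gsteps C n x y -> gsteps C m y z -> gsteps C (n + m) x z.
Proof.
elim: n x => [|n IH] x /=; first by move=> ->.
by case=> t h1 h2 h3; exists t => //; apply: IH h3.
Qed.

Lemma gsteps1 C x y : gstep C x = Some y -> gsteps C 1 x y.
Proof. by move=> h; exists y. Qed.

Lemma comp_sim C c s n s' : exec c s n s' -> forall pc, code_at C pc (comp pc c) ->
  gsteps C n (pc, s) (pc + size (comp pc c), s').
Proof.
elim=> {c s n s'}.
- by move=> s pc _ /=; rewrite addn0.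
- by move=> i b s pc h; apply: gsteps1; rewrite /gstep (code_at_nth h) addn1.
- move=> c1 c2 s n1 s1 n2 s2 _ h1 _ h2 pc h /=; rewrite size_cat addnA.
  apply: gsteps_trans (h1 _ (code_at_catl h)) (h2 _ _).
  exact: code_at_catr h.
- move=> i c1 c0 cE s v n s' hs _ h pc hc.
  rewrite comp_case in hc *; cbv zeta in hc |- *.
  have h1 := code_at_behead hc.
  rewrite (_ : n + 2 = 1 + (n + 1)); last by lia.
  apply: gsteps_trans.
    by apply: gsteps1; rewrite /gstep (code_at_nth hc) hs.
  apply: gsteps_trans (h _ (code_at_catl h1)) _.
  have h2 := code_at_catr h1; apply: gsteps1; rewrite /gstep (code_at_nth h2).
  by congr (Some (_, _)); rewrite /= !size_cat /= !size_cat /=; lia.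
- move=> i c1 c0 cE s v n s' hs _ h pc hc.
  rewrite comp_case in hc *; cbv zeta in hc |- *.
  have h1 := code_at_behead (code_at_catr (code_at_behead hc)).
  rewrite -(addn1 (_ + _)) in h1.
  rewrite (_ : n + 2 = 1 + (n + 1)); last by lia.
  apply: gsteps_trans.
    by apply: gsteps1; rewrite /gstep (code_at_nth hc) hs.
  apply: gsteps_trans (h _ (code_at_catl h1)) _.
  have h2 := code_at_catr h1; apply: gsteps1; rewrite /gstep (code_at_nth h2).
  by congr (Some (_, _)); rewrite /= !size_cat /= !size_cat /=; lia.
- move=> i c1 c0 cE s n s' hs _ h pc hc.
  rewrite comp_case in hc *; cbv zeta in hc |- *.
  have h1 := code_at_behead (code_at_catr (code_at_behead hc)).
  rewrite -(addn1 (_ + _)) in h1.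
  have h2 := code_at_behead (code_at_catr h1).
  rewrite -(addn1 (_ + size _)) in h2.
  rewrite addnC; apply: (@gsteps_trans _ 1).
    by apply: gsteps1; rewrite /gstep (code_at_nth hc) hs.
  have := h _ h2; congr gsteps; congr (_, _).
  by rewrite /= !size_cat /= !size_cat /=; lia.
- move=> i c s v n1 s1 n2 s2 hs _ h1 _ h2 pc hc.
  have k1 := code_at_behead hc.
  rewrite (_ : n1 + n2 + 2 = 1 + (n1 + (1 + n2))); last by lia.
  apply: gsteps_trans.
    by apply: gsteps1; rewrite /gstep (code_at_nth hc) hs.
  apply: gsteps_trans (h1 _ (code_at_catl k1)) _.
  apply: gsteps_trans (h2 _ hc).
  by apply: gsteps1; rewrite /gstep (code_at_nth (code_at_catr k1)).
- move=> i c s v hs pc hc; rewrite comp_loop in hc *; cbv zeta in hc |- *.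
  apply: gsteps1; rewrite /gstep (code_at_nth hc) hs.
  by congr (Some (_, _)); rewrite /= !size_cat /=; lia.
- move=> i c s hs pc hc; rewrite comp_loop in hc *; cbv zeta in hc |- *.
  apply: gsteps1; rewrite /gstep (code_at_nth hc) hs.
  by congr (Some (_, _)); rewrite /= !size_cat /=; lia.
Qed.

(** * Deciders: programs that leave a truth value on a stack *)

Definition ireg (i : instr) := match i with IPush i _ => i | IPop i _ _ _ => i | _ => 0 end.

Definition decider r c : seq instr :=
  let K := comp 0 c in K ++ [:: IPop r (size K).+1 (size K).+2 (size K).+2; IAcc; IHalt].

Definition width (C : seq instr) := (foldr maxn 1 (map ireg C)).+1.

Lemma width_ok C : all (instr_ok (width C)) C.
Proof.
rewrite /width; elim: C => //= i C IH; apply/andP; split.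
  by case: i => //= i *; rewrite ltnS leq_maxl.
by apply: sub_all IH => -[i1 b1|i1 a1 b1 d1|l1||] //=; lia.
Qed.

Lemma width_ge2 C : 2 <= width C.
Proof. by rewrite /width ltnS; elim: (map _ _) => //= x l h; lia. Qed.

Definition run c s B s' := exists2 n, n <= B & exec c s n s'.

Definition decides r c w g B (b : bool) := exists s v,
  run c (stacks0 w g) B s /\ s r = b :: v.

Lemma decider_complete r c w g B : decides r c w g B true ->
  accepts_within ((B + 2) * (3 * (size w + size g + width (decider r c) + B + 1) + 8)
     + 2 * (size w + size g) + 8)
   (init_config (mach (decider r c) (width (decider r c))) w).
Proof.
case=> s [v [[n hn he] hs]].
have hc : code_at (decider r c) 0 (comp 0 c) by exists [::]; eexists.
have h1 := comp_sim he hc; rewrite add0n in h1.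
have h2 : gsteps (decider r c) (n + 1) (0, stacks0 w g) ((size (comp 0 c)).+1, upd s r v).
  apply: gsteps_trans h1 _; apply: gsteps1.
  by rewrite /gstep /decider nth_cat ltnn subnn /= hs.
apply: accepts_monotone (mach_complete (width_ge2 _) (width_ok _) h2 _); last first.
  by rewrite /decider nth_cat ltnNge leqnSn /= subSnn.
set k := width _; clear -hn; nia.
Qed.

Lemma decider_sound r c w m :
  accepts_within m (init_config (mach (decider r c) (width (decider r c))) w) ->
  exists g, forall B, ~ decides r c w g B false.
Proof.
move=> /(mach_sound (width_ge2 _) (width_ok _))[g hg]; exists g => B [s [v [[n hn he] hs]]].
have hc : code_at (decider r c) 0 (comp 0 c) by exists [::]; eexists.
have h1 := comp_sim he hc; rewrite add0n in h1.
have h2 : gsteps (decider r c) (n + 1) (0, stacks0 w g) ((size (comp 0 c)).+2, upd s r v).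
  apply: gsteps_trans h1 _; apply: gsteps1.
  by rewrite /gstep /decider nth_cat ltnn subnn /= hs.
apply: (hg _ _ _ h2).
by rewrite /decider nth_cat ltnNge (leq_trans (leqnSn _) (leqnSn _)) /= -addn2 addKn.
Qed.

(** * Counters and string access *)

Lemma run_le c s B B' s' : run c s B s' -> B <= B' -> run c s B' s'.
Proof. by case=> n h1 h2 h3; exists n => //; apply: leq_trans h3. Qed.

Lemma run_skip s : run Skip s 0 s.
Proof. by exists 0 => //; constructor. Qed.

Lemma run_push i b s : run (Push i b) s 1 (upd s i (b :: s i)).
Proof. by exists 1 => //; constructor. Qed.

Lemma run_seq c1 c2 s B1 s1 B2 s2 :
  run c1 s B1 s1 -> run c2 s1 B2 s2 -> run (Seq c1 c2) s (B1 + B2) s2.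
Proof.
by case=> n1 h1 e1 [n2 h2 e2]; exists (n1 + n2); [lia|apply: ESeq e1 e2].
Qed.

Lemma run_case i c1 c0 cE s B s' :
  match s i with
  | [::] => run cE s B s'
  | b :: v => run (if b then c1 else c0) (upd s i v) B s'
  end -> run (Case i c1 c0 cE) s (B + 2) s'.
Proof.
case E: (s i) => [|[] v] [n h1 h2].
- by exists (n + 1); [lia|apply: ECaseE].
- by exists (n + 2); [lia|apply: ECase1 E h2].
- by exists (n + 2); [lia|apply: ECase0 E h2].
Qed.

(** [f j] describes the stacks when [j] iterations remain. The tail [v] is empty or begins with the
    terminating [false]; the nonempty case is needed where the unary prefix of the guess is read. *)
Lemma run_loop i c (f : nat -> stacks) m B v :
  (forall j, j <= m -> f j i = nseq j true ++ v) ->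
  (if v is b :: _ then b = false else True) ->
  (forall j, j < m -> run c (upd (f j.+1) i (nseq j true ++ v)) B (f j)) ->
  run (Loop i c) (f m) (m * (B + 2) + 1) (upd (f 0) i (behead v)).
Proof.
move=> hf hv; elim: m hf => [|m IH] hf hb.
  exists 1 => //; have := hf 0 isT; rewrite /= => h0.
  case: v h0 hv {hf hb} => [|b v] h0 hv; last by subst b; apply: ELoop0.
  rewrite (_ : upd _ _ _ = f 0); first exact: ELoopE.
  by apply: funext => j; rewrite /upd; case: eqP => // ->.
have [n1 h1 e1] := hb m (ltnSn _).
have [j /(leqW)/hf//|j hj|n2 h2 e2] := IH; first by apply: hb; lia.
exists (n1 + n2 + 2); first by nia.
by apply: ELoop1 e1 e2; rewrite hf.
Qed.

Lemma updE (s : stacks) i v j : upd s i v j = if j == i then v else s j.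
Proof. by []. Qed.

Lemma upd_id (s : stacks) i v : s i = v -> upd s i v = s.
Proof.
by move=> h; apply: funext => j; rewrite updE; case: eqP => // ->.
Qed.

Definition inc i := Push i true.
Notation un m := (nseq m true).

Lemma run_count i c (f : nat -> stacks) m B :
  (forall j, j <= m -> f j i = un j) ->
  (forall j, j < m -> run c (upd (f j.+1) i (un j)) B (f j)) ->
  run (Loop i c) (f m) (m * (B + 2) + 1) (f 0).
Proof.
move=> hf hb; rewrite -(@upd_id (f 0) i [::]); last exact: hf.
apply: (@run_loop i c f m B [::]) => // j hj; first by rewrite cats0 hf.
by rewrite cats0; apply: hb.
Qed.

Lemma run_mv a b s m : a != b -> s a = un m ->
  run (Loop a (inc b)) s (m * 3 + 1) (upd (upd s b (un m ++ s b)) a [::]).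
Proof.
move=> ab hs.
have := @run_count a (inc b) (fun j => upd (upd s b (un (m - j) ++ s b)) a (un j)) m 1.
rewrite subnn subn0; rewrite (_ : upd (upd s b _) a (un m) = s); last first.
  apply: funext => r; rewrite !updE.
  by case: eqP => [->//|_]; case: eqP => [->|].
apply=> j hj; first by rewrite updE eqxx.
have -> : upd (upd s b (un (m - j) ++ s b)) a (un j) =
  upd (upd (upd (upd s b (un (m - j.+1) ++ s b)) a (un j.+1)) a (un j)) b
    (true :: upd (upd (upd s b (un (m - j.+1) ++ s b)) a (un j.+1)) a (un j) b).
  rewrite !updE eqxx eq_sym (negbTE ab) (_ : m - j = (m - j.+1).+1); last by lia.
  apply: funext => r; rewrite !updE.
  by case: (r =P a) => [->|_]; [rewrite (negbTE ab)|case: (r =P b)].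
exact: run_push.
Qed.

(** [rZ] holds the parked prefix during string access, [rRes] is a stack of truth values, [rP] an
    accumulator or address, and [rT], [rU], [rV] are scratch. [rVar x] holds the value of variable
    [x], and [rLim x] the number of values its quantifier has still to try. *)
Definition rIn := 0. Definition rCert := 1. Definition rZ := 2. Definition rRes := 3.
Definition rN := 4. Definition rT := 5. Definition rP := 6. Definition rU := 7.
Definition rV := 8. Definition rVar x := 9 + x.*2. Definition rLim x := 10 + x.*2.

(** A counter is read by emptying it, so its value is saved in [rT] and restored. *)
Definition copy_add a b := Seq (Loop a (Seq (inc rT) (inc b))) (Loop rT (inc a)).

Lemma run_copy_add a b s m : a != b -> a != rT -> b != rT -> s a = un m -> s rT = [::] ->
  run (copy_add a b) s (m * 7 + 2) (upd s b (un m ++ s b)).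
Proof.
move=> ab aT bT hs hT.
have E := (negbTE ab, negbTE aT, negbTE bT, eqxx).
have E2 : (b == a = false) * (rT == a = false) * (rT == b = false).
  by rewrite (eq_sym b a) (eq_sym rT a) (eq_sym rT b) !E.
pose f j := upd (upd (upd s b (un (m - j) ++ s b)) rT (un (m - j))) a (un j).
have e0 : f m = s.
  by rewrite /f subnn /=; apply: funext => r; rewrite !updE;
     case: eqP => [->//|_]; case: eqP => [->//|_]; case: eqP => [->|].
apply: (@run_le _ _ (m * 4 + 1 + (m * 3 + 1))); last by lia.
apply: (@run_seq _ _ _ _ (f 0)).
  rewrite -{1}e0; apply: (@run_count a _ f m 2) => j hj; first by rewrite /f updE eqxx.
  apply: (@run_le _ _ (1 + 1)) => //; apply: (run_seq (run_push _ _ _)).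
  set Y := upd (upd _ _ _) rT _; set X := upd Y b (true :: Y b).
  suff -> : f j = X by exact: run_push.
  rewrite /X /Y /f (_ : m - j = (m - j.+1).+1); last by lia.
  apply: funext => r; rewrite !updE !E ?E2.
  case: (r =P a) => [->|ra]; first by rewrite !E ?E2.
  case: (r =P rT) => [->|rt]; first by rewrite ?E ?E2.
  by case: (r =P b).
have := @run_mv rT a (f 0) m; rewrite !E2 => /(_ isT).
rewrite {1}/f subn0 !updE ?E ?E2 => /(_ erefl).
congr run; rewrite /f subn0 !updE ?E ?E2 cats0.
apply: funext => r; rewrite !updE.
case: (r =P rT) => [->|rt]; first by rewrite E2.
case: (r =P a) => [->|ra]; first by rewrite E.
by [].
Qed.

Lemma rVar_eq x r : r < 9 -> (rVar x == r = false) * (r == rVar x = false).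
Proof. by move=> h; rewrite /rVar; split; apply/eqP; lia. Qed.

Lemma rLim_eq x r : r < 9 -> (rLim x == r = false) * (r == rLim x = false).
Proof. by move=> h; rewrite /rLim; split; apply/eqP; lia. Qed.

Lemma rVar_rLim x y : (rVar x == rLim y = false) * (rLim y == rVar x = false).
Proof. by rewrite /rVar /rLim; split; apply/eqP; lia. Qed.

Lemma rVar_rVar x y : (rVar x == rVar y) = (x == y).
Proof. by rewrite /rVar eqn_add2l; apply/eqP/eqP; lia. Qed.

Lemma rLim_rLim x y : (rLim x == rLim y) = (x == y).
Proof. by rewrite /rLim eqn_add2l; apply/eqP/eqP; lia. Qed.

Lemma upd_upd (s : stacks) i v v' : upd (upd s i v) i v' = upd s i v'.
Proof. by apply: funext => j; rewrite !updE; case: eqP. Qed.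

Lemma upd_comm (s : stacks) i j v v' : i != j -> upd (upd s i v) j v' = upd (upd s j v') i v.
Proof.
move=> h; apply: funext => k; rewrite !updE.
by case: (k =P j) => [->|//]; rewrite eq_sym (negbTE h).
Qed.

Ltac upd_ext := let j := fresh "j" in
  apply: funext => j; rewrite !updE;
  repeat (match goal with |- context [j == ?i] => case: (j =P i) => [?|_]; try subst j end);
  rewrite ?updE ?eqxx //=.

Definition mulN := Seq (Loop rP (copy_add rN rU)) (Loop rU (inc rP)).

Lemma run_mulN s p N : s rP = un p -> s rN = un N -> s rT = [::] -> s rU = [::] ->
  run mulN s (p * (10 * N + 4) + 2) (upd s rP (un (p * N))).
Proof.
move=> hP hN hT hU.
pose f j := upd (upd s rP (un j)) rU (un ((p - j) * N)).
apply: (@run_le _ _ (p * (N * 7 + 2 + 2) + 1 + (p * N * 3 + 1))); last by nia.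
apply: (@run_seq _ _ _ _ (f 0)).
  have -> : s = f p.
    rewrite /f subnn mul0n upd_id; first by rewrite upd_id.
    by rewrite updE.
  apply: (@run_count rP _ f p _) => j hj //.
  have -> : f j = upd (upd (f j.+1) rP (un j)) rU (un N ++ (upd (f j.+1) rP (un j)) rU).
    rewrite /f (_ : (p - j) * N = N + (p - j.+1) * N); last by nia.
    by rewrite nseqD; upd_ext.
  by apply: run_copy_add.
have := @run_mv rU rP (f 0) (p * N) isT; rewrite {1}/f subn0 => /(_ erefl).
congr run; rewrite /f !updE /= cats0 subn0.
by upd_ext.
Qed.

Definition addm x y := Seq (copy_add (rVar x) rU) (Loop rU (copy_add (rVar y) rP)).

Lemma run_addm s x y p a b : s rP = un p -> s (rVar x) = un a -> s (rVar y) = un b ->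
  s rT = [::] -> s rU = [::] ->
  run (addm x y) s (a * (7 * b + 11) + 3) (upd s rP (un (p + a * b))).
Proof.
move=> hP hx hy hT hU.
pose f j := upd (upd s rP (un (p + (a - j) * b))) rU (un j).
apply: (@run_le _ _ (a * 7 + 2 + (a * (b * 7 + 2 + 2) + 1))); last by nia.
apply: (@run_seq _ _ _ _ (f a)).
  have -> : f a = upd s rU (un a ++ s rU).
    by rewrite /f subnn addn0 [upd s rP _]upd_id // hU cats0.
  by apply: run_copy_add; rewrite // ?rVar_eq.
have -> : upd s rP (un (p + a * b)) = f 0.
  by rewrite /f subn0 [upd _ rU _]upd_id // updE.
apply: run_count => j hj //.
have -> : f j = upd (upd (f j.+1) rU (un j)) rP (un b ++ (upd (f j.+1) rU (un j)) rP).
  rewrite /f (_ : p + (a - j) * b = b + (p + (a - j.+1) * b)); last by nia.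
  by rewrite nseqD; upd_ext.
by apply: run_copy_add; rewrite ?rVar_eq // /f !updE ?rVar_eq.
Qed.

(** Interleaving with [true] makes a bit string fit for [Loop]: each marker starts an iteration, and
    the bit after it is the payload. *)
Definition marked u := flatten [seq [:: true; b] | b <- u].

(** The first bits, as many as [rP] tells, are parked on [rZ] and put back after the access, so the
    string survives. Past the end of the string the answer is [f None]. *)
Definition read_at r (f : option bool -> bool) :=
  Seq (Loop rP (Case r (Seq (Push rZ true) (inc rZ)) (Seq (Push rZ false) (inc rZ)) Skip))
 (Seq (Case r (Seq (Push r true) (Push rRes (f (Some true))))
              (Seq (Push r false) (Push rRes (f (Some false)))) (Push rRes (f None)))
      (Loop rZ (Case rZ (Push r true) (Push r false) Skip))).

Lemma run_back r s u : r != rZ -> s rZ = marked u ->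
  run (Loop rZ (Case rZ (Push r true) (Push r false) Skip)) s (size u * 5 + 1)
    (upd (upd s rZ [::]) r (catrev u (s r))).
Proof.
move=> hr; elim: u s => [|b u IH] s hs.
  rewrite upd_id; last by rewrite updE (negbTE hr).
  by rewrite upd_id //; exists 1 => //; apply: ELoopE.
pose s1 := upd (upd s rZ (marked u)) r (b :: s r).
have hr' : (rZ == r) = false by rewrite eq_sym; apply/negbTE.
have := IH s1; rewrite {1}/s1 !updE hr' => /(_ erefl) [n2 h2 e2].
have [n1 h1 e1] : run (Case rZ (Push r true) (Push r false) Skip) (upd s rZ (b :: marked u)) (1 + 2) s1.
  apply: run_case; rewrite updE eqxx upd_upd /s1.
  by case: (b); [have := run_push r true (upd s rZ (marked u))|
                 have := run_push r false (upd s rZ (marked u))]; rewrite updE (negbTE hr).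
exists (n1 + n2 + 2); first by rewrite /=; lia.
apply: (@ELoop1 _ _ _ (b :: marked u) _ s1) => //.
move: e2; congr exec; rewrite /s1 !updE eqxx.
apply: funext => j; rewrite !updE.
by case: (j =P r) => // _; case: (j =P rZ).
Qed.

Lemma run_forth r s u v p : r != rZ -> r != rP -> s rP = un p -> s rZ = marked u -> s r = v ->
  run (Loop rP (Case r (Seq (Push rZ true) (inc rZ)) (Seq (Push rZ false) (inc rZ)) Skip)) s
   (p * 6 + 1)
   (upd (upd (upd s rP [::]) rZ (marked (catrev (take p v) u))) r (drop p v)).
Proof.
move=> rz rp; elim: p s u v => [|p IH] s u v hP hZ hv.
  by rewrite drop0 take0 !upd_id ?updE ?(negbTE rz) ?(negbTE rp) //; exists 1 => //; apply: ELoopE.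
have rz' : (rZ == r) = false by rewrite eq_sym; apply/negbTE.
have rp' : (rP == r) = false by rewrite eq_sym; apply/negbTE.
pose s1 := upd (upd (upd s rP (un p)) rZ (marked (catrev (take 1 v) u))) r (drop 1 v).
have := IH s1 (catrev (take 1 v) u) (drop 1 v).
rewrite {1 2 3}/s1 !updE ?rz' ?rp' !eqxx => /(_ erefl erefl erefl)[n2 h2 e2].
have [n1 h1 e1] : run (Case r (Seq (Push rZ true) (inc rZ)) (Seq (Push rZ false) (inc rZ)) Skip)
   (upd s rP (un p)) (1 + 1 + 2) s1.
  apply: run_case; rewrite updE (negbTE rp) hv.
  case Ev: (v) => [|b v1].
    have -> : s1 = upd s rP (un p).
      rewrite /s1 Ev /= [X in upd X r _]upd_id ?updE // upd_id // updE (negbTE rp).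
      by rewrite hv.
    by apply: run_le; [apply: run_skip|].
  have -> : s1 = upd (upd (upd (upd s rP (un p)) r v1) rZ (b :: marked u)) rZ (true :: b :: marked u).
    by rewrite /s1 Ev /= take0 drop0 upd_comm ?rz' // upd_upd.
  case: (b).
    apply: (@run_seq _ _ _ _ (upd (upd (upd s rP (un p)) r v1) rZ (true :: marked u))).
      by have := run_push rZ true (upd (upd s rP (un p)) r v1); rewrite !updE rz' hZ.
    by have := run_push rZ true (upd (upd (upd s rP (un p)) r v1) rZ (true :: marked u)); rewrite !updE.
  apply: (@run_seq _ _ _ _ (upd (upd (upd s rP (un p)) r v1) rZ (false :: marked u))).
    by have := run_push rZ false (upd (upd s rP (un p)) r v1); rewrite !updE rz' hZ.
  by have := run_push rZ true (upd (upd (upd s rP (un p)) r v1) rZ (false :: marked u)); rewrite !updE.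
exists (n1 + n2 + 2); first by lia.
apply: (@ELoop1 _ _ _ (un p) _ s1) => //.
have -> : drop p.+1 v = drop p (drop 1 v) by rewrite drop_drop addn1.
have -> : catrev (take p.+1 v) u = catrev (take p (drop 1 v)) (catrev (take 1 v) u).
  by case: (v) => //= b v'; rewrite take0 drop0.
move: e2; congr exec; rewrite /s1.
apply: funext => j; rewrite !updE.
by case: (j =P r) => // _; case: (j =P rZ) => // _; case: (j =P rP).
Qed.

Lemma run_read_at r f s p : r < 2 -> s rP = un p -> s rZ = [::] ->
  run (read_at r f) s (p * 11 + 6) (upd (upd s rP [::]) rRes (f (onth (s r) p) :: s rRes)).
Proof.
move=> hr hP hZ.
have rz : r != rZ by apply/eqP => e; move: hr; rewrite e.
have rp : r != rP by apply/eqP => e; move: hr; rewrite e.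
have rr : r != rRes by apply/eqP => e; move: hr; rewrite e.
have rr' : (rRes == r) = false by rewrite eq_sym; apply/negbTE.
have rz' : (rZ == r) = false by rewrite eq_sym; apply/negbTE.
set v := s r; set u := rev (take p v).
pose s1 := upd (upd (upd s rP [::]) rZ (marked u)) r (drop p v).
pose s2 := upd s1 rRes (f (onth v p) :: s rRes).
have hu : size u <= p by rewrite size_rev size_take; case: ltnP => //; lia.
apply: (@run_le _ _ (p * 6 + 1 + (2 + 2 + (size u * 5 + 1)))); last by lia.
apply: run_seq; first exact: (@run_forth r s [::] v p).
rewrite catrevE cats0 -/u -/s1.
apply: (@run_seq _ _ _ _ s2).
  apply: run_case; have -> : s1 r = drop p v by rewrite /s1 updE eqxx.
  have s1r : s1 rRes = s rRes by rewrite /s1 !updE rr'.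
  have e2 : onth v p = onth (drop p v) 0 by elim: (v) (p) => [|? ? IH] [|?] /=.
  case E : (drop p v) => [|b v'].
    apply: (@run_le _ _ 1) => //.
    have := run_push rRes (f None) s1; rewrite /s2 e2 E.
    by rewrite s1r.
  have -> : s2 = upd (upd (upd s1 r v') r (b :: v')) rRes (f (Some b) :: s rRes).
    by rewrite /s2 e2 E /= upd_upd [upd s1 r _]upd_id // /s1 updE eqxx E.
  have h1 b0 : run (Push r b0) (upd s1 r v') 1 (upd (upd s1 r v') r (b0 :: v')).
    by have := run_push r b0 (upd s1 r v'); rewrite updE eqxx.
  have h2 b0 : run (Push rRes (f (Some b0))) (upd (upd s1 r v') r (b0 :: v')) 1
     (upd (upd (upd s1 r v') r (b0 :: v')) rRes (f (Some b0) :: s rRes)).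
    have := run_push rRes (f (Some b0)) (upd (upd s1 r v') r (b0 :: v')).
    by rewrite !updE rr' s1r.
  by case: (b); apply: run_seq (h1 _) (h2 _).
have := @run_back r s2 u rz; rewrite {1}/s2 /s1 !updE rz' => /(_ erefl).
congr run; rewrite /s2 /s1 !updE (negbTE rr) eqxx.
apply: funext => j; rewrite !updE.
case: (j =P r) => [->|jr].
  by rewrite (negbTE rr) (negbTE rp) catrevE revK cat_take_drop.
case: (j =P rZ) => [->|//].
by rewrite hZ.
Qed.

(** * Evaluation of first-order formulas *)

Definition polyB (f : nat -> nat) := exists a, forall S, 0 < S -> f S <= a * S ^ a.

Lemma polyB_const c : polyB (fun=> c).
Proof. by exists c => S hS; rewrite leq_pmulr // expn_gt0 hS. Qed.

Lemma polyB_id : polyB id.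
Proof. by exists 1 => S hS; rewrite mul1n. Qed.

Lemma polyB_add f g : polyB f -> polyB g -> polyB (fun S => f S + g S).
Proof.
move=> [a ha] [b hb]; exists (a + b) => S hS.
rewrite mulnDl; apply: leq_add.
  by apply: leq_trans (ha _ hS) _; rewrite leq_mul2l leq_pexp2l ?leq_addr ?orbT.
by apply: leq_trans (hb _ hS) _; rewrite leq_mul2l leq_pexp2l ?leq_addl ?orbT.
Qed.

Lemma polyB_mul f g : polyB f -> polyB g -> polyB (fun S => f S * g S).
Proof.
move=> [a ha] [b hb]; exists (a * b + (a + b)) => S hS.
apply: leq_trans (leq_mul (ha _ hS) (hb _ hS)) _.
rewrite mulnACA -expnD; apply: leq_mul; first exact: leq_addr.
by rewrite leq_pexp2l // leq_addl.
Qed.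

Lemma polyB_exp f m : polyB f -> polyB (fun S => f S ^ m).
Proof.
move=> hf; elim: m => [|m IH]; first exact: polyB_const.
have [a h] := polyB_mul hf IH; exists a => S hS; rewrite expnS; exact: h.
Qed.

Ltac polyB := repeat first [assumption | exact: polyB_const | exact: polyB_id
  | apply: polyB_add | apply: polyB_mul | apply: polyB_exp].

(** * Syntax and semantics of bounded formulas *)

Inductive item := IOne | IVar of nat | IMul of nat & nat.

(** A term is a sum of items; products of two variables suffice for inequalities between
    cross-multiplied fractions. [FIn] reads an input bit and [FInD] tests that the position exists.
    Guessed relations are all ternary, those of smaller arity repeating an argument. *)
Inductive fo_form :=
  | FLe of seq item & seq item
  | FIn of nat
  | FInD of nat
  | FRel of nat & nat & nat & nat
  | FNot of fo_form
  | FAnd of fo_form & fo_form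
  | FOr of fo_form & fo_form
  | FImp of fo_form & fo_form
  | FAll of nat & fo_form
  | FEx of nat & fo_form.

Definition ival (e : nat -> nat) it :=
  match it with IOne => 1 | IVar x => e x | IMul x y => e x * e y end.
Definition tval e (t : seq item) := sumn (map (ival e) t).

Section Semantics.
Variables (N : nat) (w : seq bool) (R : nat -> nat -> nat -> nat -> bool).

Fixpoint holds (e : nat -> nat) (f : fo_form) : bool :=
  match f with
  | FLe t1 t2 => tval e t1 <= tval e t2
  | FIn x => odflt false (onth w (e x))
  | FInD x => isSome (onth w (e x))
  | FRel i x y z => R i (e x) (e y) (e z)
  | FNot f => ~~ holds e f
  | FAnd f g => holds e f && holds e g
  | FOr f g => holds e f || holds e g
  | FImp f g => holds e f ==> holds e g
  | FAll x f => all (fun v => holds (upd e x v) f) (iota 0 N)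
  | FEx x f => has (fun v => holds (upd e x v) f) (iota 0 N)
  end.

(** The propositional twin of [holds]: the machine computes the latter, the mathematics uses the
    former. *)
Fixpoint sat (e : nat -> nat) (f : fo_form) : Prop :=
  match f with
  | FLe t1 t2 => tval e t1 <= tval e t2
  | FIn x => nth false w (e x)
  | FInD x => e x < size w
  | FRel i x y z => R i (e x) (e y) (e z)
  | FNot f => ~ sat e f
  | FAnd f g => sat e f /\ sat e g
  | FOr f g => sat e f \/ sat e g
  | FImp f g => sat e f -> sat e g
  | FAll x f => forall v, v < N -> sat (upd e x v) f
  | FEx x f => exists2 v, v < N & sat (upd e x v) f
  end.

Lemma onth_nth (T : Type) (u : seq T) x0 i : odflt x0 (onth u i) = nth x0 u i.
Proof. by elim: u i => [|b u IH] [|i] //=. Qed.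

Lemma onth_lt (T : Type) (u : seq T) i : isSome (onth u i) = (i < size u).
Proof. by elim: u i => [|b u IH] [|i] //=. Qed.

Lemma holdsP e f : reflect (sat e f) (holds e f).
Proof.
elim: f e => [t1 t2|x|x|i x y z|f IH|f IHf g IHg|f IHf g IHg|f IHf g IHg|x f IH|x f IH] e /=.
- exact: idP.
- by rewrite onth_nth; apply: idP.
- by rewrite onth_lt; apply: idP.
- exact: idP.
- by apply: (iffP negP) => h /IH.
- by apply: (iffP andP) => -[/IHf h1 /IHg h2].
- by apply: (iffP orP) => -[/IHf|/IHg] h; [left|right|left|right].
- apply: (iffP implyP) => h; first by move=> /IHf/h/IHg.
  by move=> /IHf/h/IHg.
- apply: (iffP allP) => h v; first by move=> hv; apply/IH/h; rewrite mem_iota.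
  by rewrite mem_iota => /h/IH.
- apply: (iffP hasP) => -[v]; rewrite ?mem_iota.
    by move=> hv /IH; exists v.
  by move=> hv /IH h; exists v => //; rewrite mem_iota.
Qed.

End Semantics.

(** The relations are stored as consecutive tables of side [N]. Positions past the end count as
    false, so every guess denotes relations. *)
Definition certR N (ct : seq bool) i x y z := nth false ct (((i * N + x) * N + y) * N + z).

Definition add_item it :=
  match it with IOne => inc rP | IVar x => copy_add (rVar x) rP | IMul x y => addm x y end.
Definition add_term t := foldr (fun it c => Seq (add_item it) c) Skip t.

Definition comb (op : bool -> bool -> bool) :=
  Case rRes (Case rRes (Push rRes (op true true)) (Push rRes (op false true)) Skip)
            (Case rRes (Push rRes (op true false)) (Push rRes (op false false)) Skip) Skip.

(** Truncated subtraction: the units of [rV] that find no partner in [rP] are collected in [rU],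
    which stays empty exactly when the comparison holds. *)
Definition cmp := Seq (Loop rV (Case rP Skip Skip (inc rU)))
  (Seq (Loop rP Skip)
   (Case rU (Seq (Loop rU Skip) (Push rRes false)) Skip (Push rRes true))).

(** All [N] values are tried without short-circuit, [rVar x] counting up while [rLim x] counts down,
    and the results are folded on top of [rRes]. *)
Definition quant x init op c :=
  Seq (Push rRes init) (Seq (copy_add rN (rLim x))
    (Seq (Loop (rLim x) (Seq c (Seq (comb op) (inc (rVar x))))) (Loop (rVar x) Skip))).

(** One Horner step of the address computed by [certR]. *)
Definition addx x := Seq mulN (copy_add (rVar x) rP).

Fixpoint eval_cmd (f : fo_form) : cmd :=
  match f with
  | FLe t1 t2 => Seq (add_term t1) (Seq (Loop rP (inc rV)) (Seq (add_term t2) cmp))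
  | FIn x => Seq (copy_add (rVar x) rP) (read_at rIn (odflt false))
  | FInD x => Seq (copy_add (rVar x) rP) (read_at rIn isSome)
  | FRel i x y z => Seq (add_term (nseq i IOne))
      (Seq (addx x) (Seq (addx y) (Seq (addx z) (read_at rCert (odflt false)))))
  | FNot f => Seq (eval_cmd f) (Case rRes (Push rRes false) (Push rRes true) Skip)
  | FAnd f g => Seq (eval_cmd f) (Seq (eval_cmd g) (comb andb))
  | FOr f g => Seq (eval_cmd f) (Seq (eval_cmd g) (comb orb))
  | FImp f g => Seq (eval_cmd f) (Seq (eval_cmd g) (comb implb))
  | FAll x f => quant x true andb (eval_cmd f)
  | FEx x f => quant x false orb (eval_cmd f)
  end.

(* The loop evaluating a quantifier clears the counter of its variable on exit. *)
Fixpoint noshadow (bs : seq nat) (f : fo_form) : bool :=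
  match f with
  | FNot f => noshadow bs f
  | FAnd f g | FOr f g | FImp f g => noshadow bs f && noshadow bs g
  | FAll x f | FEx x f => (x \notin bs) && noshadow (x :: bs) f
  | _ => true
  end.

(** * Correctness and cost of the evaluator *)

Record scratch (s : stacks) N e : Prop := Scratch {
  sc_N : s rN = un N; sc_T : s rT = [::]; sc_U : s rU = [::];
  sc_var : forall x, s (rVar x) = un (e x) }.

Lemma scratch_updP s N e v : scratch s N e -> scratch (upd s rP v) N e.
Proof. by case=> h1 h2 h3 h4; split=> // x; rewrite updE rVar_eq. Qed.

Lemma scratch_updV s N e v : scratch s N e -> scratch (upd s rV v) N e.
Proof. by case=> h1 h2 h3 h4; split=> // x; rewrite updE rVar_eq. Qed.

Lemma scratch_updR s N e v : scratch s N e -> scratch (upd s rRes v) N e.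
Proof. by case=> h1 h2 h3 h4; split=> // x; rewrite updE rVar_eq. Qed.

Lemma run_inc i s m : s i = un m -> run (inc i) s 1 (upd s i (un m.+1)).
Proof. by move=> h; have := run_push i true s; rewrite h. Qed.

Lemma add_itemP it S s N e p : scratch s N e -> (forall x, e x <= S) -> s rP = un p ->
  run (add_item it) s (7 * S * S + 18 * S + 3) (upd s rP (un (p + ival e it))).
Proof.
case=> hN hT hU hv hS hp; case: it => [|x|x y] /=.
- by apply: run_le; [rewrite addn1; apply: run_inc hp|lia].
- apply: (@run_le _ _ (e x * 7 + 2)); last by have := hS x; nia.
  have -> : un (p + e x) = un (e x) ++ s rP by rewrite hp -nseqD addnC.
  by apply: run_copy_add; rewrite ?rVar_eq.
- apply: run_le; first by apply: run_addm.
  by have := hS x; have := hS y; nia.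
Qed.

Lemma add_termP t S s N e p : scratch s N e -> (forall x, e x <= S) -> s rP = un p ->
  run (add_term t) s (size t * (7 * S * S + 18 * S + 3)) (upd s rP (un (p + tval e t))).
Proof.
move=> hs hS; elim: t s p hs => [|it t IH] s p hs hp.
  by rewrite addn0 upd_id //; apply: run_skip.
rewrite [size _]/= mulSn; apply: run_seq; first exact: (add_itemP it hs hS hp).
have := IH _ (p + ival e it) (scratch_updP (un (p + ival e it)) hs) erefl.
by rewrite upd_upd -(addnA p).
Qed.

Lemma tval_le S e t : (forall x, e x <= S) -> 0 < S -> tval e t <= size t * (S * S).
Proof.
move=> hS h0; elim: t => //= it t IH; rewrite /tval /= mulSn leq_add //.
by case: it => [|x|x y] /=; [|have := hS x|have := hS x; have := hS y]; nia.
Qed.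

Lemma run_comb op s b1 b2 v : s rRes = b2 :: b1 :: v ->
  run (comb op) s 5 (upd s rRes (op b1 b2 :: v)).
Proof.
move=> h; apply: (@run_le _ _ (1 + 2 + 2)) => //; apply: run_case; rewrite h.
have e b : run (Push rRes b) (upd (upd s rRes (b1 :: v)) rRes v) 1 (upd s rRes (b :: v)).
  by have := run_push rRes b (upd (upd s rRes (b1 :: v)) rRes v); rewrite !updE eqxx !upd_upd.
by case: b2 h => h; apply: run_case; rewrite updE eqxx; case: (b1) e; apply.
Qed.

Lemma run_clear i s m : s i = un m -> run (Loop i Skip) s (m * 2 + 1) (upd s i [::]).
Proof.
move=> h; have := @run_count i Skip (fun j => upd s i (un j)) m 0.
rewrite -h upd_id //; apply=> j hj; first by rewrite updE eqxx.
by rewrite upd_upd; apply: run_skip.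
Qed.

Lemma run_cmp s a b : s rV = un a -> s rP = un b -> s rU = [::] ->
  run cmp s (7 * a + 2 * b + 10)
    (upd (upd (upd s rV [::]) rP [::]) rRes ((a <= b) :: s rRes)).
Proof.
move=> hV hP hU.
pose f j := upd (upd (upd s rV (un j)) rP (un (b - (a - j)))) rU (un ((a - j) - b)).
apply: (@run_le _ _ (a * (1 + 2 + 2) + 1 + (b * 2 + 1 + (a * 2 + 1 + 1 + 2)))); last by lia.
apply: (@run_seq _ _ _ _ (f 0)).
  have -> : s = f a.
    by rewrite /f subnn subn0 sub0n /=; upd_ext.
  apply: run_count => j hj; first by [].
  apply: run_case; rewrite /f !updE /=.
  have [h|h] := ltnP (a - j.+1) b.
    have -> : b - (a - j.+1) = (b - (a - j)).+1 by lia.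
    have -> : a - j.+1 - b = 0 by lia.
    have -> : a - j - b = 0 by lia.
    rewrite /=; apply: (@run_le _ _ 0) => //.
    set X := upd _ rP _; set Y := upd _ rU _; suff -> : X = Y by apply: run_skip.
    by rewrite /X /Y; upd_ext.
  have -> : b - (a - j.+1) = 0 by lia.
  have -> : b - (a - j) = 0 by lia.
  have -> : a - j - b = (a - j.+1 - b).+1 by lia.
  rewrite /=; set X := upd _ rV (un j); set Y := upd _ rU _.
  have -> : Y = upd X rU (un (a - j.+1 - b).+1) by rewrite /X /Y; upd_ext.
  by apply: run_inc.
rewrite /f subn0; set s1 := upd _ rU _.
apply: (@run_seq _ _ _ _ (upd s1 rP [::])).
  by apply: run_le; [apply: (@run_clear rP s1 (b - a))|lia].
set s2 := upd s1 _ _.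
have hs2 : s2 rU = un (a - b) by rewrite /s2 /s1 !updE.
have hr : s2 rRes = s rRes by rewrite /s2 /s1 !updE.
set sf := upd (upd _ rP _) rRes _.
have -> : sf = upd (upd s2 rU [::]) rRes ((a <= b) :: s rRes).
  by rewrite /sf /s2 /s1; upd_ext.
apply: run_case; rewrite hs2.
case: leqP => [h|h].
  have -> : a - b = 0 by lia.
  rewrite /= [upd s2 _ _]upd_id; last by rewrite hs2 (_ : a - b = 0) //; lia.
  by apply: run_le; [have := run_push rRes true s2; rewrite hr; apply|lia].
rewrite (_ : a - b = (a - b.+1).+1) /=; last by lia.
apply: (@run_seq _ _ _ _ (upd s2 rU [::])).
  have := @run_clear rU (upd s2 rU (un (a - b.+1))) (a - b.+1).
  rewrite updE eqxx upd_upd => /(_ erefl) h1; apply: run_le; [exact: h1|lia].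
by have := run_push rRes false (upd s2 rU [::]); rewrite updE hr.
Qed.

Record env (s : stacks) N w ct e : Prop := Env {
  ev_sc : scratch s N e; ev_in : s rIn = w; ev_cert : s rCert = ct;
  ev_Z : s rZ = [::]; ev_P : s rP = [::]; ev_V : s rV = [::] }.

Lemma env_updR s N w ct e v : env s N w ct e -> env (upd s rRes v) N w ct e.
Proof. by case=> h1 h2 h3 h4 h5 h6; split=> //; apply: scratch_updR. Qed.

Lemma run_addx S s N e x p : scratch s N e -> (forall x, e x <= S) -> N <= S ->
  s rP = un p ->
  run (addx x) s (p * (10 * S + 4) + 7 * S + 4) (upd s rP (un (p * N + e x))).
Proof.
case=> hN hT hU hv hS hNS hp.
apply: (@run_le _ _ (p * (10 * N + 4) + 2 + (e x * 7 + 2))); last first.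
  by have := hS x; have : p * (10 * N + 4) <= p * (10 * S + 4); nia.
apply: run_seq; first exact: run_mulN.
have := @run_copy_add (rVar x) rP (upd s rP (un (p * N))) (e x).
rewrite !rVar_eq // !updE rVar_eq // hv hT eqxx -nseqD upd_upd (addnC (e x)); exact.
Qed.

Lemma env_updv s N w ct e x v : env s N w ct e ->
  env (upd s (rVar x) (un v)) N w ct (upd e x v).
Proof.
case=> -[hN hT hU hv] h2 h3 h4 h5 h6.
have E r : r < 9 -> upd s (rVar x) (un v) r = s r by move=> h; rewrite updE rVar_eq.
split; rewrite ?E //; split; rewrite ?E // => y.
by rewrite updE rVar_rVar [upd e x v y]/upd; case: eqP.
Qed.

Lemma env_updl s N w ct e x v : env s N w ct e -> env (upd s (rLim x) v) N w ct e.
Proof.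
case=> -[hN hT hU hv] h2 h3 h4 h5 h6.
have E r : r < 9 -> upd s (rLim x) v r = s r by move=> h; rewrite updE rLim_eq.
split; rewrite ?E //; split; rewrite ?E // => y.
by rewrite updE rVar_rLim.
Qed.

Lemma run_quant x init op c s N w ct e B (h : nat -> bool) :
  env s N w ct e -> e x = 0 -> s (rLim x) = [::] ->
  (forall v s', v < N -> env s' N w ct (upd e x v) ->
     (forall y, y != x -> s' (rLim y) = s (rLim y)) ->
     run c s' B (upd s' rRes (h v :: s' rRes))) ->
  run (quant x init op c) s (N * B + 20 * N + 10)
    (upd s rRes (foldl op init (map h (iota 0 N)) :: s rRes)).
Proof.
move=> he ex hl hc; have hx : s (rVar x) = [::] by rewrite (sc_var (ev_sc he)) ex.
pose acc m := foldl op init (map h (iota 0 m)).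
pose f j := upd (upd (upd s rRes (acc (N - j) :: s rRes)) (rVar x) (un (N - j))) (rLim x) (un j).
apply: (@run_le _ _ (1 + (N * 7 + 2 + (N * (B + (5 + 1) + 2) + 1 + (N * 2 + 1))))); last by nia.
apply: (run_seq (run_push _ _ _)).
have e1 : upd s rRes (init :: s rRes) =
    upd (upd s rRes (init :: s rRes)) (rVar x) [::].
  by rewrite [RHS]upd_id // updE rVar_eq.
apply: (@run_seq _ _ _ _ (f N)).
  have := @run_copy_add rN (rLim x) (upd s rRes (init :: s rRes)) N.
  rewrite !rLim_eq // !updE /= (sc_N (ev_sc he)) (sc_T (ev_sc he)) ?rLim_eq // hl cats0.
  move=> /(_ isT isT isT erefl erefl).
  by rewrite e1 /f subnn.
apply: (@run_seq _ _ _ _ (f 0)).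
  apply: run_count => j hj; first by rewrite /f updE eqxx.
  set s1 := upd (f _) _ _; set m := N - j.+1.
  have hm : N - j = m.+1 by rewrite /m; lia.
  have hs1 : s1 = upd (upd (upd s rRes (acc m :: s rRes)) (rVar x) (un m)) (rLim x) (un j).
    by rewrite /s1 /f upd_upd.
  have he1 : env s1 N w ct (upd e x m).
    by rewrite hs1; apply/env_updl/env_updv/env_updR.
  have hr : s1 rRes = acc m :: s rRes.
    by rewrite hs1 !updE rLim_eq // rVar_eq.
  apply: run_seq.
    apply: (hc m) => //; first by rewrite /m; lia.
    by move=> y hy; rewrite hs1 !updE rLim_rLim (negbTE hy) !rVar_rLim rLim_eq.
  apply: run_seq; first by apply: run_comb; rewrite updE eqxx hr.
  rewrite upd_upd.
  have -> : op (acc m) (h m) = acc m.+1.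
    by rewrite /acc -(addn1 m) iotaD map_cat foldl_cat.
  have -> : f j = upd (upd s1 rRes (acc m.+1 :: s rRes)) (rVar x) (un m.+1).
    rewrite hs1 /f hm; apply: funext => r; rewrite !updE.
    case: (r =P rRes) => [->|_]; first by rewrite rLim_eq // rVar_eq.
    case: (r =P rVar x) => [->|_]; first by rewrite rVar_rLim.
    by [].
  by apply: run_inc; rewrite hs1 !updE rVar_eq // rVar_rLim eqxx.
have := @run_clear (rVar x) (f 0) N.
rewrite {1}/f subn0 !updE rVar_rLim eqxx => /(_ erefl); congr run.
rewrite /f subn0; apply: funext => r; rewrite !updE.
case: (r =P rVar x) => [->|_]; first by rewrite rVar_eq.
by case: (r =P rLim x) => [->|_]; first by rewrite rLim_eq.
Qed.

Lemma foldl_andb b (u : seq bool) : foldl andb b u = b && all id u.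
Proof. by elim: u b => [|c u IH] b /=; rewrite ?andbT // IH andbA. Qed.

Lemma foldl_orb b (u : seq bool) : foldl orb b u = b || has id u.
Proof. by elim: u b => [|c u IH] b /=; rewrite ?orbF // IH orbA. Qed.

Lemma eval_cmdP f : exists2 B, polyB B & forall bs S s N w ct e,
  noshadow bs f -> env s N w ct e -> (forall y, y \notin bs -> e y = 0 /\ s (rLim y) = [::]) ->
  0 < S -> N <= S -> (forall x, e x <= S) ->
  run (eval_cmd f) s (B S) (upd s rRes (holds N w (certR N ct) e f :: s rRes)).
Proof.
have binary op f1 f2 (ff := Seq (eval_cmd f1) (Seq (eval_cmd f2) (comb op))) :
  (exists2 B, polyB B & forall bs S s N w ct e,
  noshadow bs f1 -> env s N w ct e -> (forall y, y \notin bs -> e y = 0 /\ s (rLim y) = [::]) ->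
  0 < S -> N <= S -> (forall x, e x <= S) ->
  run (eval_cmd f1) s (B S) (upd s rRes (holds N w (certR N ct) e f1 :: s rRes))) ->
  (exists2 B, polyB B & forall bs S s N w ct e,
  noshadow bs f2 -> env s N w ct e -> (forall y, y \notin bs -> e y = 0 /\ s (rLim y) = [::]) ->
  0 < S -> N <= S -> (forall x, e x <= S) ->
  run (eval_cmd f2) s (B S) (upd s rRes (holds N w (certR N ct) e f2 :: s rRes))) ->
  exists2 B, polyB B & forall bs S s N w ct e,
  noshadow bs f1 && noshadow bs f2 -> env s N w ct e ->
  (forall y, y \notin bs -> e y = 0 /\ s (rLim y) = [::]) ->
  0 < S -> N <= S -> (forall x, e x <= S) ->
  run ff s (B S) (upd s rRes (op (holds N w (certR N ct) e f1) (holds N w (certR N ct) e f2)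
     :: s rRes)).
  move=> [B1 p1 h1] [B2 p2 h2]; exists (fun S => B1 S + (B2 S + 5)); first by polyB.
  move=> bs S s N w ct e /andP[ok1 ok2] he hb hS hN hx.
  apply: (run_seq (h1 bs S s N w ct e ok1 he hb hS hN hx)).
  apply: run_seq.
    apply: (h2 bs S _ N w ct e) => //; first exact: env_updR.
  have := @run_comb op (upd (upd s rRes (holds N w (certR N ct) e f1 :: s rRes)) rRes
    (holds N w (certR N ct) e f2 :: holds N w (certR N ct) e f1 :: s rRes))
    (holds N w (certR N ct) e f1) (holds N w (certR N ct) e f2) (s rRes) erefl.
  by rewrite !upd_upd.
have quanti x init op f1 (F : (nat -> bool) -> seq nat -> bool) :
  (forall h u, foldl op init (map h u) = F h u) ->
  (exists2 B, polyB B & forall bs S s N w ct e,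
  noshadow bs f1 -> env s N w ct e -> (forall y, y \notin bs -> e y = 0 /\ s (rLim y) = [::]) ->
  0 < S -> N <= S -> (forall x, e x <= S) ->
  run (eval_cmd f1) s (B S) (upd s rRes (holds N w (certR N ct) e f1 :: s rRes))) ->
  exists2 B, polyB B & forall bs S s N w ct e,
  (x \notin bs) && noshadow (x :: bs) f1 -> env s N w ct e ->
  (forall y, y \notin bs -> e y = 0 /\ s (rLim y) = [::]) ->
  0 < S -> N <= S -> (forall x, e x <= S) ->
  run (quant x init op (eval_cmd f1)) s (B S)
   (upd s rRes (F (fun v => holds N w (certR N ct) (upd e x v) f1) (iota 0 N) :: s rRes)).
  move=> hF [B p h]; exists (fun S => S * B S + 20 * S + 10); first by polyB.
  move=> bs S s N w ct e /andP[xbs ok] he hb hS hN hx.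
  have [ex lx] := hb x xbs; rewrite -hF.
  apply: run_le; first apply: (run_quant _ _ (B := B S) he ex lx) => v s' hv he' hl.
    apply: (h (x :: bs)) => //.
      move=> y; rewrite inE negb_or => /andP[yx /hb[ey ly]].
      by rewrite /upd (negbTE yx) hl.
    by move=> y; rewrite /upd; case: eqP => // _; lia.
  by nia.
elim: f => [t1 t2|x|x|i x y z|f IH|f IHf g IHg|f IHf g IHg|f IHf g IHg|x f IH|x f IH].
- exists (fun S => size t1 * (7 * S * S + 18 * S + 3) + (size t1 * (S * S) * 3 + 1 +
    (size t2 * (7 * S * S + 18 * S + 3) +
      (7 * (size t1 * (S * S)) + 2 * (size t2 * (S * S)) + 10)))); first by polyB.
  move=> bs S s N w ct e _ he hb hS hN hx.
  have hs := ev_sc he.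
  apply: run_seq; first exact: (add_termP t1 hs hx (ev_P he : _ = un 0)).
  rewrite add0n; set a := tval e t1; have ha := tval_le t1 hx hS.
  apply: (@run_seq _ _ _ _ (upd s rV (un a))).
    have := @run_mv rP rV (upd s rP (un a)) a isT erefl; rewrite updE /= (ev_V he) cats0.
    have -> : upd (upd (upd s rP (un a)) rV (un a)) rP [::] = upd s rV (un a).
      by have := ev_P he => hp; upd_ext.
    by move=> h1; apply: run_le h1 _; rewrite /a; lia.
  apply: run_seq.
    by apply: (add_termP t2 (scratch_updV _ hs) hx (p := 0)); rewrite updE /= (ev_P he).
  rewrite add0n; set b := tval e t2; have hb' := tval_le t2 hx hS.
  have := @run_cmp (upd (upd s rV (un a)) rP (un b)) a b erefl erefl (sc_U hs).
  move=> h1; apply: (@run_le _ _ (7 * a + 2 * b + 10)); last first.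
    by move: ha hb'; rewrite -/a -/b; lia.
  move: h1; congr run; rewrite !updE /=.
  have := ev_V he; have := ev_P he => e1 e2.
  by upd_ext.
- exists (fun S => S * 7 + 2 + (S * 11 + 6)); first by polyB.
  move=> bs S s N w ct e _ he hb hS hN hx.
  apply: (@run_le _ _ (e x * 7 + 2 + (e x * 11 + 6))); last by have := hx x; lia.
  apply: (@run_seq _ _ _ _ (upd s rP (un (e x)))).
    have := @run_copy_add (rVar x) rP s (e x); rewrite (ev_P he) cats0; apply; rewrite ?rVar_eq //.
      by rewrite (sc_var (ev_sc he)).
    exact: (sc_T (ev_sc he)).
  have := @run_read_at rIn (odflt false) (upd s rP (un (e x))) (e x) isT erefl (ev_Z he).
  by rewrite !updE /= upd_upd [upd s rP [::]]upd_id ?(ev_P he) // (ev_in he).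
- exists (fun S => S * 7 + 2 + (S * 11 + 6)); first by polyB.
  move=> bs S s N w ct e _ he hb hS hN hx.
  apply: (@run_le _ _ (e x * 7 + 2 + (e x * 11 + 6))); last by have := hx x; lia.
  apply: (@run_seq _ _ _ _ (upd s rP (un (e x)))).
    have := @run_copy_add (rVar x) rP s (e x); rewrite (ev_P he) cats0; apply; rewrite ?rVar_eq //.
      by rewrite (sc_var (ev_sc he)).
    exact: (sc_T (ev_sc he)).
  have := @run_read_at rIn isSome (upd s rP (un (e x))) (e x) isT erefl (ev_Z he).
  by rewrite !updE /= upd_upd [upd s rP [::]]upd_id ?(ev_P he) // (ev_in he).
(* Bounds on the successive Horner values of the address. *)
- pose P1 S := i * S + S; pose P2 S := P1 S * S + S; pose P3 S := P2 S * S + S.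
  exists (fun S => i * (7 * S * S + 18 * S + 3) + (i * (10 * S + 4) + 7 * S + 4 +
     (P1 S * (10 * S + 4) + 7 * S + 4 + (P2 S * (10 * S + 4) + 7 * S + 4 +
      (P3 S * 11 + 6))))); first by rewrite /P3 /P2 /P1; polyB.
  move=> bs S s N w ct e _ he hb hS hN hx.
  have hs := ev_sc he.
  have sum1 : tval e (nseq i IOne) = i by rewrite /tval map_nseq /= sumn_nseq mul1n.
  apply: run_seq.
    have := add_termP (nseq i IOne) hs hx (ev_P he : _ = un 0).
    by rewrite size_nseq add0n sum1; apply.
  apply: run_seq; first exact: (run_addx x (scratch_updP _ hs) hx hN erefl).
  set a1 := i * N + e x; have h1 : a1 <= P1 S by rewrite /a1 /P1; have := hx x; nia.
  rewrite upd_upd; apply: run_seq.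
    apply: run_le; first exact: (run_addx y (scratch_updP _ hs) hx hN erefl).
    by rewrite !leq_add2r leq_mul2r h1 orbT.
  set a2 := a1 * N + e y.
  have h2 : a2 <= P2 S by rewrite /a2 /P2; have := hx y; have := leq_mul h1 hN; lia.
  rewrite upd_upd; apply: run_seq.
    apply: run_le; first exact: (run_addx z (scratch_updP _ hs) hx hN erefl).
    by rewrite !leq_add2r leq_mul2r h2 orbT.
  set a3 := a2 * N + e z.
  have h3 : a3 <= P3 S by rewrite /a3 /P3; have := hx z; have := leq_mul h2 hN; lia.
  rewrite upd_upd; apply: (@run_le _ _ (a3 * 11 + 6)); last by rewrite leq_add2r leq_mul2r h3.
  have := @run_read_at rCert (odflt false) (upd s rP (un a3)) a3 isT erefl (ev_Z he).
  rewrite !updE /= upd_upd [upd s rP [::]]upd_id ?(ev_P he) // (ev_cert he).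
  by rewrite /certR onth_nth.
- case: IH => B p h; exists (fun S => B S + (1 + 2)); first by polyB.
  move=> bs S s N w ct e ok he hb hS hN hx.
  apply: (run_seq (h bs S s N w ct e ok he hb hS hN hx)).
  apply: run_case; rewrite updE eqxx /=.
  have := run_push rRes; case: (holds _ _ _ _ f) => hp.
    by have := hp false (upd (upd s rRes (true :: s rRes)) rRes (s rRes)); rewrite !upd_upd updE.
  by have := hp true (upd (upd s rRes (false :: s rRes)) rRes (s rRes)); rewrite !upd_upd updE.
- exact: (binary andb).
- exact: (binary orb).
- exact: (binary implb).
- by apply: (quanti x true andb f all) => // h u; rewrite foldl_andb all_map.
- by apply: (quanti x false orb f has) => // h u; rewrite foldl_orb has_map.
Qed.

(** * A descriptive criterion for NExpTime *)

Fixpoint rel_bound (f : fo_form) : nat :=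
  match f with
  | FRel i _ _ _ => i.+1
  | FNot f | FAll _ f | FEx _ f => rel_bound f
  | FAnd f g | FOr f g | FImp f g => maxn (rel_bound f) (rel_bound g)
  | _ => 0
  end.

(** A formula sees only finitely many relations, and only below [N]; this lets arbitrary relations
    be replaced by a finite certificate. *)
Lemma eq_holds N w (R R' : nat -> nat -> nat -> nat -> bool) m f e :
  (forall i x y z, i < m -> x < N -> y < N -> z < N -> R i x y z = R' i x y z) ->
  rel_bound f <= m -> (forall y, e y < N) -> holds N w R e f = holds N w R' e f.
Proof.
move=> hR; elim: f e => [t1 t2|x|x|i x y z|f IH|f IHf g IHg|f IHf g IHg|f IHf g IHg|x f IH|x f IH]
  e /= hm he //.
- by apply: hR.
- by rewrite IH.
- by rewrite IHf ?IHg //; lia.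
- by rewrite IHf ?IHg //; lia.
- by rewrite IHf ?IHg //; lia.
- apply: eq_in_all => v; rewrite mem_iota => hv; apply: IH => // y.
  by rewrite /upd; case: eqP.
- apply: eq_in_has => v; rewrite mem_iota => hv; apply: IH => // y.
  by rewrite /upd; case: eqP.
Qed.

Definition cert_of N (R : nat -> nat -> nat -> nat -> bool) m : seq bool :=
  mkseq (fun p => R (p %/ N %/ N %/ N) (p %/ N %/ N %% N) (p %/ N %% N) (p %% N))
    (m * N * N * N).

Lemma certR_cert_of N R m i x y z : i < m -> x < N -> y < N -> z < N ->
  certR N (cert_of N R m) i x y z = R i x y z.
Proof.
move=> hi hx hy hz; have hN : 0 < N by lia.
rewrite /certR /cert_of nth_mkseq; last first.
  have h1 : i * N + x < m * N by nia.
  have h2 : (i * N + x) * N + y < m * N * N by nia.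
  by nia.
have dm q r : r < N -> ((q * N + r) %/ N = q) * ((q * N + r) %% N = r).
  by move=> hr; rewrite divnMDl // divn_small // addn0 modnMDl modn_small.
by rewrite !(dm _ z hz) !(dm _ y hy) !(dm _ x hx).
Qed.

(** The unary prefix of the guess is taken as [N], the rest as the certificate. *)
Definition fo_program f := Seq (Loop rCert (inc rN)) (eval_cmd f).

Lemma fo_program_decides f : noshadow [::] f -> exists2 B, polyB B & forall N v w,
  (if v is b :: _ then b = false else True) ->
  decides rRes (fo_program f) w (un N ++ v) (B N.+1)
    (holds N w (certR N (behead v)) (fun=> 0) f).
Proof.
move=> ok; have [B pB hB] := eval_cmdP f.
exists (fun S => S * (1 + 2) + 1 + B S); first by polyB.
move=> N v w hv; set g := un N ++ v.
pose s0 j := upd (upd (stacks0 w g) rN (un (N - j))) rCert (un j ++ v).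
have e0 : s0 N = stacks0 w g.
  rewrite /s0 subnn; apply: funext => r; rewrite !updE.
  by case: (r =P rCert) => [->//|_]; case: (r =P rN) => [->|].
set s1 := upd (s0 0) rCert (behead v).
have r1 : run (Loop rCert (inc rN)) (stacks0 w g) (N * (1 + 2) + 1) s1.
  rewrite -e0; apply: run_loop hv _ => j hj; first by [].
  have -> : s0 j = upd (upd (s0 j.+1) rCert (un j ++ v)) rN (un (N - j.+1).+1).
    rewrite /s0 (_ : N - j = (N - j.+1).+1); last by lia.
    by upd_ext.
  by apply: run_inc.
have he : env s1 N w (behead v) (fun=> 0).
  by split=> //; split=> //; rewrite /s1 /s0 !updE subn0.
have hb y : y \notin (nil : seq nat) -> 0 = 0 /\ s1 (rLim y) = [::] by [].
have r2 := hB [::] N.+1 s1 N w (behead v) _ ok he hb isT (leqnSn N) (fun=> isT).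
exists (upd s1 rRes (holds N w (certR N (behead v)) (fun=> 0) f :: s1 rRes)), (s1 rRes).
split; last by rewrite updE eqxx.
by apply: run_seq r2; apply: run_le r1 _; nia.
Qed.

(** Every guess has the shape that the program expects, so no check of well-formedness is needed. *)
Lemma un_split g : exists N v, g = un N ++ v /\ (if v is b :: _ then b = false else True).
Proof.
elim: g => [|[] g [N [v [-> hv]]]]; first by exists 0, [::].
- by exists N.+1, v.
- by exists 0, (false :: un N ++ v).
Qed.

(** With [S = N + n] one has S <= 2 ^ (2 n ^ (k+1)), so a S ^ a <= 2 ^ (3a n ^ (k+1)); the factor 3a
    is absorbed as n ^ (3a), which uses 1 < n. *)
Lemma polyB_exp_bound B k : polyB B ->
  exists k', forall n N, 1 < n -> N <= 2 ^ (n ^ k) -> B (N + n) <= 2 ^ (n ^ k').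
Proof.
case=> a hB; exists (3 * a + k.+1) => n N hn hN.
have h0 : 0 < N + n by lia.
apply: leq_trans (hB _ h0) _.
have hS : N + n <= 2 ^ (2 * n ^ k.+1).
  apply: (@leq_trans (2 ^ (n ^ k) * 2 ^ n)).
    have h1 : 1 < 2 ^ (n ^ k) by rewrite -{1}(expn0 2) ltn_exp2l // expn_gt0 ltnW.
    have h2 : n < 2 ^ n by apply: ltn_expl.
    by nia.
  rewrite -expnD leq_exp2l // expnS.
  have : 0 < n ^ k by rewrite expn_gt0 ltnW.
  by nia.
apply: (@leq_trans (2 ^ a * 2 ^ (2 * n ^ k.+1 * a))).
  apply: leq_mul; first exact/ltnW/ltn_expl.
  by rewrite expnM; case: (a) => [|a']; rewrite ?expn0 // leq_exp2r.
rewrite -expnD leq_exp2l // expnD.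
have h3 : 3 * a <= n ^ (3 * a) by apply/ltnW/ltn_expl.
have h4 : 0 < n ^ k.+1 by rewrite expn_gt0 ltnW.
by have := leq_mul h3 (leqnn (n ^ k.+1)); nia.
Qed.

(** The evaluation half of Fagin's theorem, one exponential higher. Only completeness bounds [N];
    soundness must cover any [N] and [R], since the machine may guess them freely. *)
Theorem fo_in_NExpTime (X : Type) (valid : X -> Prop) (enc : X -> seq bool) (P : X -> Prop)
    (f : fo_form) (k : nat) :
  noshadow [::] f ->
  (forall x, valid x -> 0 < size (enc x)) ->
  (forall x, valid x -> P x -> exists N R,
     [/\ 0 < N, N <= 2 ^ ((size (enc x)).+1 ^ k) & sat N (enc x) R (fun=> 0) f]) ->
  (forall x N R, valid x -> sat N (enc x) R (fun=> 0) f -> P x) ->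
  in_NExpTime valid enc P.
Proof.
move=> ok hpos complete sound.
have [B pB hB] := fo_program_decides ok.
set C := decider rRes (fo_program f); set m := rel_bound f.
(* [B] need not be monotone, so it is replaced by the monotone majorant [D], which can be compared
   at [N.+1] and at [S]. *)
case: pB => a ha; pose D S := a * S ^ a.
have pD : polyB D by exists a.
pose G S := S + 1 + m * S * S * S.
pose T S := (D S + 2) * (3 * (S + G S + width C + D S + 1) + 8) + 2 * (S + G S) + 8.
have pT : polyB T.
  have pG : polyB G by rewrite /G; polyB.
  by rewrite /T; polyB.
have [k' hk'] := polyB_exp_bound k pT.
exists (mach C (width C)), k' => x vx; split.
  move=> /(complete x vx)[N [R [N0 hN /holdsP hR]]].
  set n := size (enc x) in hN *; have n1 : 1 < n.+1 by rewrite ltnS; apply: hpos.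
  apply: accepts_monotone (hk' n.+1 N n1 hN) _.
  have hd := hB N (false :: cert_of N R m) (enc x) erefl.
  rewrite [behead _]/= (@eq_holds _ _ _ R m) // in hd; last exact: certR_cert_of.
  rewrite hR in hd.
  have := decider_complete hd; apply: accepts_monotone.
  rewrite size_cat size_nseq /= /cert_of size_mkseq -/n -/C.
  set S := N + n.+1.
  have hD : B N.+1 <= D S.
    apply: leq_trans (ha N.+1 isT) _; rewrite /D leq_mul2l; apply/orP; right.
    by case: (a) => [|a']; rewrite ?expn0 // leq_exp2r // /S; lia.
  have hG : N + (m * N * N * N).+1 <= G S.
    have NS : N <= S by rewrite /S; lia.
    have := leq_mul (leq_mul (leq_mul (leqnn m) NS) NS) NS; rewrite /G; lia.
  have nS : n <= S by rewrite /S; lia.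
  rewrite /T; apply: leq_add => //; apply: leq_add; last by lia.
  by apply: leq_mul; lia.
move=> /decider_sound[g hg]; have [N [v [eg hv]]] := un_split g; subst g.
(* If the formula failed for this guess, the program would halt with [false], which acceptance
   excludes. *)
apply: (sound x N (certR N (behead v))) => //; apply/holdsP/negPn/negP => /negbTE hf.
by apply: (hg (B N.+1)); have := hB N v (enc x) hv; rewrite hf.
Qed.

(** * Small solutions of homogeneous linear inequalities *)

Import Order.TTheory GRing.Theory Num.Theory.

Section LinearAlgebra.
Local Open Scope ring_scope.

Lemma det_norm_le n (M : 'M[int]_n) (B : nat) :
  (forall i j, `|M i j| <= B%:R) -> `|\det M| <= (n`! * B ^ n)%:R.
Proof.
move=> hM; apply: le_trans (ler_norm_sum _ _ _) _.
have h (s : 'S_n) : `|(-1) ^+ s * \prod_i M i (s i)| <= (B ^ n)%:R.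
  rewrite normrM normrX normrN1 expr1n mul1r normr_prod natrX.
  rewrite -[X in _ <= B%:R ^+ X](card_ord n) -prodr_const.
  by apply: ler_prod => i _; rewrite normr_ge0 hM.
apply: le_trans (ler_sum _ (fun s _ => h s)) _.
by rewrite sumr_const card_Sn -mulrnA mulnC.
Qed.

(** The entries of [a *m \adj M] are the numerators of Cramer's rule. Each is a sum of n products of
    an entry of [a] with a minor of order n - 1, and n (n-1)! B ^ n = n! B ^ n. *)
Lemma mul_adj_norm_le n (a : 'rV[int]_n) (M : 'M[int]_n) (B : nat) i :
  (forall i j, `|M i j| <= B%:R) -> (forall j, `|a 0 j| <= B%:R) ->
  `|(a *m \adj M) 0 i| <= (n`! * B ^ n)%:R.
Proof.
move=> hM ha; rewrite mxE; apply: le_trans (ler_norm_sum _ _ _) _.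
case: n a M i hM ha => [|n] a M i hM ha; first by case: i.
have h (j : 'I_n.+1) : `|a 0 j * \adj M j i| <= (B * (n`! * B ^ n))%:R.
  rewrite normrM natrM; apply: ler_pM => //.
  rewrite mxE /cofactor normrM normrX normrN1 expr1n mul1r.
  by apply: det_norm_le => k l; rewrite !mxE.
apply: le_trans (ler_sum _ (fun j _ => h j)) _.
rewrite sumr_const card_ord -mulrnA ler_nat factS expnS; lia.
Qed.

Section Support.
Variables (F : realFieldType) (t d : nat) (A : 'M[F]_(t, d)) (j : 'I_t).
Implicit Types x y z : 'rV[F]_t.

Definition supp x := [set i | x 0 i != 0].

(* If x itself is not minimal because of y, subtracting the largest multiple of y that
   keeps x nonnegative shrinks the support without changing coordinate j. *)
Lemma minimal_support x :
  (forall i, 0 <= x 0 i) -> 0 < x 0 j -> x *m A = 0 ->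
  exists z, [/\ forall i, 0 <= z 0 i, 0 < z 0 j, z *m A = 0, supp z \subset supp x &
    forall y, y *m A = 0 -> supp y \subset supp z -> y 0 j = 0 -> y = 0].
Proof.
have [n] := ubnP #|supp x|; elim: n x => // n IH x hn x0 xj xA.
have [[y [yA ys yj yn0]]|hno] :=
    EM (exists y, [/\ y *m A = 0, supp y \subset supp x, y 0 j = 0 & y != 0]); last first.
  exists x; split=> // y yA ys yj; apply/eqP/negPn/negP => yn0.
  by apply: hno; exists y.
(* Up to replacing y by its opposite, some entry is positive, so that the minimal ratio below ranges
   over a nonempty set. *)
wlog [i0 yi0] : y yA ys yj yn0 / exists i, 0 < y 0 i.
  move=> hw; have [k yk] : exists k, y 0 k != 0.
    apply: contrapT => hk; move/negP: yn0; apply; apply/eqP/rowP => k; rewrite mxE.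
    by apply/eqP/negPn/negP => h; apply: hk; exists k.
  have [h|h|h] := ltgtP (y 0 k) 0; last by rewrite h eqxx in yk.
    apply: (hw (- y)).
    - by rewrite mulNmx yA oppr0.
    - by apply: subset_trans ys; apply/subsetP => i; rewrite !inE mxE oppr_eq0.
    - by rewrite mxE yj oppr0.
    - by rewrite oppr_eq0.
    - by exists k; rewrite mxE oppr_gt0.
  exact: (hw y yA ys yj yn0 (ex_intro _ k h)).
case: (@arg_minP _ _ _ i0 (fun i => 0 < y 0 i) (fun i => x 0 i / y 0 i) yi0) => i yi imin.
pose z := x - (x 0 i / y 0 i) *: y.
have zE k : z 0 k = x 0 k - x 0 i / y 0 i * y 0 k by rewrite !mxE.
have zi : z 0 i = 0 by rewrite zE divfK ?subrr // gt_eqF.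
have marked : supp z \subset supp x.
  apply/subsetP => k; rewrite !inE zE; apply: contraNneq => xk.
  move/subsetP: ys => /(_ k); rewrite !inE xk eqxx => /contraFT/(_ erefl)/eqP ->.
  by rewrite mulr0 subrr.
have xi : i \in supp x by move/subsetP: ys; apply; rewrite inE gt_eqF.
have zlt : (#|supp z| < n)%N.
  rewrite ltnS in hn; apply: leq_trans hn; apply: proper_card; rewrite properE marked.
  by apply/subsetPn; exists i => //; rewrite inE zi eqxx.
have z0 k : 0 <= z 0 k.
  rewrite zE subr_ge0; have [yk|yk] := lerP (y 0 k) 0; last by rewrite -ler_pdivlMr // imin.
  apply: le_trans (x0 k); rewrite mulr_ge0_le0 // divr_ge0 // ltW //.
have [z' [h1 h2 h3 h4 h5]] : exists z', [/\ forall i, 0 <= z' 0 i, 0 < z' 0 j, z' *m A = 0,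
    supp z' \subset supp z & forall y, y *m A = 0 -> supp y \subset supp z' -> y 0 j = 0 -> y = 0].
  apply: IH => //; first by rewrite zE yj mulr0 subr0.
  by rewrite mulmxBl -scalemxAl xA yA scaler0 subrr.
by exists z'; split=> //; apply: subset_trans marked.
Qed.

End Support.

(* Cramer's rule on the rows of a minimal support gives a small integral multiple. *)
Lemma small_kernel_vector (t d : nat) (A : 'M[int]_(t, d)) (B : nat) (j : 'I_t)
    (x : 'rV[rat]_t) :
  (0 < B)%N -> (forall i c, `|A i c| <= B%:R) ->
  (forall i, 0 <= x 0 i) -> 0 < x 0 j -> x *m map_mx intr A = 0 ->
  exists y : 'I_t -> nat, [/\ (0 < y j)%N, forall i, (y i <= d`! * B ^ d)%N,
    forall i, (0 < y i)%N -> x 0 i != 0 &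
    forall c, \sum_i (y i)%:R * A i c = 0].
Proof.
move=> B0 hA x0 xj xA.
have [z [z0 zj zA marked zmin]] := minimal_support x0 xj xA.
set S := supp z :\ j; pose n := #|S|.
pose f (i : 'I_n) : 'I_t := enum_val i.
have fS i : f i \in S by apply: enum_valP.
have finj : injective f by apply: enum_val_inj.
pose AQ : 'M[rat]_(t, d) := map_mx intr A.
pose G := rowsub f AQ.
pose ext (v : 'rV[rat]_n) : 'rV[rat]_t :=
  \row_k \sum_(i | f i == k) v 0 i.
have extf v i : ext v 0 (f i) = v 0 i.
  by rewrite mxE (big_pred1 i) // => k; rewrite /= (inj_eq finj).
have extN v k : k \notin S -> ext v 0 k = 0.
  by move=> hk; rewrite mxE big1 // => i /eqP e; move: hk; rewrite -e fS.
have extA v : ext v *m AQ = v *m G.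
  apply/rowP => c; rewrite !mxE; under eq_bigr => k _ do rewrite mxE mulr_suml.
  rewrite (exchange_big_dep predT) //=; apply: eq_bigr => i _.
  by rewrite (big_pred1 (f i)) // !mxE.
(* A linear relation between these rows would be a kernel vector supported in [supp z] and vanishing
   at [j], which minimality excludes. *)
have Gfree : row_free G.
  apply: inj_row_free => v vG.
  have : ext v = 0.
    apply: zmin; first by rewrite extA.
      apply/subsetP => k; rewrite inE; apply: contraR => hk; rewrite extN //.
      by rewrite inE (negbTE hk) andbF.
    by rewrite extN // !inE eqxx.
  by move=> e; apply/rowP => i; rewrite -extf e !mxE.
(* Here the number of unknowns leaves the bound: independent rows are no more numerous than the
   columns. *)
have nd : (n <= d)%N by rewrite -(eqP Gfree) rank_leq_col.
have Gfull : row_full G^T by rewrite /row_full mxrank_tr -/(row_free G).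
pose g := fullrankfun Gfull.
pose H : 'M[int]_n := \matrix_(i, k) A (f i) (g k).
have HQ : map_mx intr H = colsub g G by apply/matrixP => i k; rewrite !mxE.
have Hdet : \det H != 0.
  have : colsub g G \in unitmx.
    rewrite -unitmx_tr (_ : _^T = rowsub g G^T); first exact: fullrowsub_unit.
    by apply/matrixP => i k; rewrite !mxE.
  by rewrite -HQ unitmxE det_map_mx unitfE intr_eq0.
pose a : 'rV[int]_n := \row_k A j (g k).
pose z' : 'rV[rat]_n := \row_i z 0 (f i).
have zE : z = z 0 j *: delta_mx 0 j + ext z'.
  apply/rowP => k; rewrite !mxE; have [->|kj] := eqVneq k j.
    rewrite big1 ?addr0 ?mulr1 // => i /eqP e; have := fS i.
    by rewrite e !inE eqxx.
  rewrite mulr0 add0r; have [kS|kS] := boolP (k \in S).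
    rewrite (big_pred1 (enum_rank_in kS k)) ?mxE /f ?enum_rankK_in // => i /=.
    apply/eqP/eqP => [e|->]; last by rewrite enum_rankK_in.
    by apply: finj; rewrite /f enum_rankK_in // e.
  rewrite big1; last by move=> i /eqP e; move: kS; rewrite -e fS.
  by move: kS; rewrite !inE kj negbK => /eqP.
(* The kernel equation restricted to the columns chosen by [g], with row [j] moved to the other
   side. *)
have z'H : z' *m map_mx intr H = - (z 0 j *: map_mx intr a).
  have e : colsub g (z *m AQ) = 0 by rewrite zA; apply/matrixP => ? ?; rewrite !mxE.
  rewrite {1}zE mulmxDl extA -scalemxAl -rowE in e; rewrite HQ mulmx_colsub.
  apply/rowP => k; move/rowP: e => /(_ k); rewrite !mxE => e.
  by apply/eqP; rewrite -addr_eq0 addrC; apply/eqP.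
have Dz' : (\det H)%:~R *: z' = - (z 0 j *: map_mx intr (a *m \adj H)).
  rewrite map_mxM map_mx_adj scalemxAl -mulNmx -z'H -mulmxA mul_mx_adj.
  by rewrite det_map_mx mul_mx_scalar.
have bnd m : (m <= n`! * B ^ n)%N -> (m <= d`! * B ^ d)%N.
  move=> h; apply: leq_trans h _; apply: leq_mul; first exact: leq_fact.
  by rewrite leq_pexp2l.
have hH i k : `|H i k| <= B%:R by rewrite mxE.
(* The multiple of z by |det H| / z_j is integral: its entries are |det H| at [j], the absolute
   values of the entries of [a *m \adj H] on [S], and 0 elsewhere. *)
have [k|y hy] := @fin_all_exists _ (fun=> nat) (fun k m =>
    (m <= d`! * B ^ d)%N /\ `|(\det H)%:~R| * z 0 k = z 0 j * m%:R) _.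
  have [->|kj] := eqVneq k j.
    exists `|\det H|%N; split; last by rewrite mulrC natr_absz intr_norm.
    by apply: bnd; rewrite -lez_nat abszE -(natz (_ * _)); apply: det_norm_le.
  have [kS|kS] := boolP (k \in S); last first.
    exists 0%N; split=> //; rewrite mulr0.
    by move: kS; rewrite !inE kj negbK => /eqP ->; rewrite mulr0.
  pose i := enum_rank_in kS k; have fi : f i = k by rewrite /f enum_rankK_in.
  exists (absz ((a *m \adj H) 0 i)); split.
    apply: bnd; rewrite -lez_nat abszE -(natz (_ * _)); apply: mul_adj_norm_le => // l.
    by rewrite mxE.
  move/rowP: Dz' => /(_ i); rewrite !mxE fi => e.
  rewrite -[z 0 k]ger0_norm // -normrM e normrN normrM (ger0_norm (z0 j)).
  by rewrite natr_absz intr_norm.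
have zjn : z 0 j != 0 by rewrite gt_eqF.
exists y; split.
- have [_] := hy j; rewrite mulrC => /(mulfI zjn) e.
  by rewrite -(ltr0n rat) -e normr_gt0 intr_eq0.
- by move=> i; case: (hy i).
- move=> i yi; have [_ e] := hy i.
  have : i \in supp z.
    rewrite inE; apply: contraTneq yi => zi; move: e; rewrite zi mulr0 => /esym/eqP.
    by rewrite mulf_eq0 (negbTE zjn) pnatr_eq0 => /eqP ->.
  by move=> /(subsetP marked); rewrite inE.
- move=> c; apply: (@intr_inj rat); apply: (mulfI zjn); rewrite mulr0.
  rewrite rmorph_sum mulr_sumr /=; transitivity (`|(\det H)%:~R| * (z *m AQ) 0 c).
    rewrite mxE mulr_sumr; apply: eq_bigr => i _; rewrite mxE intrM mulrA mulrA.
    by have [_ ->] := hy i; rewrite natz.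
  by rewrite zA mxE mulr0.
Qed.

(** Each summand has its support inside that of [x], so no new index becomes positive; the factor
    [#|T|] bounds the number of summands. Positivity of [B] covers the entries -1 of the slack
    rows. *)
Lemma small_nonneg_solution (T : finType) (d B : nat) (a : T -> 'I_d -> int) (x : T -> nat) :
  (0 < B)%N -> (forall i c, `|a i c| <= B%:R) ->
  (forall c, 0 <= \sum_i (x i)%:R * a i c) ->
  exists y : T -> nat, [/\ forall i, (0 < y i)%N = (0 < x i)%N,
    forall i, (y i <= #|T| * (d`! * B ^ d))%N & forall c, 0 <= \sum_i (y i)%:R * a i c].
Proof.
move=> B0 ha hx.
(* inequalities become equations by means of one slack variable for each of them *)
pose A : 'M[int]_(#|T| + d, d) := col_mx (\matrix_(i, c) a (enum_val i) c) (- 1%:M).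
pose xs : 'rV[rat]_(#|T| + d) :=
  row_mx (\row_i (x (enum_val i))%:R) (\row_c (\sum_i (x i)%:R * a i c)%:~R).
have hA i c : `|A i c| <= B%:R.
  rewrite mxE; case: split => k; rewrite !mxE //.
  by rewrite normrN; case: eqP => _; rewrite ?normr0 ?normr1 // ler1n.
have xs0 i : 0 <= xs 0 i.
  by rewrite mxE; case: split => k; rewrite mxE ?ler0n // ler0z.
have xsA : xs *m map_mx intr A = 0.
  rewrite map_col_mx mul_row_col; apply/rowP => c; rewrite !mxE.
  rewrite [X in _ + X](bigD1 c) //= [X in _ + (_ + X)]big1; last first.
    by move=> k kc; rewrite !mxE (negbTE kc) oppr0 mulr0.
  rewrite !mxE eqxx addr0 rmorphN mulrN mulr1 rmorph_sum /=.
  rewrite [X in _ - X](reindex_onto enum_val enum_rank) /=; last by move=> *; rewrite enum_rankK.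
  apply/eqP; rewrite subr_eq0; apply/eqP.
  apply: eq_big => [i|i _]; first by rewrite enum_valK eqxx.
  by rewrite !mxE rmorphM /= natz.
have small (j : T) : exists y : T -> nat, (0 < x j)%N -> [/\ (0 < y j)%N,
    forall i, (y i <= d`! * B ^ d)%N, forall i, (0 < y i)%N -> (0 < x i)%N &
    forall c, 0 <= \sum_i (y i)%:R * a i c].
  have [xj|xj] := posnP (x j); first by exists x; rewrite xj.
  pose l i : 'I_(#|T| + d) := lshift d (enum_rank (i : T)).
  have xl i : xs 0 (l i) = (x i)%:R by rewrite row_mxEl mxE enum_rankK.
  have [|y [h1 h2 h3 h4]] := @small_kernel_vector _ d A B (l j) xs B0 hA xs0 _ xsA.
    by rewrite xl ltr0n.
  exists (fun i => y (l i)) => _; split=> //.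
    by move=> i /h3; rewrite xl pnatr_eq0 lt0n.
  move=> c; have := h4 c; rewrite big_split_ord /=.
  rewrite [X in _ + X](bigD1 c) //= [X in _ + (_ + X)]big1; last first.
    by move=> k kc; rewrite col_mxEd !mxE (negbTE kc) oppr0 mulr0.
  rewrite col_mxEd !mxE eqxx addr0 mulrN mulr1 => /eqP; rewrite subr_eq0 => /eqP e.
  rewrite (reindex_onto enum_val enum_rank) /=; last by move=> *; rewrite enum_rankK.
  suff -> : \sum_(k | enum_rank (enum_val k) == k) (y (l (enum_val k)))%:R * a (enum_val k) c =
    (y (rshift #|T| c))%:R by rewrite ler0n.
  rewrite -e; apply: eq_big => [i|i _]; first by rewrite enum_valK eqxx.
  by rewrite col_mxEu mxE /l enum_valK.
have [Y hY] := fin_all_exists small.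
exists (fun i => \sum_(j | (0 < x j)%N) Y j i)%N; split.
- move=> i; apply/idP/idP => h.
    case: (posnP (x i)) => // xi; move: h; rewrite lt0n sum_nat_eq0 negb_forall.
    case/existsP => j; rewrite negb_imply -lt0n => /andP[/hY[_ _ h _] yi].
    by have := h i yi; rewrite xi.
  by have [h1 _ _ _] := hY i h; rewrite (bigD1 i) //= ltn_addr.
- move=> i; rewrite -sum_nat_const big_mkcond /=; apply: leq_sum => j _.
  by case: ifP => // /hY[_ h _ _].
- move=> c; rewrite (_ : \sum_i _ = \sum_(j | (0 < x j)%N) \sum_i (Y j i)%:R * a i c).
    by apply: sumr_ge0 => j /hY[_ _ _ h].
  rewrite exchange_big; apply: eq_bigr => i _ /=.
  by rewrite natr_sum mulr_suml.
Qed.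

End LinearAlgebra.

(** * Models of exponential size *)

Definition nD (Δ : finType) (I : interp Δ) k := card_ext I (cond_D k).
Definition nCD (Δ : finType) (I : interp Δ) k := card_ext I (CAnd (cond_C k) (cond_D k)).

Lemma nCD_le (Δ : finType) (I : interp Δ) k : nCD I k <= nD I k.
Proof. by apply: subset_leq_card; apply/subsetP => x; rewrite !inE /= => /andP[]. Qed.

(** Clearing denominators; absolute values are faithful because the bounds of a well-formed
    conditional are nonnegative. For empty D both counts are 0 and the inequalities hold trivially,
    which absorbs the disjunction. *)
Lemma sat_condE (Δ : finType) (I : interp Δ) k : wf_cond k ->
  sat_cond I k <->
  (absz (numq (cond_l k)) * nD I k <= nCD I k * absz (denq (cond_l k)) /\
   nCD I k * absz (denq (cond_u k)) <= absz (numq (cond_u k)) * nD I k).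
Proof.
case=> l0 [lu u1]; have u0 := le_trans l0 lu.
have numE (q : rat) : (0 <= q)%R -> ((absz (numq q))%:R = (numq q)%:~R :> rat)%R.
  by move=> q0; rewrite natr_absz ger0_norm // numq_ge0.
have denE (q : rat) : ((absz (denq q))%:R = (denq q)%:~R :> rat)%R.
  by rewrite natr_absz ger0_norm // denq_ge0.
have den0 (q : rat) : (0 < (denq q)%:~R :> rat)%R by rewrite ltr0z denq_gt0.
have [z|z] := posnP (nD I k).
  have z' : nCD I k = 0 by apply/eqP; rewrite -leqn0 -z nCD_le.
  by rewrite z z' !muln0 !mul0n; split=> // _; left.
have zr : (0 < (nD I k)%:R :> rat)%R by rewrite ltr0n.
have E1 : (cond_l k <= (nCD I k)%:R / (nD I k)%:R)%R =
    (absz (numq (cond_l k)) * nD I k <= nCD I k * absz (denq (cond_l k))).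
  rewrite ler_pdivlMr // -{1}(divq_num_den (cond_l k)) mulrAC ler_pdivrMr //.
  by rewrite -numE // -denE -!natrM ler_nat.
have E2 : ((nCD I k)%:R / (nD I k)%:R <= cond_u k)%R =
    (nCD I k * absz (denq (cond_u k)) <= absz (numq (cond_u k)) * nD I k).
  rewrite ler_pdivrMr // -{1}(divq_num_den (cond_u k)) mulrAC ler_pdivlMr //.
  by rewrite -numE // -denE -!natrM ler_nat.
rewrite /sat_cond -/(nD I k) -/(nCD I k) E1 E2; split; last by right.
by case=> // e; move: z; rewrite e.
Qed.

(** * Numbers, subconcepts and conditionals against the length of the code *)

Lemma bits_aux_gt f n : n <= f -> n < 2 ^ size (bits_aux f n).
Proof.
elim: f n => [|f IH] [|n] //= h.
have := IH (n.+1./2); rewrite expnS -[in n.+1 < _](odd_double_half n.+1) => hi.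
have {hi}: n.+1./2 < 2 ^ size (bits_aux f n.+1./2) by apply: hi; lia.
by rewrite -muln2; case: (odd _) => /=; lia.
Qed.

Lemma size_numenc n : size (numenc n) = 2 * size (nat_bits n) + 2.
Proof.
by rewrite /numenc size_cat /=; congr (_ + _); elim: (nat_bits n) => //= b s ->; lia.
Qed.

Lemma numenc_gt n : n < 2 ^ size (numenc n).
Proof.
apply: leq_trans (bits_aux_gt (leqnn n)) _; rewrite leq_exp2l // size_numenc /nat_bits; lia.
Qed.

Definition encT (s : seq nat) := flatten (map numenc s).

Lemma encT_cat s1 s2 : encT (s1 ++ s2) = encT s1 ++ encT s2.
Proof. by rewrite /encT map_cat flatten_cat. Qed.

Lemma encT_cons a s : encT (a :: s) = numenc a ++ encT s.
Proof. by []. Qed.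

Lemma size_encT s : size s <= size (encT s).
Proof. by elim: s => //= a s IH; rewrite encT_cons size_cat size_numenc; lia. Qed.

Lemma encT_gt a s : a \in s -> a < 2 ^ size (encT s).
Proof.
elim: s => //= b s IH; rewrite inE encT_cons size_cat expnD => /orP[/eqP <-|/IH h].
  by apply: leq_trans (numenc_gt a) _; rewrite leq_pmulr // expn_gt0.
by apply: leq_trans h _; rewrite leq_pmull // expn_gt0.
Qed.

Lemma in_ser_kb K k a : List.In k K -> a \in ser_cond k -> a \in ser_kb K.
Proof.
move=> hk ha; rewrite inE; apply/orP; right.
elim: K hk => //= k' K IH [->|/IH h]; rewrite mem_cat ?ha ?h ?orbT //.
Qed.

Lemma rat_in_ser k : [/\ absz (numq (cond_l k)) \in ser_cond k,
  absz (denq (cond_l k)) \in ser_cond k, absz (numq (cond_u k)) \in ser_cond k &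
  absz (denq (cond_u k)) \in ser_cond k].
Proof. by rewrite /ser_cond /ser_rat; split; rewrite !mem_cat !inE eqxx !orbT. Qed.

Fixpoint subc (c : concept) : seq concept :=
  c :: match c with
       | CAnd c1 c2 => subc c1 ++ subc c2
       | CEx _ c1 => subc c1
       | _ => [::]
       end.

Lemma subc_self c : List.In c (subc c).
Proof. by case: c => *; left. Qed.

Definition closure_kb (K : kb) : seq concept :=
  flatten [seq subc (CAnd (cond_C k) (cond_D k)) | k <- K].

Lemma In_cat (T : Type) (x : T) s1 s2 : List.In x (s1 ++ s2) <-> List.In x s1 \/ List.In x s2.
Proof. exact: List.in_app_iff. Qed.

Lemma subc_closure K k c : List.In k K ->
  List.In c (subc (CAnd (cond_C k) (cond_D k))) -> List.In c (closure_kb K).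
Proof.
elim: K => // k' K IH [->|hk] h; apply/In_cat; first by left.
by right; apply: IH.
Qed.

Lemma size_subc c : size (subc c) <= size (ser_concept c).
Proof. by elim: c => //= [c1 h1 c2 h2|r c h]; rewrite ?size_cat; lia. Qed.

(** The additional node [CAnd C D] of each conditional is paid for by the four numbers that encode
    its bounds. *)
Lemma size_closure K : size (closure_kb K) <= size (ser_kb K).
Proof.
rewrite /closure_kb /ser_kb /=; apply: leqW.
elim: K => //= k K IH; rewrite ?size_cat /= ?size_cat /=.
by have := size_subc (cond_C k); have := size_subc (cond_D k); lia.
Qed.

Lemma size_kb K : 2 * size K <= size (ser_kb K).
Proof.
rewrite /ser_kb /=; apply: leqW.
by elim: K => //= k K IH; rewrite !size_cat /=; lia.
Qed.

Lemma fact_le_exp d : d`! <= 2 ^ (d * d).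
Proof.
elim: d => // d IH; rewrite factS.
apply: leq_trans (leq_mul (ltn_expl d (isT : 1 < 2)) IH) _.
by rewrite -expnD leq_exp2l //; lia.
Qed.

(** * Types and their multiplicities *)

Section SmallModel.
Variables (Δ : finType) (I : interp Δ) (K : kb) (x0 : Δ).
Hypotheses (wfK : wf_kb K) (modI : is_model I K).

Let cl := closure_kb K.
Let T : finType := {ffun 'I_(size cl) -> bool}.
Definition typ (x : Δ) : T := [ffun i : 'I_(size cl) => ext I (nth CTop cl i) x].
(** The default [x0] concerns unrealised types only, and these always get multiplicity 0. *)
Definition rep (t : T) : Δ := odflt x0 [pick x | typ x == t].

Lemma typ_ext c x y : List.In c cl -> typ x = typ y -> ext I c x = ext I c y.
Proof.
move=> hc e; have [i hi <-] : exists2 i, i < size cl & nth CTop cl i = c.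
  elim: cl hc => //= c' s IH [->|/IH[i hi <-]]; first by exists 0.
  by exists i.+1.
by have := congr1 (fun f : T => f (Ordinal hi)) e; rewrite !ffunE.
Qed.

Lemma rep_typ x : typ (rep (typ x)) = typ x.
Proof.
rewrite /rep; case: pickP => [y /eqP //|/(_ x)]; by rewrite eqxx.
Qed.

Definition mult (t : T) := #|[pred x | typ x == t]|.

Section Blowup.
Variable y : T -> nat.
Hypothesis y_pos : forall t, (0 < y t) = (0 < mult t).

Definition blowT : finType := {t : T & 'I_(y t)}.
(** Each copy behaves like the representative of its type: it is linked to all copies of a type as
    soon as the representative has a successor of that type. *)
Definition blow : interp blowT := {|
  conc := fun a p => conc I a (rep (tag p));
  role := fun r p q => [exists z, role I r (rep (tag p)) z && (typ z == tag q)] |}.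

Lemma blow_ext c (p : blowT) : (forall c', List.In c' (subc c) -> List.In c' cl) ->
  ext blow c p = ext I c (rep (tag p)).
Proof.
elim: c p => [a|//|c1 IH1 c2 IH2|r c IH] p hs //=.
  by rewrite IH1 ?IH2 // => c' h; apply: hs; right; apply/In_cat; [right|left].
have hc : List.In c cl by apply: hs; right; apply: subc_self.
have hs' c' : List.In c' (subc c) -> List.In c' cl by move=> h; apply: hs; right.
apply/existsP/existsP.
  case=> q /andP[/existsP[z /andP[hz /eqP tz]]]; rewrite IH // => hq.
  exists z; rewrite hz /=; rewrite (@typ_ext c z (rep (tag q))) //.
  by rewrite -tz rep_typ.
case=> z /andP[hz cz].
have yz : 0 < y (typ z) by rewrite y_pos; apply/card_gt0P; exists z; rewrite inE.
exists (Tagged (fun t => 'I_(y t)) (Ordinal yz)); rewrite IH //=.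
apply/andP; split; first by apply/existsP; exists z; rewrite hz /=.
by rewrite (@typ_ext c _ z) // rep_typ.
Qed.

Lemma blow_card c : (forall c', List.In c' (subc c) -> List.In c' cl) ->
  card_ext blow c = \sum_t y t * ext I c (rep t).
Proof.
move=> hs; rewrite /card_ext -sum1_card.
rewrite (eq_bigl (fun p : blowT => true && ext I c (rep (tag p)))); last first.
  by move=> p; rewrite inE blow_ext.
rewrite -(sig_big_dep xpredT (fun t _ => ext I c (rep t)) (fun _ _ => 1)) /=.
apply: eq_bigr => t _; case: (ext I c (rep t)); rewrite ?muln1 ?muln0.
  by rewrite sum1_card card_ord.
by rewrite big_pred0.
Qed.

Lemma card_blow : #|{: blowT}| = \sum_t y t.
Proof.
rewrite -sum1_card -(sig_big_dep xpredT (fun _ _ => true) (fun _ _ => 1)) /=.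
by apply: eq_bigr => t _; rewrite sum1_card card_ord.
Qed.

End Blowup.

Lemma sum_mult (F : Δ -> nat) : (forall x y, typ x = typ y -> F x = F y) ->
  \sum_t mult t * F (rep t) = \sum_x F x.
Proof.
move=> hF; rewrite (partition_big typ xpredT) //=; apply: eq_bigr => t _.
rewrite -sum_nat_const; apply: eq_big => [x|x]; first by rewrite inE.
by rewrite inE => /eqP <-; apply: hF; rewrite rep_typ.
Qed.

Lemma card_mult c : List.In c cl -> card_ext I c = \sum_t mult t * ext I c (rep t).
Proof.
move=> hc; rewrite (sum_mult (F := fun x => ext I c x)); last first.
  by move=> x y e; rewrite (typ_ext hc e).
by rewrite /card_ext -sum1_card big_mkcond; apply: eq_bigr => x _; rewrite inE; case: ext.
Qed.

(* (alpha, beta) stands for the constraint  alpha * [C and D] + beta * [D] >= 0;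
   a conditional gives one constraint for each of its bounds. *)
Definition coef (kb : conditional * bool) : int * int :=
  let: (k, b) := kb in
  if b then (- Posz (absz (denq (cond_u k))), Posz (absz (numq (cond_u k))))%R
  else (Posz (absz (denq (cond_l k))), - Posz (absz (numq (cond_l k))))%R.

Lemma coefE k (u v : nat) :
  (absz (numq (cond_l k)) * v <= u * absz (denq (cond_l k)) /\
   u * absz (denq (cond_u k)) <= absz (numq (cond_u k)) * v) <->
  (forall b, 0 <= (coef (k, b)).1 * u%:R + (coef (k, b)).2 * v%:R)%R.
Proof.
split=> [[h1 h2] b|h]; first by rewrite !natz; case: b => /=; lia.
by have := h true; have := h false; rewrite /= !natz; lia.
Qed.

Definition constraints := [seq (k, b) | k <- K, b <- [:: false; true]].

Lemma In_constraints k b : List.In k K -> List.In (k, b) constraints.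
Proof.
rewrite /constraints; elim: (K) => //= k' K' IH [->|/IH h].
  by case: b {IH}; [right; left|left].
by right; right.
Qed.

Lemma constraints_In kb : List.In kb constraints -> List.In kb.1 K.
Proof.
rewrite /constraints; elim: (K) => //= k' K' IH [<-|[<-|/IH h]]; [left|left|right] => //.
Qed.

Lemma size_constraints : size constraints = 2 * size K.
Proof. by rewrite /constraints size_allpairs mulnC. Qed.

Definition kdef := Cond CTop CTop 0%R 0%R.

Definition contrib (kb : conditional * bool) (t : T) : int :=
  ((coef kb).1 * (ext I (CAnd (cond_C kb.1) (cond_D kb.1)) (rep t))%:R +
   (coef kb).2 * (ext I (cond_D kb.1) (rep t))%:R)%R.

Lemma sum_contrib kb (y : T -> nat) : (\sum_t (y t)%:R * contrib kb t =
  (coef kb).1 * (\sum_t y t * ext I (CAnd (cond_C kb.1) (cond_D kb.1)) (rep t))%:R +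
  (coef kb).2 * (\sum_t y t * ext I (cond_D kb.1) (rep t))%:R)%R.
Proof.
rewrite !natr_sum !mulr_sumr -big_split /=; apply: eq_bigr => t _.
by rewrite /contrib !natrM; ring.
Qed.

Let n := size (enc_kb K).

Lemma coef_le k b : List.In k K ->
  (`|(coef (k, b)).1| <= (2 ^ n)%:R /\ `|(coef (k, b)).2| <= (2 ^ n)%:R)%R.
Proof.
move=> hk; have [h1 h2 h3 h4] := rat_in_ser k.
have B a : a \in ser_cond k -> a <= 2 ^ n.
  by move=> /(in_ser_kb hk)/encT_gt/ltnW.
by case: b => /=; rewrite ?normrN !natz !lez_nat; split; apply: B.
Qed.

Lemma satE y : (forall t, (0 < y t) = (0 < mult t)) -> forall k, List.In k K ->
  sat_cond (blow y) k <-> forall b, (0 <= \sum_t (y t)%:R * contrib (k, b) t)%R.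
Proof.
move=> hy k hk; rewrite sat_condE; last exact: wfK.
have hs c : List.In c (subc (CAnd (cond_C k) (cond_D k))) -> List.In c cl.
  exact: subc_closure.
have -> : nCD (blow y) k = \sum_t y t * ext I (CAnd (cond_C k) (cond_D k)) (rep t).
  by apply: blow_card.
have -> : nD (blow y) k = \sum_t y t * ext I (cond_D k) (rep t).
  by apply: blow_card => // c h; apply: hs; right; apply/In_cat; right.
rewrite coefE; split=> h b; first by rewrite sum_contrib; apply: h.
by have := h b; rewrite sum_contrib.
Qed.

(** The multiplicities found in the given model solve the system; this is the solution that gets
    shrunk. *)
Lemma modE k b : List.In k K -> (0 <= \sum_t (mult t)%:R * contrib (k, b) t)%R.
Proof.
move=> hk; have := modI hk; rewrite sat_condE; last exact: wfK.
have hs c : List.In c (subc (CAnd (cond_C k) (cond_D k))) -> List.In c cl.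
  exact: subc_closure.
rewrite sum_contrib -!card_mult; first last.
- by apply/hs/subc_self.
- by apply: hs; right; apply/In_cat; right; apply: subc_self.
by rewrite coefE; apply.
Qed.

Lemma small_model : exists (Δ' : finType) (I' : interp Δ'),
  [/\ 0 < #|Δ'|, is_model I' K & #|Δ'| <= 2 ^ (10 * (n * n))].
Proof.
pose d := size constraints.
pose a (t : T) (c : 'I_d) := contrib (nth (kdef, false) constraints c) t.
have hc (c : 'I_d) : List.In (nth (kdef, false) constraints c) constraints.
  have := ltn_ord c; rewrite {2}/d; move: (c : nat).
  by elim: constraints => // q s IH [|i] //= h; [left|right; apply: IH].
(* A contribution adds up to two coefficients of size at most 2 ^ n, whence the exponent [n.+1]. *)
have ha t c : (`|a t c| <= (2 ^ n.+1)%:R)%R.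
  rewrite /a; case E: (nth _ _ _) (hc c) => [k b] /constraints_In hk.
  have [h1 h2] := coef_le b hk; rewrite /contrib.
  move: (coef (k, b)) h1 h2 => [α β] /= h1 h2.
  by rewrite expnS mul2n -addnn natrD; case: (_ && _); case: (ext _ _ _); lia.
have [||y [y1 y2 y3]] := @small_nonneg_solution T d (2 ^ n.+1) a mult _ ha.
- by rewrite expn_gt0.
- move=> c; rewrite /a; case E: (nth _ _ _) (hc c) => [k b] /constraints_In hk.
  exact: modE.
exists (blowT y), (blow y); split.
- rewrite card_blow lt0n sum_nat_eq0 negb_forall; apply/existsP; exists (typ x0).
  by rewrite -lt0n y1; apply/card_gt0P; exists x0; rewrite inE.
- move=> k hk; apply/satE => // b.
  have [i hi e] : exists2 i, i < d & nth (kdef, false) constraints i = (k, b).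
    have := In_constraints b hk; rewrite /d.
    elim: constraints => //= q s IH [->|/IH[i hi e]]; first by exists 0.
    by exists i.+1.
  by have := y3 (Ordinal hi); rewrite /a /= e.
- rewrite card_blow.
  (* One factor [#|T|] comes from summing over the types, the other from the bound on each
     multiplicity. With d and the size of the closure at most n, the exponent is at most 2n + n ^ 2
     + (n+1) n, below 10 n ^ 2. *)
  apply: (@leq_trans (#|T| * (#|T| * (d`! * (2 ^ n.+1) ^ d)))).
    by rewrite -sum_nat_const; apply: leq_sum.
  have dn : d <= n by rewrite /d size_constraints; apply: leq_trans (size_kb K) (size_encT _).
  have mn : size cl <= n by apply: leq_trans (size_closure K) (size_encT _).
  have n0 : 0 < n by apply: (@leq_trans (size (ser_kb K))) (size_encT _).
  have cT : #|T| = 2 ^ size cl by rewrite card_ffun card_bool card_ord.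
  rewrite cT -expnM; apply: leq_trans (_ : 2 ^ (size cl + (size cl + (d * d + n.+1 * d))) <= _).
    by rewrite !expnD !leq_mul // fact_le_exp.
  by rewrite leq_exp2l //; nia.
Qed.

End SmallModel.

(** * The binary encoding of knowledge bases *)

(** The default values of [tok_val] and [tok_len] on truncated input are chosen so that
    [tok_val_drop] and [tok_len_drop] hold at every position; these recurrences are what the formula
    states. *)
Fixpoint tok_val (w : seq bool) : nat :=
  match w with
  | true :: r => if r is b :: r' then b + 2 * tok_val r' else 0
  | _ => 0
  end.

Fixpoint tok_len (w : seq bool) : nat :=
  match w with
  | true :: r => 2 + (if r is b :: r' then tok_len r' else 2)
  | _ => 2
  end.

Lemma bits_aux_val f n r : n <= f ->
  tok_val (flatten [seq [:: true; b] | b <- bits_aux f n] ++ [:: false; false] ++ r) = n.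
Proof.
elim: f n => [|f IH] [|n] //= h; rewrite IH; last by lia.
by rewrite -[in RHS](odd_double_half n.+1) mul2n.
Qed.

Lemma tok_val_numenc a r : tok_val (numenc a ++ r) = a.
Proof. by rewrite /numenc -catA; apply: bits_aux_val. Qed.

Lemma tok_len_numenc a r : tok_len (numenc a ++ r) = size (numenc a).
Proof.
rewrite /numenc -catA size_cat; elim: (nat_bits a) => //= b s ->; lia.
Qed.

Lemma numenc_inj a b x y : numenc a ++ x = numenc b ++ y -> a = b /\ x = y.
Proof.
move=> e; have ab : a = b by rewrite -(tok_val_numenc a x) e tok_val_numenc.
by split=> //; move/(congr1 (drop (size (numenc a)))): e; rewrite -ab !drop_size_cat.
Qed.

Lemma drop_nth_true (w : seq bool) p : nth false w p -> drop p w = true :: drop p.+1 w.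
Proof.
move=> h; have hp : p < size w by case: (ltnP p (size w)) h => // hp; rewrite nth_default.
by rewrite (drop_nth false hp) h.
Qed.

Lemma tok_val_drop (w : seq bool) p : tok_val (drop p w) =
  if nth false w p then nth false w p.+1 + 2 * tok_val (drop p.+2 w) else 0.
Proof.
case: ifP => [/drop_nth_true ->|h].
  have [hp|hp] := ltnP p.+1 (size w); first by rewrite (drop_nth false hp).
  rewrite (drop_oversize hp) nth_default // (drop_oversize (_ : _ <= p.+2)) //; lia.
by move: h; rewrite -[p]addn0 -nth_drop addn0; case: (drop p w) => [|[] u].
Qed.

Lemma tok_len_drop (w : seq bool) p : tok_len (drop p w) =
  if nth false w p then 2 + tok_len (drop p.+2 w) else 2.
Proof.
case: ifP => [/drop_nth_true ->|h].
  have [hp|hp] := ltnP p.+1 (size w); first by rewrite (drop_nth false hp).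
  rewrite (drop_oversize hp) (drop_oversize (_ : _ <= p.+2)) //; lia.
by move: h; rewrite -[p]addn0 -nth_drop addn0; case: (drop p w) => [|[] u].
Qed.

Lemma tok_val_lt w : tok_val w < 2 ^ size w.
Proof.
have [n] := ubnP (size w); elim: n w => // n IH [|[] [|b w]] //= h; try by rewrite expn_gt0.
have := IH w; rewrite !expnS; move: (2 ^ size w) => X; case: b => /=; lia.
Qed.

Notation encC c := (encT (ser_concept c)).

Lemma encC_name a x : encC (CName a) ++ x = numenc 0 ++ (numenc a ++ x).
Proof. by rewrite !encT_cons -!(catA (numenc _)). Qed.

Lemma encC_top x : encC CTop ++ x = numenc 1 ++ x.
Proof. by rewrite encT_cons -(catA (numenc _)). Qed.

Lemma encC_and c1 c2 x : encC (CAnd c1 c2) ++ x = numenc 2 ++ (encC c1 ++ (encC c2 ++ x)).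
Proof. by rewrite encT_cons encT_cat -(catA (numenc _)) -(catA (encC _)). Qed.

Lemma encC_ex r c x : encC (CEx r c) ++ x = numenc 3 ++ (numenc r ++ (encC c ++ x)).
Proof. by rewrite !encT_cons -!(catA (numenc _)). Qed.

Definition encCE := (encC_name, encC_top, encC_and, encC_ex).

(** Unique readability: the code is prefix-free, so a position determines the concept written there
    and where it ends. *)
Lemma encC_inj c c' x y : encC c ++ x = encC c' ++ y -> c = c' /\ x = y.
Proof.
elim: c c' x y => [a||c1 IH1 c2 IH2|r c IH] [a'||c1' c2'|r' c'] x y;
  rewrite !encCE => /numenc_inj[] // _.
- by move=> /numenc_inj[-> ->].
- by move=> /IH1[-> /IH2[-> ->]].
- by move=> /numenc_inj[-> /IH[-> ->]].
Qed.

(** * The formula *)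

(* The relations to be guessed; p, q, d are positions of bits of the input.
   fVal p v: the number written at p is v;  fNxt p q: the token at p ends at q;
   fEnd p q: the concept written at p ends at q;  fTy p e: element e belongs to it;
   fConc, fRole: the interpretation;  fCn p e v (resp. fCt p e v): v elements below e
   belong to the concept at p (resp. and to the concept following it);
   fK p: a conditional is written at p.
   The formula only unfolds each relation one step in one direction: a guess that
   satisfies it is correct wherever it claims something. *)
Definition fVal p v := FRel 0 p v v.
Definition fNxt p q := FRel 1 p q q.
Definition fEnd p q := FRel 2 p q q.
Definition fConc v e := FRel 3 v e e.
Definition fRole v e e' := FRel 4 v e e'.
Definition fTy p e := FRel 5 p e e.
Definition fCn p e v := FRel 6 p e v.
Definition fCt p e v := FRel 7 p e v.
Definition fK p := FRel 8 p p p.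

Definition fEq x t := FAnd (FLe [:: IVar x] t) (FLe t [:: IVar x]).
Definition fIff f g := FAnd (FImp f g) (FImp g f).
Definition fConst c x := fEq x (nseq c IOne).
Definition fPlus x y c := fEq x (IVar y :: nseq c IOne).
(* variable 0 is the size of the domain *)
Definition fDom e f := FAll e (FImp (FLe [:: IOne; IVar e] [:: IVar 0]) f).

(** The recurrence [tok_val_drop], variables 3 and 4 being the next two positions. *)
Definition axVal := FAll 1 (FAll 2 (FImp (fVal 1 2)
  (FOr (FAnd (FNot (FIn 1)) (fConst 0 2))
    (FAnd (FIn 1) (FEx 3 (FEx 4 (FEx 5 (FAnd (fPlus 3 1 1) (FAnd (fPlus 4 1 2)
      (FAnd (fVal 4 5) (FOr (FAnd (FIn 3) (fEq 2 [:: IOne; IVar 5; IVar 5]))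
         (FAnd (FNot (FIn 3)) (fEq 2 [:: IVar 5; IVar 5]))))))))))))).

Definition axNxt := FAll 1 (FAll 2 (FImp (fNxt 1 2)
  (FOr (FAnd (FNot (FIn 1)) (fPlus 2 1 2))
    (FAnd (FIn 1) (FEx 3 (FAnd (fPlus 3 1 2) (fNxt 3 2))))))).

(** Parsing and semantics in one recursion: a position claimed to start a concept must carry one of
    the tags of [ser_concept], and its row of [fTy] must agree with those of its immediate
    subconcepts. *)
Definition axEnd := FAll 1 (FAll 2 (FImp (fEnd 1 2) (FEx 3 (FAnd (fVal 1 3)
  (FOr (FAnd (fConst 0 3) (FEx 4 (FEx 5 (FAnd (fNxt 1 4) (FAnd (fNxt 4 2) (FAnd (fVal 4 5)
          (fDom 6 (fIff (fTy 1 6) (fConc 5 6)))))))))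
  (FOr (FAnd (fConst 1 3) (FAnd (fNxt 1 2) (fDom 6 (fTy 1 6))))
  (FOr (FAnd (fConst 2 3) (FEx 4 (FEx 5 (FAnd (fNxt 1 4) (FAnd (fEnd 4 5) (FAnd (fEnd 5 2)
          (fDom 6 (fIff (fTy 1 6) (FAnd (fTy 4 6) (fTy 5 6))))))))))
       (FAnd (fConst 3 3) (FEx 4 (FEx 5 (FEx 7 (FAnd (fNxt 1 4) (FAnd (fNxt 4 5)
          (FAnd (fVal 4 7) (FAnd (fEnd 5 2)
          (fDom 6 (fIff (fTy 1 6) (FEx 8 (FAnd (FLe [:: IOne; IVar 8] [:: IVar 0])
             (FAnd (fRole 7 6 8) (fTy 5 8))))))))))))))))))))).

Definition axCn := FAll 1 (FAll 2 (FAll 3 (FImp (fCn 1 2 3)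
  (FOr (FAnd (fConst 0 2) (fConst 0 3))
    (FEx 4 (FEx 5 (FAnd (fPlus 2 4 1) (FAnd (fCn 1 4 5)
      (FOr (FAnd (fTy 1 4) (fPlus 3 5 1)) (FAnd (FNot (fTy 1 4)) (fPlus 3 5 0))))))))))).

(** The conjunction of C and D is not itself written in the input, so its elements are counted from
    the rows of two consecutive concepts. *)
Definition axCt := FAll 1 (FAll 2 (FAll 3 (FImp (fCt 1 2 3)
  (FOr (FAnd (fConst 0 2) (fConst 0 3))
    (FEx 4 (FEx 5 (FEx 6 (FAnd (fEnd 1 6) (FAnd (fPlus 2 4 1) (FAnd (fCt 1 4 5)
      (FOr (FAnd (FAnd (fTy 1 4) (fTy 6 4)) (fPlus 3 5 1))
           (FAnd (FNot (FAnd (fTy 1 4) (fTy 6 4))) (fPlus 3 5 0))))))))))))).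

Definition fRest p := FOr (FNot (FInD p)) (fK p).

(** Variables 1 and 2 are the positions of C and D, 3 to 6 those of the four numbers, with values 8
    to 11, and 7 is where the conditional ends; 12 and 13 are the counts of D and of C with D. *)
Definition axK := FAll 1 (FImp (fK 1)
  (FEx 2 (FEx 3 (FEx 4 (FEx 5 (FEx 6 (FEx 7
  (FAnd (FAnd (fEnd 1 2) (FAnd (fEnd 2 3) (FAnd (fNxt 3 4) (FAnd (fNxt 4 5)
     (FAnd (fNxt 5 6) (FAnd (fNxt 6 7) (fRest 7)))))))
  (FEx 8 (FEx 9 (FEx 10 (FEx 11 (FEx 12 (FEx 13
  (FAnd (FAnd (fVal 3 8) (FAnd (fVal 4 9) (FAnd (fVal 5 10) (FAnd (fVal 6 11)
     (FAnd (fCn 2 0 12) (fCt 1 0 13))))))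
  (FAnd (FLe [:: IMul 8 12] [:: IMul 13 9]) (FLe [:: IMul 13 11] [:: IMul 10 12]))))))))))))))))).

(** The leading number of conditionals is skipped: the list is parsed until the input ends. *)
Definition axRoot := FEx 1 (FEx 2 (FAnd (fConst 0 1) (FAnd (fNxt 1 2) (fRest 2)))).

Definition consistency_fo := FEx 0 (FAnd (FLe [:: IOne] [:: IVar 0])
  (FAnd axVal (FAnd axNxt (FAnd axEnd (FAnd axCn (FAnd axCt (FAnd axK axRoot))))))).

Lemma consistency_fo_noshadow : noshadow [::] consistency_fo.
Proof. by []. Qed.

(** The content of [consistency_fo] freed from variable numbers; both directions of the criterion go
    through it. *)
Record correct_guess N (w : seq bool) (R : nat -> nat -> nat -> nat -> bool) M : Prop := CorrectGuess {
  a_val : forall p v, p < N -> v < N -> R 0 p v v ->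
    ~ nth false w p /\ v = 0 \/
    nth false w p /\ exists u, [/\ u < N, p.+2 < N, R 0 p.+2 u u & v = nth false w p.+1 + 2 * u];
  a_nxt : forall p q, p < N -> q < N -> R 1 p q q ->
    ~ nth false w p /\ q = p + 2 \/ [/\ nth false w p, p.+2 < N & R 1 p.+2 q q];
  a_end : forall p q, p < N -> q < N -> R 2 p q q -> exists c, [/\ c < N, R 0 p c c &
    [\/ c = 0 /\ exists a v, [/\ a < N, v < N, R 1 p a a /\ R 1 a q q, R 0 a v v &
          forall e, e < M -> R 5 p e e = R 3 v e e],
        [/\ c = 1, R 1 p q q & forall e, e < M -> R 5 p e e],
        c = 2 /\ exists a b, [/\ a < N, b < N, R 1 p a a, R 2 a b b /\ R 2 b q q &
          forall e, e < M -> R 5 p e e = R 5 a e e && R 5 b e e] |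
        c = 3 /\ exists a b v, [/\ a < N, b < N, v < N, R 1 p a a /\ R 1 a b b &
          [/\ R 0 a v v, R 2 b q q & forall e, e < M ->
            R 5 p e e <-> exists2 e', e' < M & R 4 v e e' && R 5 b e' e']]]];
  a_cn : forall p e v, p < N -> e < N -> v < N -> R 6 p e v ->
    e = 0 /\ v = 0 \/ exists e1 v1, [/\ v1 < N, e = e1.+1, R 6 p e1 v1 & v = v1 + R 5 p e1 e1];
  a_ct : forall p e v, p < N -> e < N -> v < N -> R 7 p e v ->
    e = 0 /\ v = 0 \/ exists e1 v1 d, [/\ v1 < N, d < N, R 2 p d d, e = e1.+1 &
      R 7 p e1 v1 /\ v = v1 + (R 5 p e1 e1 && R 5 d e1 e1)];
  a_k : forall p, p < N -> R 8 p p p -> exists d l l' u u' p',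
    [/\ [/\ d < N, l < N, l' < N, u < N & u' < N /\ p' < N],
      [/\ R 2 p d d, R 2 d l l, R 1 l l' l', R 1 l' u u & R 1 u u' u'],
      R 1 u' p' p', ~ p' < size w \/ R 8 p' p' p' &
      exists vl vl' vu vu' x y, [/\ [/\ vl < N, vl' < N, vu < N, vu' < N & x < N /\ y < N],
       [/\ R 0 l vl vl, R 0 l' vl' vl', R 0 u vu vu & R 0 u' vu' vu'],
       R 6 d M x, R 7 p M y & vl * x <= y * vl' /\ y * vu' <= vu * x]];
  a_root : exists p, [/\ p < N, R 1 0 p p & ~ p < size w \/ R 8 p p p] }.

Lemma sat_consistency_fo N w R : 0 < N -> sat N w R (fun=> 0) consistency_fo <->
  exists2 M, 0 < M < N & correct_guess N w R M.
Proof.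
move=> N0; split.
  rewrite /consistency_fo /= => -[M hM [M1 [h1 [h2 [h3 [h4 [h5 [h6 h7]]]]]]]].
  rewrite /upd /tval /= in h1 h2 h3 h4 h5 h6 h7 M1.
  exists M; first by lia.
  split.
  - move=> p v hp hv /(h1 p hp v hv)[[h [h' _]]|[h [p1 _ [p2 h8 [u hu]]]]].
      by left; split=> //; lia.
    case=> e1 [e2 [hR h9]]; right; split=> //; exists u.
    have E1 : p1 = p.+1 by lia.
    have E2 : p2 = p.+2 by lia.
    subst p1 p2; split=> //; case: h9 => -[h9 h10]; first by rewrite h9; lia.
    by rewrite (negbTE (introN idP h9)); lia.
  - move=> p q hp hq /(h2 p hp q hq)[[h h']|[h [p2 hp2 [e2 hR]]]].
      by left; split=> //; lia.
    have E2 : p2 = p.+2 by lia.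
    by subst p2; right.
  - move=> p q hp hq /(h3 p hp q hq)[c hc [hR h]]; exists c; split=> //.
    case: h => [[hc0 [a ha [v hv [k1 [k2 [k3 k4]]]]]]|[[hc1 [k1 k2]]|
        [[hc2 [a ha [b hb [k1 [k2 [k3 k4]]]]]]|
         [hc3 [a ha [b hb [v hv [k1 [k2 [k3 [k4 k5]]]]]]]]]]].
    + apply: Or41; split; first by lia.
      exists a, v; split=> // e he; have := k4 e; lia.
    + by apply: Or42; split=> //; [lia|move=> e he; apply: k2; lia].
    + apply: Or43; split; first by lia.
      exists a, b; split=> // e he; have := k4 e; lia.
    + apply: Or44; split; first by lia.
      exists a, b, v; split=> //; split=> // e he; have [||i j] := k5 e; [lia|lia|].
      split.
        by move=> /i[e' _ [l1 [l2 l3]]]; exists e'; [lia|rewrite l2].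
      by case=> e' l1 /andP[l2 l3]; apply: j; exists e'; [lia|split=> //; lia].
  - move=> p e v hp he hv /(h4 p hp e he v hv)[[e1 e2]|[e1 he1 [v1 hv1 [k1 [k2 k3]]]]].
      by left; lia.
    right; exists e1, v1; split=> //; first by lia.
    by case: k3 => -[k3 k4]; [rewrite k3|rewrite (negbTE (introN idP k3))]; lia.
  - move=> p e v hp he hv
      /(h5 p hp e he v hv)[[e1 e2]|[e1 he1 [v1 hv1 [d hd [k0 [k1 [k2 k3]]]]]]].
      by left; lia.
    right; exists e1, v1, d; split=> //; first by lia.
    split=> //; case: k3 => -[k3 k4]; first by case: k3 => -> ->; lia.
    by rewrite (negbTE (introN andP k3)); lia.
  - move=> p hp /(h6 p hp)[d hd [l hl [l' hl' [u hu [u' hu' [p' hp' [k1 k2]]]]]]].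
    exists d, l, l', u, u', p'.
    case: k1 => ? [? [? [? [? [? ?]]]]]; split=> //.
    case: k2 => vl ? [vl' ? [vu ? [vu' ? [x ? [y ? [[? [? [? [? [? ?]]]]] []]]]]]].
    by rewrite !addn0 => hl1 hu1; exists vl, vl', vu, vu', x, y.
  - case: h7 => z _ [p hp [hz [hR h]]]; have E : z = 0 by lia.
    by subst z; exists p.
case=> M /andP[M1 hM] ax.
exists M; first exact: hM.
rewrite /= /upd /tval /=; split; first by lia.
split.
  move=> p hp v hv /(a_val ax hp hv)[[h1 h2]|[h1 [u [k1 k2 k3 k4]]]].
    by left; split=> //; lia.
  right; split=> //; exists p.+1; first by lia.
  exists p.+2; first by [].
  exists u => //; do 2!(split; first by lia); split=> //.
  case: (nth false w p.+1) k4 => k4; [left|right]; split=> //; lia.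
split.
  move=> p hp q hq /(a_nxt ax hp hq)[[h1 h2]|[h1 h2 h3]].
    by left; split=> //; lia.
  by right; split=> //; exists p.+2 => //; split=> //; lia.
split.
  move=> p hp q hq /(a_end ax hp hq)[c [hc hR h]]; exists c => //; split=> //.
  case: h => [[c0 [a [v [k1 k2 [k3 k3'] k4 k5]]]]|[c0 k1 k2]|
              [c0 [a [b [k1 k2 k3 [k4 k4'] k5]]]]|[c0 [a [b [v [k1 k2 k3 [k4 k4'] [k5 k6 k7]]]]]]];
    subst c.
  - left; split; first by lia.
    exists a => //; exists v => //; split=> //; split=> //; split=> // e he1 he.
    by have := k5 e; lia.
  - right; left; split; first by lia.
    by split=> // e he1 he; apply: k2; lia.
  - right; right; left; split; first by lia.
    exists a => //; exists b => //; split=> //; split=> //; split=> // e he1 he.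
    by have := k5 e; lia.
  - right; right; right; split; first by lia.
    exists a => //; exists b => //; exists v => //; split=> //; split=> //; split=> //; split=> // e he1 he.
    have [|i j] := k7 e; first by lia.
    split=> [/i[e' e1 /andP[e2 e3]]|[e' e1 [e2 [e3 e4]]]].
      by exists e'; [lia|split=> //; lia].
    by apply: j; exists e'; [lia|rewrite e3].
split.
  move=> p hp e he v hv /(a_cn ax hp he hv)[[e1 e2]|[e1 [v1 [k1 k2 k3 k4]]]].
    by left; lia.
  right; exists e1; first by lia.
  exists v1 => //; split; first by lia.
  by split=> //; case: (R 5 p e1 e1) k4 => k4; [left|right]; split=> //; lia.
split.
  move=> p hp e he v hv /(a_ct ax hp he hv)[[e1 e2]|[e1 [v1 [d [k1 k2 k3 k4 [k5 k6]]]]]].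
    by left; lia.
  right; exists e1; first by lia.
  exists v1 => //; exists d => //; split=> //; split; first by lia.
  split=> //; case: (boolP (R 5 p e1 e1 && R 5 d e1 e1)) k6 => [/andP k|/andP k] k6;
    [left|right]; split=> //; lia.
split.
  move=> p hp /(a_k ax hp)[d [l [l' [u [u' [p' [[? ? ? ? [? ?]] [? ? ? ? ?] ? ? k]]]]]]].
  exists d => //; exists l => //; exists l' => //; exists u => //; exists u' => //.
  exists p' => //; split=> //.
  case: k => vl [vl' [vu [vu' [x [y [[? ? ? ? [? ?]] [? ? ? ?] ? ? [? ?]]]]]]].
  exists vl => //; exists vl' => //; exists vu => //; exists vu' => //.
  by exists x => //; exists y => //; split=> //; rewrite !addn0.
have [p [hp hR h]] := a_root ax.
by exists 0 => //; exists p => //; split=> //.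
Qed.

Lemma card_ext_ord M (I : interp 'I_M) c (f : nat -> bool) :
  (forall i : 'I_M, ext I c i = f i) -> card_ext I c = \sum_(0 <= i < M) f i.
Proof.
move=> h; rewrite /card_ext -sum1_card big_mkcond big_mkord.
by apply: eq_bigr => i _; rewrite inE h; case: (f i).
Qed.

Lemma drop_drop_cat (w x y : seq bool) p : drop p w = x ++ y -> drop (p + size x) w = y.
Proof. by move=> h; rewrite addnC -drop_drop h drop_size_cat. Qed.

Lemma encT_cond k s : encT (ser_cond k ++ s) =
  encC (cond_C k) ++ (encC (cond_D k) ++
   (numenc (absz (numq (cond_l k))) ++ (numenc (absz (denq (cond_l k))) ++
   (numenc (absz (numq (cond_u k))) ++ (numenc (absz (denq (cond_u k))) ++ encT s))))).
Proof.
rewrite /ser_cond /ser_rat -!(catA (ser_concept _)) !(encT_cat (ser_concept _)).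
by rewrite [in LHS]/= !encT_cons.
Qed.

(** * Soundness: a correct guess contains a model *)

Section Soundness.
Variables (N M : nat) (w : seq bool) (R : nat -> nat -> nat -> nat -> bool).
Hypotheses (MN : M < N) (ax : correct_guess N w R M).

(** Each unfolding reads a bit [true], hence a position inside the input, so what remains of [w]
    bounds the recursion. *)
Lemma val_sound p v : p < N -> v < N -> R 0 p v v -> v = tok_val (drop p w).
Proof.
have [m] := ubnP (size w - p); elim: m p v => // m IH p v hm hp hv.
rewrite tok_val_drop => /(a_val ax hp hv)[[/negP/negbTE -> //]|[h [u [k1 k2 k3 ->]]]].
rewrite h; congr (_ + 2 * _); apply: IH => //.
by case: (ltnP p (size w)) h => hw; [lia|rewrite nth_default].
Qed.

Lemma nxt_sound p q : p < N -> q < N -> R 1 p q q -> q = p + tok_len (drop p w).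
Proof.
have [m] := ubnP (size w - p); elim: m p => // m IH p hm hp hq.
rewrite tok_len_drop => /(a_nxt ax hp hq)[[/negP/negbTE -> //]|[h k1 k2]].
rewrite h (IH p.+2) //; first by lia.
by case: (ltnP p (size w)) h => hw; [lia|rewrite nth_default].
Qed.

Lemma val_numenc p v a r : p < N -> v < N -> R 0 p v v -> drop p w = numenc a ++ r -> v = a.
Proof. by move=> hp hv hR e; rewrite (val_sound hp hv hR) e tok_val_numenc. Qed.

Lemma nxt_numenc p q a r : p < N -> q < N -> R 1 p q q -> drop p w = numenc a ++ r ->
  drop q w = r /\ q = p + size (numenc a).
Proof.
move=> hp hq hR e; rewrite (nxt_sound hp hq hR) e tok_len_numenc; split=> //.
exact: drop_drop_cat e.
Qed.

Definition guessed : interp 'I_M :=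
  {| conc := fun a (x : 'I_M) => R 3 a x x; role := fun r (x y : 'I_M) => R 4 r x y |}.

(** Induction on the concept really written at [p]: its tag leaves only one clause of [a_end]. A
    wrong cyclic claim is impossible, since parsing follows the actual encoding. *)
Lemma end_sound c p q r : p < N -> q < N -> R 2 p q q -> drop p w = encC c ++ r ->
  [/\ drop q w = r, q = p + size (encC c) & forall e : 'I_M, R 5 p e e = ext guessed c e].
Proof.
(* The empty tail lets [encCE] unfold the code inside the size too. *)
have sz : size (encC c) = size (encC c ++ [::]) by rewrite cats0.
rewrite sz {sz}; elim: c p q r => [a||c1 IH1 c2 IH2|rn c IH] p q r hp hq hR; rewrite !encCE => e;
  have [t [ht hv h]] := a_end ax hp hq hR; have et := val_numenc hp ht hv e; subst t;
  rewrite ?(size_cat (numenc _)) ?(size_cat (encC _)).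
- case: h => [[_ [b [v [k1 k2 [k3 k3'] k4 k5]]]]|[]|[]|[]] //.
  have [e1 s1] := nxt_numenc hp k1 k3 e; have [e2 s2] := nxt_numenc k1 hq k3' e1.
  split=> //; first by rewrite s2 s1 [size [::]]/= addn0 addnA.
  move=> x; rewrite k5 //= ; congr (R 3 _ _ _).
  exact: val_numenc k1 k2 k4 e1.
- case: h => [[]|[_ k1 k2]|[]|[]] //.
  have [e1 s1] := nxt_numenc hp hq k1 e; split=> // x; exact: k2.
- case: h => [[]|[]|[_ [b [d [k1 k2 k3 [k4 k4'] k5]]]]|[]] //.
  have [e1 s1] := nxt_numenc hp k1 k3 e.
  have [e2 s2 f2] := IH1 _ _ _ k1 k2 k4 e1; have [e3 s3 f3] := IH2 _ _ _ k2 hq k4' e2.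
  split=> //; first by rewrite s3 s2 s1 ?size_cat [size [::]]/= !addn0 !addnA.
  by move=> x; rewrite k5 // f2 f3.
- case: h => [[]|[]|[]|[_ [b [d [v [k1 k2 k3 [k4 k4'] [k5 k6 k7]]]]]]] //.
  have [e1 s1] := nxt_numenc hp k1 k4 e; have [e2 s2] := nxt_numenc k1 k2 k4' e1.
  have eval_cmd := val_numenc k1 k3 k5 e1; subst v.
  have [e3 s3 f3] := IH _ _ _ k2 hq k6 e2; split=> //.
    by rewrite s3 s2 s1 ?size_cat [size [::]]/= !addn0 !addnA.
  move=> x; have [i j] := k7 x (ltn_ord x); apply/idP/existsP.
    move=> /i[y hy /andP[h1 h2]]; exists (Ordinal hy).
    by apply/andP; split=> //; exact: etrans (esym (f3 (Ordinal hy))) h2.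
  by case=> y /andP[h1 h2]; apply: j; exists (y : nat) => //; apply/andP; split=> //; rewrite f3.
Qed.

Lemma cn_sound p e v : p < N -> e <= M -> v < N -> R 6 p e v ->
  v = \sum_(0 <= i < e) R 5 p i i.
Proof.
move=> hp; elim: e v => [|e IH] v he hv hR.
  have h0 : 0 < N by lia.
  by case: (a_cn ax hp h0 hv hR) => [[_ ->]|[e1 [v1 []]] //]; rewrite big_geq.
have h0 : e.+1 < N by lia.
case: (a_cn ax hp h0 hv hR) => [[] //|[e1 [v1 [k1 [k2] k3 ->]]]].
by subst e1; rewrite big_nat_recr //= -(IH v1) //; lia.
Qed.

(** The end of the first concept is guessed anew at each unfolding, but [end_sound] forces it to be
    [d] every time. *)
Lemma ct_sound c r p d e v : p < N -> d < N -> e <= M -> v < N ->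
  drop p w = encC c ++ r -> R 2 p d d -> R 7 p e v ->
  v = \sum_(0 <= i < e) (R 5 p i i && R 5 d i i).
Proof.
move=> hp hd he hv E hpd; elim: e v he hv => [|e IH] v he hv hR.
  have h0 : 0 < N by lia.
  by case: (a_ct ax hp h0 hv hR) => [[_ ->]|[e1 [v1 [d' []]]] //]; rewrite big_geq.
have h0 : e.+1 < N by lia.
case: (a_ct ax hp h0 hv hR) => [[] //|[e1 [v1 [d' [k1 k2 k3 [k4] [k5 ->]]]]]].
subst e1; rewrite big_nat_recr //= -(IH v1) //; last by lia.
have [_ -> _] := end_sound hp hd hpd E.
by have [_ -> _] := end_sound hp k2 k3 E.
Qed.

Lemma cond_sound ks p : (forall k, List.In k ks -> wf_cond k) -> p < N ->
  drop p w = encT (flatten (map ser_cond ks)) -> ~ p < size w \/ R 8 p p p ->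
  forall k, List.In k ks -> sat_cond guessed k.
Proof.
elim: ks p => // k ks IH p wf hp e hK.
(* The other alternative, the end of the input, is excluded because a conditional remains to be
   read. *)
have {hK} hK : R 8 p p p.
  case: hK => // hK; have := congr1 size e; rewrite size_drop.
  have := size_encT (flatten (map ser_cond (k :: ks))); rewrite /= !size_cat /=; lia.
have [d [l [l' [u [u' [p' [[hd hl hl' hu [hu' hp']] [h1 h2 h3 h4 h5] h6 h7 hv]]]]]]] := a_k ax hp hK.
case: hv => vl [vl' [vu [vu' [x [y [[hvl hvl' hvu hvu' [hx hy]] [g1 g2 g3 g4] g5 g6 [g7 g8]]]]]]].
rewrite [flatten _]/= encT_cond in e.
have [e1 _ f1] := end_sound hp hd h1 e.
have [e2 _ f2] := end_sound hd hl h2 e1.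
have [e3 _] := nxt_numenc hl hl' h3 e2.
have [e4 _] := nxt_numenc hl' hu h4 e3.
have [e5 _] := nxt_numenc hu hu' h5 e4.
have [e6 _] := nxt_numenc hu' hp' h6 e5.
move=> k' [<-|hk']; last first.
  by apply: (IH p') => // k2 hk2; apply: wf; right.
apply/sat_condE; first by apply: wf; left.
rewrite -(val_numenc hl hvl g1 e2) -(val_numenc hl' hvl' g2 e3).
rewrite -(val_numenc hu hvu g3 e4) -(val_numenc hu' hvu' g4 e5).
have -> : nD guessed k = x.
  by rewrite (cn_sound hd (leqnn M) hx g5); apply: card_ext_ord => i; rewrite f2.
have -> : nCD guessed k = y.
  rewrite (ct_sound hp hd (leqnn M) hy e h1 g6); apply: card_ext_ord => i.
  by rewrite f1 f2.
by [].
Qed.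

End Soundness.

Lemma consistency_fo_sound K N R : wf_kb K -> 0 < N -> sat N (enc_kb K) R (fun=> 0) consistency_fo -> consistent K.
Proof.
move=> wfK N0 /(sat_consistency_fo _ _ N0)[M /andP[M0 MN] ax].
exists 'I_M, (guessed M R); split; first by rewrite card_ord.
have [p [hp hR h]] := a_root ax.
have [e _] := @nxt_numenc _ _ _ _ MN ax 0 p (size K) (encT (flatten (map ser_cond K))) N0 hp hR (drop0 _).
exact: (cond_sound MN ax wfK hp e h).
Qed.

(** * Completeness: the guess obtained from a small model *)

Section Completeness.
Variables (K : kb) (Δ : finType) (I : interp Δ) (x0 : Δ) (N : nat).
Hypotheses (wfK : wf_kb K) (modI : is_model I K).
Let w := enc_kb K.
Let M := #|Δ|.
Hypotheses (MN : M < N) (wN : size w + 4 < N) (bN : 2 ^ size w <= N).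

Definition elt (e : nat) : Δ := nth x0 (enum Δ) e.

(** Relations 2, 5, 7 and 8 claim something only where the input really contains such an encoding,
    so every claim unfolds into true ones. The hypotheses on [N] keep positions and values inside
    the range of the quantifiers. *)
Definition intended (i x y z : nat) : bool :=
  match i with
  | 0 => y == tok_val (drop x w)
  | 1 => y == x + tok_len (drop x w)
  | 2 => `[< exists c r, drop x w = encC c ++ r /\ y = x + size (encC c) >]
  | 3 => conc I x (elt y)
  | 4 => role I x (elt y) (elt z)
  | 5 => `[< exists c r, drop x w = encC c ++ r /\ ext I c (elt y) >]
  | 6 => z == \sum_(0 <= j < y) `[< exists c r, drop x w = encC c ++ r /\ ext I c (elt j) >]
  | 7 => `[< exists c d r, drop x w = encC c ++ (encC d ++ r) /\
            z = \sum_(0 <= j < y) ext I (CAnd c d) (elt j) >]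
  | _ => `[< exists k ks, (forall k', List.In k' (k :: ks) -> List.In k' K) /\
            drop x w = encT (flatten (map ser_cond (k :: ks))) >]
  end.

Lemma ty_intended c r p e : drop p w = encC c ++ r -> intended 5 p e e = ext I c (elt e).
Proof.
move=> h; apply/asboolP/idP => [[c' [r' []]]|h']; last by exists c, r.
by rewrite h => /encC_inj[<- _].
Qed.

Lemma drop_lt p (u v : seq bool) : 0 < size u -> drop p w = u ++ v -> p + size u <= size w.
Proof.
move=> hu h; have := congr1 size h; rewrite size_drop size_cat; lia.
Qed.

Lemma numenc_pos a : 0 < size (numenc a).
Proof. by rewrite size_numenc addn2. Qed.

Lemma encC_pos c : 0 < size (encC c).
Proof. by apply: leq_trans (size_encT _); case: c. Qed.

Lemma numenc_intended p a r : drop p w = numenc a ++ r ->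
  [/\ intended 0 p a a, intended 1 p (p + size (numenc a)) (p + size (numenc a)),
      a < N, p + size (numenc a) < N & drop (p + size (numenc a)) w = r].
Proof.
move=> h; have hs := drop_lt (numenc_pos a) h.
rewrite /intended h tok_val_numenc tok_len_numenc !eqxx; split=> //; last exact: drop_drop_cat h.
  apply: leq_trans bN; have := tok_val_lt (drop p w); rewrite h tok_val_numenc => ha.
  apply: leq_trans ha _; rewrite leq_exp2l // -h size_drop; lia.
by lia.
Qed.

Lemma end_intended p c r : drop p w = encC c ++ r ->
  [/\ intended 2 p (p + size (encC c)) (p + size (encC c)),
      p + size (encC c) < N & drop (p + size (encC c)) w = r].
Proof.
move=> h; have hs := drop_lt (encC_pos c) h; split; last exact: drop_drop_cat h.
  by apply/asboolP; exists c, r.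
by lia.
Qed.

Lemma elt_surj (x : Δ) : exists2 e, e < M & elt e = x.
Proof.
exists (index x (enum Δ)); last by rewrite /elt nth_index // mem_enum.
by rewrite /M cardE index_mem mem_enum.
Qed.

Lemma card_ext_elt c : card_ext I c = \sum_(0 <= j < M) ext I c (elt j).
Proof.
rewrite /card_ext -sum1_card big_mkcond /= /M cardE -(big_nth x0 xpredT (fun x => ext I c x : nat)).
rewrite big_enum; apply: eq_bigr => x _; by rewrite inE; case: ext.
Qed.

Lemma card_ext_lt c : card_ext I c < N.
Proof. by apply: leq_ltn_trans MN; apply: max_card. Qed.

Lemma rest_intended p ks : (forall k, List.In k ks -> List.In k K) ->
  drop p w = encT (flatten (map ser_cond ks)) -> ~ p < size w \/ intended 8 p p p.
Proof.
case: ks => [|k ks] hk h.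
  by left; have := congr1 size h; rewrite size_drop /=; lia.
by right; apply/asboolP; exists k, ks.
Qed.

Lemma correct_guess_intended : correct_guess N w intended M.
Proof.
split.
- move=> p v hp hv /eqP ->; rewrite tok_val_drop; case: ifP => h; last by left.
  right; split=> //; exists (tok_val (drop p.+2 w)).
  have hw : p < size w by case: (ltnP p (size w)) h => // hw; rewrite nth_default.
  split=> //; [|by lia|exact/eqP].
  apply: leq_trans bN; apply: leq_trans (tok_val_lt _) _.
  by rewrite leq_exp2l // size_drop; lia.
- move=> p q hp hq /eqP ->; rewrite tok_len_drop; case: ifP => h; last by left.
  have hw : p < size w by case: (ltnP p (size w)) h => // hw; rewrite nth_default.
  by right; split=> //; [lia|apply/eqP; lia].
- move=> p q hp hq /asboolP[c [r [h hq2]]].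
  have E := ty_intended _ h.
  have sz c1 : size (encC c1) = size (encC c1 ++ [::]) by rewrite cats0.
  case: c h hq2 E => [a||c1 c2|rn c] h hq2 E; move: (h); rewrite encCE => h0;
    have [v0 n0 l0 p0 e0] := numenc_intended h0.
  + exists 0; split=> //; apply: Or41; split=> //.
    have [v1 n1 l1 p1 e1] := numenc_intended e0.
    exists (p + size (numenc 0)), a; split=> //; first split=> //.
    rewrite (_ : q = p + size (numenc 0) + size (numenc a)); first exact: n1.
    by rewrite hq2 sz encCE ?(size_cat (numenc _)) ?(size_cat (encC _)) [size [::]]/= addn0 addnA.
  + exists 1; split=> //; apply: Or42; split=> //; last by move=> e _; rewrite E.
    rewrite (_ : q = p + size (numenc 1)); first exact: n0.
    by rewrite hq2 sz encCE ?(size_cat (numenc _)) ?(size_cat (encC _)) [size [::]]/= addn0.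
  + exists 2; split=> //; apply: Or43; split=> //.
    have [n1 p1 e1] := end_intended e0; have [n2 p2 e2] := end_intended e1.
    exists (p + size (numenc 2)), (p + size (numenc 2) + size (encC c1)); split=> //.
      split=> //.
      rewrite (_ : q = p + size (numenc 2) + size (encC c1) + size (encC c2)); first exact: n2.
      by rewrite hq2 sz encCE ?(size_cat (numenc _)) ?(size_cat (encC _)) [size [::]]/= addn0 !addnA.
    by move=> e _; rewrite E (ty_intended _ e0) (ty_intended _ e1).
  + exists 3; split=> //; apply: Or44; split=> //.
    have [v1 n1 l1 p1 e1] := numenc_intended e0; have [n2 p2 e2] := end_intended e1.
    exists (p + size (numenc 3)), (p + size (numenc 3) + size (numenc rn)), rn; split=> //.
    split=> //.
      rewrite (_ : q = p + size (numenc 3) + size (numenc rn) + size (encC c)); first exact: n2.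
      by rewrite hq2 sz encCE ?(size_cat (numenc _)) ?(size_cat (encC _)) [size [::]]/= addn0 !addnA.
    move=> e _; rewrite E /=; split.
      case/existsP => y; have [e' he' <-] := elt_surj y => /andP[h1 h2].
      exists e' => //; apply/andP; split=> //.
      by rewrite -[X in is_true X]/(intended 5 _ e' e') (ty_intended _ e1).
    case=> e' he' /andP[h1 h2]; apply/existsP; exists (elt e').
    by apply/andP; split=> //; rewrite -(ty_intended _ e1).
- move=> p e v hp he hv /eqP hv2; case: e he hv2 => [|e] he hv2.
    by left; rewrite hv2 big_geq.
  right; exists e, (\sum_(0 <= j < e) intended 5 p j j).
  rewrite big_nat_recr //= in hv2; split=> //; last exact/eqP.
  by apply: leq_ltn_trans hv; rewrite hv2 leq_addr.
- move=> p e v hp he hv /asboolP[c [d [r [h hv2]]]]; case: e he hv2 => [|e] he hv2.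
    by left; rewrite hv2 big_geq.
  have [n1 p1 e1] := end_intended h.
  right; exists e, (\sum_(0 <= j < e) ext I (CAnd c d) (elt j)), (p + size (encC c)).
  rewrite big_nat_recr // in hv2; split=> //.
    by apply: leq_ltn_trans hv; rewrite hv2 leq_addr.
  split; first by apply/asboolP; exists c, d, r.
  by rewrite hv2 (ty_intended _ h) (ty_intended _ e1).
- move=> p hp /asboolP[k [ks [hk h]]].
  rewrite [flatten _]/= encT_cond in h.
  have [n1 p1 e1] := end_intended h; have [n2 p2 e2] := end_intended e1.
  have [v3 n3 l3 p3 e3] := numenc_intended e2; have [v4 n4 l4 p4 e4] := numenc_intended e3.
  have [v5 n5 l5 p5 e5] := numenc_intended e4; have [v6 n6 l6 p6 e6] := numenc_intended e5.
  move: n1 n2 p1 p2 v3 n3 p3 v4 n4 p4 v5 n5 p5 v6 n6 p6 e1 e2 e3 e4 e5 e6.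
  set d := p + _; set l := d + _; set l' := l + _; set u := l' + _; set u' := u + _.
  set p' := u' + _ => n1 n2 p1 p2 v3 n3 p3 v4 n4 p4 v5 n5 p5 v6 n6 p6 e1 e2 e3 e4 e5 e6.
  exists d, l, l', u, u', p'; split=> //.
    by apply: rest_intended e6 => k' hk'; apply: hk; right.
  exists (absz (numq (cond_l k))), (absz (denq (cond_l k))), (absz (numq (cond_u k))).
  exists (absz (denq (cond_u k))), (nD I k), (nCD I k).
  have kK : List.In k K by apply: hk; left.
  split=> //.
  + by split=> //; split; apply: card_ext_lt.
  + apply/eqP; rewrite /nD card_ext_elt; apply: eq_bigr => j _.
    by rewrite -(ty_intended _ e1).
  + by apply/asboolP; exists (cond_C k), (cond_D k); eexists; split; [exact: h|exact: card_ext_elt].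
  + by apply/sat_condE; [apply: wfK|apply: modI].
- have h0 : drop 0 w = numenc (size K) ++ encT (flatten (map ser_cond K)) by rewrite drop0.
  have [v0 n0 l0 p0 e0] := numenc_intended h0; rewrite add0n in p0 n0 e0.
  by exists (size (numenc (size K))); split=> //; apply: rest_intended e0.
Qed.

End Completeness.

Lemma leq_add_exp2 a b A B : a <= 2 ^ A -> b <= 2 ^ B -> a + b <= 2 ^ (A + B + 1).
Proof.
move=> ha hb; rewrite addn1 expnS expnD.
have : 0 < 2 ^ A by rewrite expn_gt0.
have : 0 < 2 ^ B by rewrite expn_gt0.
by nia.
Qed.

Lemma size_enc_kb_gt0 K : 0 < size (enc_kb K).
Proof. exact: leq_trans (size_encT (ser_kb K)). Qed.

Theorem theorem2 : in_NExpTime wf_kb enc_kb consistent.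
Proof.
apply: (@fo_in_NExpTime _ _ _ _ consistency_fo 6 consistency_fo_noshadow).
- by move=> K _; apply: size_enc_kb_gt0.
- move=> K wfK [Δ0 [I0 [/card_gt0P[x _] m0]]].
  have [Δ [I [/card_gt0P[x0 _] mI hI]]] := small_model x wfK m0.
  set n := size (enc_kb K) in hI *; have n0 : 0 < n by apply: size_enc_kb_gt0.
  (* Room for the domain, for every number written in the input and for every input position. *)
  pose N := #|Δ| + (2 ^ n + (n + 5)).
  have N0 : 0 < N by rewrite /N; lia.
  exists N, (intended K I x0); split=> //.
    have h5 : n + 5 <= 2 ^ (n + 5) by apply/ltnW/ltn_expl.
    apply: leq_trans (leq_add_exp2 hI (leq_add_exp2 (leqnn (2 ^ n)) h5)) _.
    (* The exponent is 10 n ^ 2 + 2n + 7, at most 16 (n+1) ^ 2; since n is positive, 16 is at most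
       (n+1) ^ 4, whence the degree 6. *)
    rewrite leq_exp2l // (_ : 6 = 4 + 2) // expnD.
    have h16 : 16 <= n.+1 ^ 4 by rewrite (_ : 16 = 2 ^ 4) // leq_exp2r.
    by apply: leq_trans (leq_mul h16 (leqnn (n.+1 ^ 2))); rewrite -mulnn; nia.
  apply/(sat_consistency_fo _ _ N0); exists #|Δ|.
    by apply/andP; split; [apply/card_gt0P; exists x0|rewrite /N; lia].
  by apply: correct_guess_intended => //; rewrite -/n /N; lia.
- move=> K [|N] R wfK; first by case.
  exact: consistency_fo_sound.
Qed.
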